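(* Let $T\in\mathbb N\cup\{\infty\}$ and let $(\phi_{t,T})_{t\in[0,T]\cap\mathbb N}$ be a time-consistent concave monetary utility functional process such that for all $t\in[0,T]\cap\mathbb N$, $$\phi_{t,T}(X)=\operatorname{ess\,inf}_{a\in\mathcal D_{t,T}}\{\langle X,a\rangle_{t,T}-\phi^{\#}_{t,T}(a)\},\qquad X\in\mathcal R^\infty_{t,T}.$$ Then $$\phi^{\#}_{\tau,T}(a)=\operatorname{ess\,sup}_{b\in\mathcal D_{\theta,T}}\phi^{\#}_{\tau,T}\big(a\oplus^\theta_\Omega b\big)+E\big[\phi^{\#}_{\theta,T}(a)\mid\mathcal F_\tau\big]$$ for every pair of finite stopping times $\tau,\theta$ such that $0\le\tau\le\theta\le T$ and all $a\in\mathcal D_{\tau,T}$.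
   Context: Setup. $\mathbb N=\{0,1,2,\dots\}$; $(\Omega,\mathcal F,(\mathcal F_t)_{t\in\mathbb N},P)$ is a filtered probability space with $\mathcal F_0=\{\emptyset,\Omega\}$; stopping times are $(\mathcal F_t)$-stopping times. All equalities and inequalities between random variables or processes (for processes: simultaneously for all $t$) and all equalities and inclusions between events are understood $P$-almost surely. $\mathcal R^0$ is the space of real-valued adapted processes $(X_t)_{t\in\mathbb N}$ (a.s. equal processes are identified); $\mathcal R^\infty$ is the subspace of those with $\sup_{t}|X_t|\le m$ for some $m\in\mathbb R$. For stopping times $0\le\tau<\infty$, $\tau\le\theta\le\infty$, put $\pi_{\tau,\theta}(X)_t:=1_{\{\tau\le t\}}X_{t\wedge\theta}$ and $\mathcal R^\infty_{\tau,\theta}:=\pi_{\tau,\theta}\mathcal R^\infty$. $1_{[\tau,\infty)}$ and $1_{[\tau,\theta)}$ are the processes $t\mapsto1_{\{\tau\le t\}}$ and $t\mapsto1_{\{\tau\le t<\theta\}}$. Dual space. For $a\in\mathcal R^0$ put $a_{-1}:=0$, $\Delta a_t:=a_t-a_{t-1}$, $\|a\|_{\mathcal A^1}:=E[\sum_{t\in\mathbb N}|\Delta a_t|]$. $\mathcal A^1:=\{a\in\mathcal R^0:\|a\|_{\mathcal A^1}<\infty\}$, $\mathcal A^1_+:=\{a\in\mathcal A^1:\Delta a_t\ge0\ \forall t\}$. $\langle X,a\rangle_{\tau,\theta}:=E[\sum_{t\in[\tau,\theta]\cap\mathbb N}X_t\Delta a_t\mid\mathcal F_\tau]$. $(\mathcal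 A^1_{\tau,\theta})_+:=\pi_{\tau,\theta}\mathcal A^1_+$, $\mathcal D_{\tau,\theta}:=\{a\in(\mathcal A^1_{\tau,\theta})_+:\langle1,a\rangle_{\tau,\theta}=1\}$. Functionals. A monetary utility functional on $\mathcal R^\infty_{\tau,\theta}$ is a map $\phi:\mathcal R^\infty_{\tau,\theta}\to L^\infty(\mathcal F_\tau)$ with: (0) $\phi(1_AX)=1_A\phi(X)$ for all $X$ and $A\in\mathcal F_\tau$; (1) $\phi(X)\le\phi(Y)$ whenever $X\le Y$; (2) $\phi(X+m1_{[\tau,\infty)})=\phi(X)+m$ for all $X\in\mathcal R^\infty_{\tau,\theta}$, $m\in L^\infty(\mathcal F_\tau)$. It is concave if (3) $\phi(\lambda X+(1-\lambda)Y)\ge\lambda\phi(X)+(1-\lambda)\phi(Y)$ for all $X,Y$ and $\lambda\in L^\infty(\mathcal F_\tau)$, $0\le\lambda\le1$. For $X\in\mathcal R^\infty$, $\phi(X):=\phi(\pi_{\tau,\theta}(X))$. Processes. A concave monetary utility functional process $(\phi_{t,T})_{t\in[0,T]\cap\mathbb N}$ consists of a concave monetary utility functional $\phi_{t,T}$ on $\mathcal R^\infty_{t,T}$ for each $t$. For a finite stopping time $\tau\le T$ and $X\in\mathcal R^\infty_{\tau,T}$, $\phi_{\tau,T}(X):=\sum_{t\in[0,T]\cap\mathbb N}\phi_{t,T}(1_{\{\tau=t\}}X)$; this is a concave monetary utility functional on $\mathcal R^\infty_{\tau,T}$, with acceptance set $\mathcal C_{\tau,T}:=\{X\in\mathcal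 R^\infty_{\tau,T}:\phi_{\tau,T}(X)\ge0\}$. The process is time-consistent if $\phi_{t,T}(X)=\phi_{t,T}(X1_{[t,\theta)}+\phi_{\theta,T}(X)1_{[\theta,\infty)})$ for each $t\in[0,T]\cap\mathbb N$, every finite stopping time $\theta$ with $t\le\theta\le T$ and all $X\in\mathcal R^\infty_{t,T}$. For a finite stopping time $\theta\le T$ and $a\in\mathcal A^1_+$, $\phi^{\#}_{\theta,T}(a):=\operatorname{ess\,inf}_{X\in\mathcal C_{\theta,T}}\langle X,a\rangle_{\theta,T}$, with values in $[-\infty,0]$ (this formula is used also when $a\in\mathcal D_{\tau,T}$ with $\tau\le\theta$). For measurable $f\le0$ (values in $[-\infty,0]$), $E[f\mid\mathcal F_\tau]:=\lim_{n\to-\infty}E[f\vee n\mid\mathcal F_\tau]$. Concatenation. For $a,b\in\mathcal A^1_+$, a finite stopping time $\theta$ and $A\in\mathcal F_\theta$, $(a\oplus^\theta_Ab)_t:=a_t$ on $\{t<\theta\}\cup A^c\cup\{\langle1,b\rangle_{\theta,\infty}=0\}$ and $(a\oplus^\theta_Ab)_t:=a_{\theta-1}+\frac{\langle1,a\rangle_{\theta,\infty}}{\langle1,b\rangle_{\theta,\infty}}(b_t-b_{\theta-1})$ on $\{t\ge\theta\}\cap A\cap\{\langle1,b\rangle_{\theta,\infty}>0\}$, with $a_{-1}=b_{-1}=0$. *)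

(* Defs.v *)
From HB Require Import structures.
From mathcomp Require Import all_boot all_order all_algebra.
From mathcomp Require Import all_classical all_reals all_analysis.
From mathcomp Require Import measurable_realfun.

Set Implicit Arguments.
Unset Strict Implicit.
Unset Printing Implicit Defensive.

Import Order.TTheory GRing.Theory Num.Theory.
Import numFieldNormedType.Exports.

Local Open Scope classical_set_scope.
Local Open Scope ring_scope.

(* Times in N \cup {oo}; None is oo. *)
Definition natbar : Type := option nat.

Definition natbar_le (u v : natbar) : bool :=
  match u, v with
  | _, None => true
  | None, Some _ => false
  | Some j, Some k => (j <= k)%N
  end.

Definition natbar_min (t : nat) (v : natbar) : nat :=
  if v is Some k then minn t k else t.

Section Prelim.
Context {R : realType} {d : measure_display} {Omega : measurableType d}.
Variable P : probability Omega R.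

Definition process : Type := nat -> Omega -> R.

(* Identities between random variables hold P-a.s., and the null sets need not
   belong to the sub-sigma-algebras. L0 G is therefore the set of all functions
   that are a.s. equal to a G-measurable one; likewise for processes below. *)
Definition measurable_wrt (G : set (set Omega)) (f : Omega -> R) : Prop :=
  forall B : set R, measurable B -> G (f @^-1` B).

Definition L0 (G : set (set Omega)) (f : Omega -> R) : Prop :=
  exists2 g, measurable_wrt G g & f = g %[ae P].

Definition Linf (G : set (set Omega)) (f : Omega -> R) : Prop :=
  L0 G f /\ exists m : R, {ae P, forall w, `|f w| <= m}.

(* Y is a version of E[f | G]; f is an element of L1, i.e. a.s. equal to an
   integrable function. *)
Definition is_condexp (G : set (set Omega)) (f Y : Omega -> R) : Prop :=
  [/\ measurable_wrt G Y,
      P.-integrable setT (EFin \o Y) &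
      exists g : Omega -> R,
        [/\ P.-integrable setT (EFin \o g), f = g %[ae P] &
            forall A, G A ->
              (\int[P]_(w in A) (Y w)%:E = \int[P]_(w in A) (g w)%:E)%E]].

Definition condexp (G : set (set Omega)) (f : Omega -> R) : Omega -> R :=
  xget (fun=> 0) [set Y | is_condexp G f Y].

(* E[f | G] = lim_(n -> -oo) E[f \vee n | G] for f with values in [-oo, 0]. *)
Definition condexp_npos (G : set (set Omega)) (f : Omega -> \bar R)
    (w : Omega) : \bar R :=
  limn (fun n : nat =>
    (condexp G (fun w' => fine (Order.max (f w') (- n%:R)%:E)) w)%:E).

Definition is_essinf (S : set (Omega -> \bar R)) (Y : Omega -> \bar R) : Prop :=
  [/\ measurable_fun setT Y,
      forall f, S f -> {ae P, forall w, (Y w <= f w)%E} &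
      forall Z, measurable_fun setT Z ->
        (forall f, S f -> {ae P, forall w, (Z w <= f w)%E}) ->
        {ae P, forall w, (Z w <= Y w)%E}].

Definition essinf (S : set (Omega -> \bar R)) : Omega -> \bar R :=
  xget (fun=> +oo%E) [set Y | is_essinf S Y].

Definition is_esssup (S : set (Omega -> \bar R)) (Y : Omega -> \bar R) : Prop :=
  [/\ measurable_fun setT Y,
      forall f, S f -> {ae P, forall w, (f w <= Y w)%E} &
      forall Z, measurable_fun setT Z ->
        (forall f, S f -> {ae P, forall w, (f w <= Z w)%E}) ->
        {ae P, forall w, (Y w <= Z w)%E}].

Definition esssup (S : set (Omega -> \bar R)) : Omega -> \bar R :=
  xget (fun=> -oo%E) [set Y | is_esssup S Y].

Variable F : nat -> set (set Omega).

(* As equalities between events hold P-a.s., F_0 = {set0, Omega} says that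
   every event of F_0 is a.s. equal to set0 or to Omega. *)
Record is_filtration : Prop := IsFiltration {
  filtration_sigma : forall t, sigma_algebra setT (F t) ;
  filtration_measurable : forall t, F t `<=` measurable ;
  filtration_mono : forall s t, (s <= t)%N -> F s `<=` F t ;
  filtration_trivial : forall A, F 0%N A -> P A = 0%E \/ P A = 1%E }.

Definition stopping_time (tau : Omega -> natbar) : Prop :=
  forall t : nat, F t [set w | natbar_le (tau w) (Some t)].

Definition stopping_le (tau theta : Omega -> natbar) : Prop :=
  {ae P, forall w, natbar_le (tau w) (theta w)}.

Definition finite_stopping_time (tau : Omega -> natbar) : Prop :=
  stopping_time tau /\ {ae P, forall w, tau w <> None}.

Definition sigma_at (tau : Omega -> natbar) : set (set Omega) :=
  [set A | measurable A /\
     forall t : nat, F t (A `&` [set w | natbar_le (tau w) (Some t)])].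

Definition proc_eq (X Y : process) : Prop :=
  {ae P, forall w, forall t, X t w = Y t w}.

Definition proc_le (X Y : process) : Prop :=
  {ae P, forall w, forall t, X t w <= Y t w}.

(* The space R^0. *)
Definition adapted (X : process) : Prop := forall t, L0 (F t) (X t).

(* The space R^oo. *)
Definition Rinfty (X : process) : Prop :=
  adapted X /\ exists m : R, {ae P, forall w, forall t, `|X t w| <= m}.

Definition proj (tau theta : Omega -> natbar) (X : process) : process :=
  fun t w => if natbar_le (tau w) (Some t)
             then X (natbar_min t (theta w)) w else 0.

Definition Rinfty_on (tau theta : Omega -> natbar) (X : process) : Prop :=
  exists2 Y, Rinfty Y & proc_eq X (proj tau theta Y).

(* a_(t-1), with a_(-1) = 0. *)
Definition prev (a : process) (t : nat) (w : Omega) : R :=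
  if t is s.+1 then a s w else 0.

Definition incr (a : process) (t : nat) (w : Omega) : R := a t w - prev a t w.

(* The integrand is a.s. equal to a measurable function; the integral of a
   nonnegative function is a supremum over measurable simple functions, so it
   does not depend on the version of a. *)
Definition A1_norm (a : process) : \bar R :=
  (\int[P]_w \sum_(0 <= t <oo) `|incr a t w|%:E)%E.

Definition A1 (a : process) : Prop := adapted a /\ (A1_norm a < +oo)%E.

Definition A1_plus (a : process) : Prop :=
  A1 a /\ {ae P, forall w, forall t, 0 <= incr a t w}.

Definition A1_plus_on (tau theta : Omega -> natbar) (a : process) : Prop :=
  exists2 b, A1_plus b & proc_eq a (proj tau theta b).

Definition pairing (tau theta : Omega -> natbar) (X a : process) : Omega -> R :=
  condexp (sigma_at tau) (fun w =>
    limn (series (fun t : nat =>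
      if natbar_le (tau w) (Some t) && natbar_le (Some t) (theta w)
      then X t w * incr a t w else 0))).

Definition one_process : process := fun _ _ => 1.

Definition D_on (tau theta : Omega -> natbar) (a : process) : Prop :=
  A1_plus_on tau theta a /\ pairing tau theta one_process a = cst 1 %[ae P].

(* A functional is a total map on processes, of which only the values on
   R^oo_(tau,theta) are constrained; by cmuf_mono, a.s. equal processes have
   a.s. equal values. *)
Record concave_muf (tau theta : Omega -> natbar)
    (phi : process -> Omega -> R) : Prop := ConcaveMuf {
  cmuf_Linf : forall X, Rinfty_on tau theta X ->
    Linf (sigma_at tau) (phi X) ;
  cmuf_local : forall X A, Rinfty_on tau theta X -> sigma_at tau A ->
    phi (fun t w => \1_A w * X t w) = (fun w => \1_A w * phi X w) %[ae P] ;
  cmuf_mono : forall X Y, Rinfty_on tau theta X -> Rinfty_on tau theta Y ->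
    proc_le X Y -> {ae P, forall w, phi X w <= phi Y w} ;
  cmuf_translation : forall X m, Rinfty_on tau theta X ->
    Linf (sigma_at tau) m ->
    phi (fun t w => X t w + (if natbar_le (tau w) (Some t) then m w else 0))
      = (fun w => phi X w + m w) %[ae P] ;
  cmuf_concave : forall X Y l, Rinfty_on tau theta X ->
    Rinfty_on tau theta Y -> Linf (sigma_at tau) l ->
    {ae P, forall w, 0 <= l w <= 1} ->
    {ae P, forall w, l w * phi X w + (1 - l w) * phi Y w
                     <= phi (fun t w' => l w' * X t w' + (1 - l w') * Y t w') w} }.

Variable T : natbar.

Let horizon : Omega -> natbar := fun=> T.

Definition det_time (t : nat) : Omega -> natbar := fun=> Some t.

Variable phi : nat -> process -> Omega -> R.

Definition concave_muf_process : Prop :=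
  forall t : nat, natbar_le (Some t) T ->
    concave_muf (det_time t) horizon (phi t).

(* phi_(tau,T)(X) = \sum_(t in [0,T]) phi_(t,T)(1_{tau = t} X); a.s. at most
   one term of the sum is nonzero. *)
Definition phi_at (tau : Omega -> natbar) (X : process) : Omega -> R := fun w =>
  limn (series (fun t : nat =>
    if natbar_le (Some t) T
    then phi t (fun s w' => if tau w' == Some t then X s w' else 0) w
    else 0)).

Definition acceptance (tau : Omega -> natbar) : set process :=
  [set X | Rinfty_on tau horizon X /\ {ae P, forall w, 0 <= phi_at tau X w}].

(* phi_(theta,T)(X) for X outside of R^oo_(theta,T) is phi_(theta,T) of the
   projection of X. *)
Definition time_consistent : Prop :=
  forall (t : nat) (theta : Omega -> natbar) (X : process),
    natbar_le (Some t) T ->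
    finite_stopping_time theta ->
    stopping_le (det_time t) theta -> stopping_le theta horizon ->
    Rinfty_on (det_time t) horizon X ->
    phi t X =
    phi t (fun s w =>
      (if natbar_le (Some t) (Some s) && ~~ natbar_le (theta w) (Some s)
       then X s w else 0)
      + (if natbar_le (theta w) (Some s)
         then phi_at theta (proj theta horizon X) w else 0)) %[ae P].

Definition phi_sharp (theta : Omega -> natbar) (a : process) : Omega -> \bar R :=
  essinf [set (fun w => (pairing theta horizon X a w)%:E)
         | X in acceptance theta].

Definition dual_representation : Prop :=
  forall (t : nat) (X : process), natbar_le (Some t) T ->
    Rinfty_on (det_time t) horizon X ->
    (fun w => (phi t X w)%:E) =
    essinf [set (fun w => (pairing (det_time t) horizon X a w)%:E
                          - phi_sharp (det_time t) a w)%E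
           | a in D_on (det_time t) horizon] %[ae P].

Definition concat (theta : Omega -> natbar) (A : set Omega) (a b : process) :
    process := fun t w =>
  let pa := pairing theta (fun=> None) one_process a w in
  let pb := pairing theta (fun=> None) one_process b w in
  if theta w is Some k then
    if `[< (k <= t)%N /\ A w /\ 0 < pb >]
    then prev a k w + pa / pb * (b t w - prev b k w)
    else a t w
  else a t w.

End Prelim.

(* Main.v *)
Require Import Defs.
From HB Require Import structures.
From mathcomp Require Import all_boot all_order all_algebra.
From mathcomp Require Import all_classical all_reals all_analysis.
From mathcomp Require Import measurable_realfun.
From mathcomp Require Import zify ring lra.

Set Implicit Arguments.
Unset Strict Implicit.
Unset Printing Implicit Defensive.

Import Order.TTheory GRing.Theory Num.Theory.
Import numFieldNormedType.Exports.

Local Open Scope classical_set_scope.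
Local Open Scope ring_scope.

Import HBNNSimple.

(** For a stopping time sigma write C_sigma for the positions that are acceptable
    from sigma on and <X, a>_sigma for the pairing on [sigma, T]; the penalty
    phi_sharp sigma a is the essential infimum of <X, a>_sigma over X in C_sigma.

    Time consistency splits C_tau at theta: every X in C_tau is a sum X1 + X2
    where X1 lies in C_tau and is frozen from theta on, X2 lies in C_theta, and
    X1 + Y lies in C_tau for every Y in C_theta ([acc_decomposition]). Since
    <X1 + Y, a>_tau = <X1, a>_tau + E[<Y, a>_theta | F_tau] ([pairing_split]),
    the infimum over C_tau becomes a sum of an infimum over the frozen parts X1
    and an infimum over the tails Y.

    The infimum over the tails is E[phi_sharp theta a | F_tau]. It is a lower
    bound by monotonicity ([condexp_npos_le]). It is the greatest one because
    C_theta is stable under pasting along events of F_theta: some sequence of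
    values <Y j, a>_theta therefore decreases to phi_sharp theta a
    ([phi_sharp_approx]), and dominated convergence applies to its truncations
    ([le_condexp_npos]).

    The infimum over the frozen parts is the essential supremum of
    phi_sharp tau (a (+) b) over b, where a (+) b follows a before theta and
    distributes the remaining mass of a according to b. On positions frozen from
    theta on, a (+) b and a pair in the same way ([pairing_concat_frozen]); hence
    phi_sharp tau (a (+) b) <= <X1, a>_tau for all b, which gives one inequality
    ([phi_sharp_ge]). Conversely, let b be such that <Y, b>_theta >= - eps for all
    Y in C_theta. As the mass that a has left at theta is at most 1 in conditional
    expectation, <X1 + X2, a (+) b>_tau >= <X1, a>_tau - eps
    ([pairing_concat_lower]), so phi_sharp tau (a (+) b) is within eps of the
    infimum ([phi_sharp_le_sum]).

    Such a b exists by the dual representation. At the position 0 it says that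
    the essential infimum of - phi_sharp t b over b is phi_t(0) = 0, so that
    countably many b have penalties of at least - eps on events that cover the whole
    space ([near_optimal_densities]); these are pasted along the events, and
    along the values of theta ([paste_densities], [near_optimal_density]).

    Processes are adapted, bounded or increasing only almost surely. Pairings are
    therefore computed from versions of the increments of a that are measurable,
    nonnegative and summable at every point ([has_dens]), as conditional
    expectations of the sums [Sint X e]. Conditional expectations are used through
    the relation [ce], that is, through integrals over the events of the
    sigma-algebra. *)

(** * Measurability with respect to a family of events *)

Section SubSigma.
Context {d : measure_display} {Omega : measurableType d} {R : realType}.

(** Real-valued functions measurable with respect to G are measurable functions on
    the measurable space (Omega, G). *)
Lemma measurable_wrtP (G : set (set Omega)) (f : Omega -> R) :
  sigma_algebra setT G ->
  measurable_wrt G f <->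
  @measurable_fun _ _ (g_sigma_algebraType G) (measurableTypeR R) setT f.
Proof.
move=> sG; split=> [mf _ B mB|mf B mB].
  by rewrite setTI /measurable/= sigma_algebra_id//; exact: mf.
have := mf measurableT B mB.
by rewrite setTI /measurable/= sigma_algebra_id.
Qed.

Lemma measurable_wrt_fun (G : set (set Omega)) (f : Omega -> R) :
  G `<=` measurable -> measurable_wrt G f -> measurable_fun setT f.
Proof. by move=> GM mf _ B mB; rewrite setTI; apply/GM/mf. Qed.

Lemma sub_measurable_wrt (G H : set (set Omega)) (f : Omega -> R) :
  G `<=` H -> measurable_wrt G f -> measurable_wrt H f.
Proof. by move=> GH mf B mB; apply/GH/mf. Qed.

Section sigma.
Variable G : set (set Omega).
Hypothesis sG : sigma_algebra setT G.

Lemma sigma_algebra_T : G setT.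
Proof. by case: sG => G0 GC _; rewrite -(setD0 setT); exact: GC. Qed.

Lemma sigma_algebra_C A : G A -> G (~` A).
Proof. by case: sG => G0 GC _ GA; rewrite -setTD; exact: GC. Qed.

Lemma sigma_algebra_U A B : G A -> G B -> G (A `|` B).
Proof.
move=> GA GB; rewrite -bigcup2E; case: sG => G0 _; apply => -[|[|n]]//=.
Qed.

Lemma sigma_algebra_I A B : G A -> G B -> G (A `&` B).
Proof.
move=> GA GB; rewrite -(setCK (_ `&` _)) setCI; apply: sigma_algebra_C.
by apply: sigma_algebra_U; exact: sigma_algebra_C.
Qed.

Lemma sigma_algebra_D A B : G A -> G B -> G (A `\` B).
Proof.
by move=> GA GB; rewrite setDE; apply: sigma_algebra_I => //; exact: sigma_algebra_C.
Qed.

Lemma measurable_wrt_cst (c : R) : measurable_wrt G (fun=> c).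
Proof. by apply/measurable_wrtP => //; exact: measurable_cst. Qed.

Lemma measurable_wrtD (f g : Omega -> R) :
  measurable_wrt G f -> measurable_wrt G g -> measurable_wrt G (fun w => f w + g w).
Proof.
move=> /(measurable_wrtP _ sG) mf /(measurable_wrtP _ sG) mg.
by apply/(measurable_wrtP _ sG); exact: measurable_funD.
Qed.

Lemma measurable_wrtM (f g : Omega -> R) :
  measurable_wrt G f -> measurable_wrt G g -> measurable_wrt G (fun w => f w * g w).
Proof.
move=> /(measurable_wrtP _ sG) mf /(measurable_wrtP _ sG) mg.
by apply/(measurable_wrtP _ sG); exact: measurable_funM.
Qed.

Lemma measurable_wrt_max (f g : Omega -> R) :
  measurable_wrt G f -> measurable_wrt G g ->
  measurable_wrt G (fun w => Num.max (f w) (g w)).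
Proof.
move=> /(measurable_wrtP _ sG) mf /(measurable_wrtP _ sG) mg.
by apply/(measurable_wrtP _ sG); exact: measurable_maxr.
Qed.

Lemma measurable_wrt_min (f g : Omega -> R) :
  measurable_wrt G f -> measurable_wrt G g ->
  measurable_wrt G (fun w => Num.min (f w) (g w)).
Proof.
move=> /(measurable_wrtP _ sG) mf /(measurable_wrtP _ sG) mg.
by apply/(measurable_wrtP _ sG); exact: measurable_minr.
Qed.

Lemma measurable_wrt_indic (A : set Omega) :
  G A -> measurable_wrt G (\1_A : Omega -> R).
Proof.
move=> GA; apply/(measurable_wrtP _ sG); apply: measurable_indic.
by rewrite /measurable/= sigma_algebra_id.
Qed.

Lemma measurable_wrt_ltr (f g : Omega -> R) :
  measurable_wrt G f -> measurable_wrt G g -> G [set w | f w < g w].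
Proof.
move=> /(measurable_wrtP _ sG) mf /(measurable_wrtP _ sG) mg.
have := measurable_fun_ltr mf mg => /(_ measurableT [set true] I).
by rewrite setTI /measurable/= sigma_algebra_id.
Qed.

Lemma measurable_wrt_ler (f g : Omega -> R) :
  measurable_wrt G f -> measurable_wrt G g -> G [set w | f w <= g w].
Proof.
move=> mf mg; rewrite (_ : [set _ | _] = ~` [set w | g w < f w]).
  by apply: sigma_algebra_C; exact: measurable_wrt_ltr.
by apply/seteqP; split => w /=; rewrite leNgt => /negP.
Qed.

End sigma.
End SubSigma.

(** * Conditional expectation *)

Section Condexp.
Context {d : measure_display} {Omega : measurableType d} {R : realType}.
Variable P : probability Omega R.
Implicit Types (f g : Omega -> R) (A B : set Omega).

(** Integrable real-valued functions. *)
Definition L1 (f : Omega -> R) := P.-integrable setT (EFin \o f).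

(** Y is a version of E[f | G]. Contrary to [is_condexp], f itself is the function
    that is integrated. *)
Definition ce (G : set (set Omega)) (f Y : Omega -> R) :=
  [/\ measurable_wrt G Y, L1 Y &
      forall A, G A -> (\int[P]_(w in A) (Y w)%:E = \int[P]_(w in A) (f w)%:E)%E].

Lemma L1_measurable f : L1 f -> measurable_fun setT f.
Proof. by move=> /measurable_int /measurable_EFinP. Qed.

Lemma L1_subset f A : measurable A -> L1 f -> P.-integrable A (EFin \o f).
Proof. by move=> mA; exact: integrableS. Qed.

Lemma L1_cst c : L1 (fun=> c).
Proof. exact: finite_measure_integrable_cst. Qed.

Lemma L1D f g : L1 f -> L1 g -> L1 (fun w => f w + g w).
Proof.
move=> Lf Lg; have := integrableD measurableT Lf Lg.
by apply: eq_integrable => // w _ /=; rewrite EFinD.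
Qed.

Lemma L1Z c f : L1 f -> L1 (fun w => c * f w).
Proof.
move=> Lf; have := @integrableZl _ _ _ P setT measurableT c _ Lf.
by apply: eq_integrable.
Qed.

Lemma L1B f g : L1 f -> L1 g -> L1 (fun w => f w - g w).
Proof.
move=> Lf Lg; have := L1D Lf (L1Z (-1) Lg).
by apply: eq_integrable => // w _ /=; rewrite mulN1r.
Qed.

Lemma le_L1 f g : measurable_fun setT f -> (forall w, `|f w| <= g w) ->
  L1 g -> L1 f.
Proof.
move=> mf fg; apply: le_integrable => //; first exact/measurable_EFinP.
by move=> w _ /=; rewrite lee_fin (le_trans (fg w))// ler_norm.
Qed.

Lemma L1_abs f : L1 f -> L1 (fun w => `|f w|).
Proof. exact: integrable_norm. Qed.

Lemma L1_indic f A : measurable A -> L1 f -> L1 (fun w => \1_A w * f w).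
Proof.
move=> mA Lf; apply: (@le_L1 _ (fun w => `|f w|)); last exact: L1_abs.
  apply: measurable_funM; last exact: L1_measurable.
  exact: measurable_indic.
move=> w; rewrite indicE; case: (_ \in _); rewrite ?mul1r ?mul0r ?normr0//.
Qed.

Lemma L1_max f c : L1 f -> L1 (fun w => Num.max (f w) c).
Proof.
move=> Lf; apply: (@le_L1 _ (fun w => `|f w| + `|c|)).
- by apply: measurable_maxr => //; exact: L1_measurable.
- move=> w; case: (leP (f w) c) => _.
    by rewrite lerDr.
  by rewrite lerDl.
- by apply: L1D; [exact: L1_abs|exact: L1_cst].
Qed.

Lemma integral_indicM f A B : measurable A -> measurable B ->
  (\int[P]_(w in B) (\1_A w * f w)%:E = \int[P]_(w in B `&` A) (f w)%:E)%E.
Proof.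
move=> mA mB; rewrite integral_mkcondr; apply: eq_integral => w _ /=.
by rewrite patchE indicE; case: ifP => _; rewrite ?mul1r ?mul0r.
Qed.

Lemma integral_eq_mod_null f A B : measurable A -> measurable B ->
  L1 f -> {ae P, forall w, A w <-> B w} ->
  (\int[P]_(w in A) (f w)%:E = \int[P]_(w in B) (f w)%:E)%E.
Proof.
move=> mA mB Lf AB; have mf := L1_measurable Lf.
rewrite -(setTI A) -(setTI B) -!integral_indicM//.
apply: ae_eq_integral => //.
- by apply/measurable_EFinP; apply: measurable_funM => //; exact: measurable_indic.
- by apply/measurable_EFinP; apply: measurable_funM => //; exact: measurable_indic.
apply: filterS AB => w AB _; congr (_%:E); congr (_ * _).
rewrite !indicE; congr ((_ : bool)%:R).
by apply/idP/idP; rewrite !inE => /AB.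
Qed.

Lemma integral_fin A f : measurable A -> L1 f ->
  (\int[P]_(w in A) (f w)%:E)%E \is a fin_num.
Proof. by move=> mA Lf; apply: integrable_fin_num => //; exact: L1_subset. Qed.

Lemma integralD_L1 A f g : measurable A -> L1 f -> L1 g ->
  (\int[P]_(w in A) (f w + g w)%:E =
   \int[P]_(w in A) (f w)%:E + \int[P]_(w in A) (g w)%:E)%E.
Proof.
move=> mA Lf Lg; under eq_integral do rewrite EFinD.
by apply: integralD => //; exact: L1_subset.
Qed.

Lemma le_integral_L1 A f g : measurable A -> L1 f -> L1 g ->
  {ae P, forall w, f w <= g w} ->
  (\int[P]_(w in A) (f w)%:E <= \int[P]_(w in A) (g w)%:E)%E.
Proof.
move=> mA Lf Lg fg.
have L0 : L1 (fun w => Num.max (g w - f w) 0) by apply: L1_max; exact: L1B.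
have -> : (\int[P]_(w in A) (g w)%:E = \int[P]_(w in A) (f w + Num.max (g w - f w) 0)%:E)%E.
  apply: ae_eq_integral => //.
  - by apply/measurable_EFinP; apply: measurable_funTS; exact: L1_measurable Lg.
  - apply/measurable_EFinP; apply: measurable_funTS; exact: L1_measurable (L1D Lf L0).
  apply: filterS fg => w fg' _; congr EFin.
  by rewrite (max_idPl _) ?subr_ge0// addrC subrK.
rewrite integralD_L1// leeDl//; apply: integral_ge0 => w _.
by rewrite lee_fin le_max lexx orbT.
Qed.

Lemma eq_integral_L1 A f g : measurable A -> L1 f -> L1 g ->
  {ae P, forall w, f w = g w} ->
  (\int[P]_(w in A) (f w)%:E = \int[P]_(w in A) (g w)%:E)%E.
Proof.
move=> mA Lf Lg fg; apply/eqP; rewrite eq_le; apply/andP; split.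
  by apply: le_integral_L1 => //; apply: filterS fg => w ->.
by apply: le_integral_L1 => //; apply: filterS fg => w ->.
Qed.

Lemma integral_ge0_ae A f : measurable A -> L1 f ->
  {ae P, forall w, A w -> 0 <= f w} -> (0 <= \int[P]_(w in A) (f w)%:E)%E.
Proof.
move=> mA Lf f0; rewrite -(setTI A) -integral_indicM// -(integral0 P setT).
apply: le_integral_L1 => //; [exact: L1_cst|exact: L1_indic|].
apply: filterS f0 => w fw; rewrite indicE; case: (boolP (w \in A)) => [|_].
  by rewrite inE mul1r => /fw.
by rewrite mul0r.
Qed.

Lemma L1M_bounded f g (m : R) : measurable_fun setT f -> (forall w, `|f w| <= m) ->
  L1 g -> L1 (fun w => f w * g w).
Proof.
move=> mf bf Lg; apply: (@le_L1 _ (fun w => m * `|g w|)).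
- by apply: measurable_funM => //; exact: L1_measurable Lg.
- by move=> w; rewrite normrM ler_wpM2r.
- by apply: L1Z; exact: L1_abs.
Qed.

Section sub_measure.
Variable G : set (set Omega).
Hypotheses (sG : sigma_algebra setT G) (GM : G `<=` measurable).
Let TG := g_sigma_algebraType G.

Let GM' (A : set TG) : measurable A -> d.-measurable (A : set Omega).
Proof. by rewrite {1}/measurable/= sigma_algebra_id// => /GM. Qed.

(** The restriction of P to G. The two proofs are arguments because the measure
    structure of this function depends on them. *)
Definition sub_measure of sigma_algebra setT G & G `<=` measurable :=
  fun A : set TG => P A.

Let nu := sub_measure sG GM.
Let nu0 : nu set0 = 0%E. Proof. exact: measure0. Qed.
Let nu_ge0 (A : set TG) : (0 <= nu A)%E. Proof. exact: measure_ge0. Qed.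
Let nu_sigma : semi_sigma_additive nu.
Proof.
move=> A mA tA mUA; apply: measure_semi_sigma_additive => //; last exact: GM'.
by move=> i; exact: GM'.
Qed.
HB.instance Definition _ := isMeasure.Build _ _ _ nu nu0 nu_ge0 nu_sigma.
Let nuT : nu setT = 1%E. Proof. exact: probability_setT. Qed.
HB.instance Definition _ := Measure_isProbability.Build _ _ _ nu nuT.

Variable f : Omega -> R.
Hypothesis Lf : L1 f.

(** The charge on G with density f, whose derivative with respect to the
    restriction of P is E[f | G]. *)
Definition sub_charge of L1 f & sigma_algebra setT G & G `<=` measurable :=
  fun A : set TG => (\int[P]_(w in (A : set Omega)) (f w)%:E)%E.

Let ch := sub_charge Lf sG GM.
Let ch0 : ch set0 = 0%E. Proof. exact: integral_set0. Qed.
Let ch_fin (A : set TG) : measurable A -> ch A \is a fin_num.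
Proof.
by move=> /GM' mA; apply: integrable_fin_num => //; exact: L1_subset.
Qed.
Let ch_sigma : semi_sigma_additive ch.
Proof.
move=> A mA tA mUA.
apply: (@charge_semi_sigma_additive _ _ _ (induced_charge Lf)) => //; last exact: GM'.
by move=> i; exact: GM'.
Qed.
HB.instance Definition _ := isCharge.Build _ _ _ ch ch0 ch_fin ch_sigma.

(** The Radon-Nikodym theorem on (Omega, G). *)
Lemma ce_exists : exists Y, ce G f Y.
Proof.
have dom : ch `<< nu.
  apply/null_content_dominatesP => A /GM' mA PA0.
  apply: null_set_integral => //.
  by apply/measurable_EFinP; apply: measurable_funTS; exact: L1_measurable.
pose Z := Radon_Nikodym ch nu.
have Zfin w : Z w \is a fin_num by exact: Radon_Nikodym_fin_num.
have iZ : nu.-integrable setT Z by exact: Radon_Nikodym_integrable.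
have mid : measurable_fun setT (idfun : Omega -> TG).
  by move=> _ B mB; rewrite setTI; exact: GM'.
have mZ : measurable_fun setT Z by exact: measurable_int iZ.
have mY : @measurable_fun _ _ TG (measurableTypeR R) setT (fun w => fine (Z w)).
  by apply: measurableT_comp.
have mY' : measurable_fun setT (Z : Omega -> \bar R).
  have -> : (Z : Omega -> \bar R) = Z \o (idfun : Omega -> TG) by [].
  exact: measurableT_comp.
have pE (A : set TG) (h : TG -> \bar R) : measurable_fun setT h -> (forall w, 0 <= h w)%E ->
    measurable A ->
    (\int[nu]_(w in A) h w = \int[P]_(w in (A : set Omega)) h w)%E.
  move=> mh h0 mA.
  have -> : (\int[nu]_(w in A) h w = \int[pushforward P (idfun : Omega -> TG)]_(w in A) h w)%E.
    by [].
  rewrite ge0_integral_pushforward//; first exact: measurable_funTS.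
have iZ' : P.-integrable setT (Z : Omega -> \bar R).
  apply/integrableP; split => //.
  rewrite -pE//; first by case/integrableP: iZ.
  exact: measurableT_comp.
exists (fun w => fine (Z w)); split.
- exact/measurable_wrtP.
- by apply: eq_integrable iZ' => // w _ /=; rewrite fineK.
- move=> A GA; have mA : measurable (A : set TG).
    by rewrite /measurable/= sigma_algebra_id.
  have -> : (\int[P]_(w in A) (f w)%:E = \int[nu]_(w in (A : set TG)) Z w)%E.
    exact: Radon_Nikodym_integral dom mA.
  rewrite (integralE P) [RHS]integralE.
  rewrite pE//; last exact: measurable_funepos.
  rewrite pE//; last exact: measurable_funeneg.
  have -> // : (fun w : Omega => (fine (Z w))%:E) = Z.
  by apply/funext => w; rewrite fineK.
Qed.
End sub_measure.

Section comparison.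
Variable G : set (set Omega).
Hypotheses (sG : sigma_algebra setT G) (GM : G `<=` measurable).

(** If on every event of G the integral of Y is exceeded by that of some Y n by at
    most e, for every e > 0, then a common lower bound of the Y n is a lower bound of Y. *)
Lemma ae_le_of_integrals (Z : Omega -> \bar R) (Yn : nat -> Omega -> R)
    (Y : Omega -> R) :
  (forall n, measurable_wrt G (Yn n) /\ L1 (Yn n)) ->
  measurable_wrt G Y -> L1 Y ->
  (forall A (e : R), G A -> 0 < e -> exists n,
    (\int[P]_(w in A) (Yn n w)%:E <= \int[P]_(w in A) (Y w)%:E + e%:E)%E) ->
  (forall n, {ae P, forall w, (Z w <= (Yn n w)%:E)%E}) ->
  {ae P, forall w, (Z w <= (Y w)%:E)%E}.
Proof.
move=> hn mY LY hint ZY.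
(* on A k all the Y n exceed Y by at least c k, so A k is a null set *)
pose c k : R := k.+1%:R^-1.
have c0 k : 0 < c k by rewrite invr_gt0.
pose A k := \bigcap_n [set w | Y w + c k <= Yn n w].
have GA k : G (A k).
  rewrite -[A k]setCK setC_bigcap; apply: sigma_algebra_C => //.
  case: (sG) => _ _; apply => n; apply: sigma_algebra_C => //.
  apply: measurable_wrt_ler => //; last by case: (hn n).
  by apply: measurable_wrtD => //; exact: measurable_wrt_cst.
have A0 k : P (A k) = 0%E.
  have mA := GM (GA k).
  have fP : P (A k) \is a fin_num by exact: fin_num_measure.
  suff : ((c k)%:E * P (A k) <= 0)%E.
    by rewrite pmule_rle0 ?lte_fin// measure_le0 => /eqP.
  apply/lee_addgt0Pr => e e0; rewrite add0e.
  have [n hne] := hint _ _ (GA k) e0.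
  have iY : (\int[P]_(w in A k) (Y w)%:E)%E \is a fin_num.
    by apply: integrable_fin_num => //; exact: L1_subset.
  rewrite -(@leeD2lE _ (\int[P]_(w in A k) (Y w)%:E)%E)//.
  apply: le_trans hne.
  rewrite -(integral_cst P mA) -integralD//; first last.
  - exact: finite_measure_integrable_cst.
  - exact: L1_subset.
  apply: le_integral => //.
  - have := @L1_subset _ _ mA (L1D LY (L1_cst (c k))).
    by apply: eq_integrable => // w _ /=; rewrite EFinD.
  - by apply: L1_subset => //; case: (hn n).
  - by move=> w; rewrite inE => Aw; rewrite -EFinD lee_fin; exact: Aw.
have A0' : {ae P, forall w, forall k, ~ A k w}.
  apply: ae_foralln => k; exists (A k); split; [exact/GM/GA|exact: A0|].
  by move=> w /= /contrapT.
apply: filterS2 (ae_foralln ZY) A0' => w Zw nA.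
apply/lee_addgt0Pr => e e0.
have [k ke] : exists k, c k <= e.
  exists (Num.truncn e^-1); rewrite /c invf_ple ?posrE//.
  by rewrite ltW// truncnS_gt.
have [n hne] : exists n, Yn n w < Y w + c k.
  apply: contrapT => /forallNP h; apply: (nA k) => n _ /=.
  by rewrite leNgt; apply/negP/h.
apply: (le_trans (Zw n)); rewrite -EFinD lee_fin; lra.
Qed.

Lemma ce_le f g Y Z : ce G f Y -> ce G g Z ->
  (forall A, G A -> (\int[P]_(w in A) (f w)%:E <= \int[P]_(w in A) (g w)%:E)%E) ->
  {ae P, forall w, Y w <= Z w}.
Proof.
move=> [mY LY YE] [mZ LZ ZE] fg.
suff : {ae P, forall w, ((Y w)%:E <= (Z w)%:E)%E}.
  by apply: filterS => w; rewrite lee_fin.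
apply: (@ae_le_of_integrals _ (fun=> Y)) => //; last by move=> _; exact: aeW.
move=> A e GA e0; exists 0%N; rewrite YE// ZE//.
by apply: (le_trans (fg _ GA)); rewrite leeDl// lee_fin ltW.
Qed.

Lemma ce_unique f g Y Z : ce G f Y -> ce G g Z ->
  (forall A, G A -> (\int[P]_(w in A) (f w)%:E = \int[P]_(w in A) (g w)%:E)%E) ->
  {ae P, forall w, Y w = Z w}.
Proof.
move=> cY cZ fg; apply: filterS2 (ce_le cY cZ _) (ce_le cZ cY _).
- by move=> w YZ ZY; apply/eqP; rewrite eq_le YZ.
- by move=> A GA; rewrite fg.
- by move=> A GA; rewrite fg.
Qed.

Lemma ceD f g Y Z : L1 f -> L1 g -> ce G f Y -> ce G g Z ->
  ce G (fun w => f w + g w) (fun w => Y w + Z w).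
Proof.
move=> Lf Lg [mY LY YE] [mZ LZ ZE]; split.
- exact: measurable_wrtD.
- exact: L1D.
- move=> A GA; have mA := GM GA.
  by rewrite !integralD_L1// YE// ZE.
Qed.

Lemma ce_indic f Y B : G B -> ce G f Y ->
  ce G (fun w => \1_B w * f w) (fun w => \1_B w * Y w).
Proof.
move=> GB [mY LY YE]; split.
- by apply: measurable_wrtM => //; exact: measurable_wrt_indic.
- by apply: L1_indic => //; exact: GM.
- move=> A GA; rewrite !integral_indicM ?YE//; try exact: GM.
  exact: sigma_algebra_I.
Qed.

Lemma condexp_ce f g : L1 g -> f = g %[ae P] -> ce G g (condexp P G f).
Proof.
move=> Lg fg.
have [Y0 [mY0 LY0 Y0E]] := ce_exists sG GM Lg.
have : is_condexp P G f (condexp P G f).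
  apply: (@xgetPex _ (fun=> 0) [set Y | is_condexp P G f Y]).
  by exists Y0; split => //; exists g.
case=> mY LY [g' [Lg' fg' YE]]; split => // A GA; rewrite YE//.
have mA := GM GA.
apply: ae_eq_integral => //.
- by apply/measurable_EFinP; apply: measurable_funTS; exact: L1_measurable.
- by apply/measurable_EFinP; apply: measurable_funTS; exact: L1_measurable.
by apply: filterS2 fg fg' => w fg fg' _; rewrite -fg// fg'.
Qed.

(** A comparison of the integrals of f and g over the events of G extends to
    nonnegative factors Z that are measurable with respect to G, by approximation
    of Z with simple functions. *)
Lemma ge0_le_integralM (f g Z : Omega -> R) :
  measurable_fun setT f -> measurable_fun setT g ->
  (forall w, 0 <= f w) -> (forall w, 0 <= g w) ->
  (forall A, G A -> (\int[P]_(w in A) (f w)%:E <= \int[P]_(w in A) (g w)%:E)%E) ->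
  measurable_wrt G Z -> (forall w, 0 <= Z w) ->
  (\int[P]_w (Z w * f w)%:E <= \int[P]_w (Z w * g w)%:E)%E.
Proof.
move=> mf mg f0 g0 fg mZ Z0.
pose TG := g_sigma_algebraType G.
have mZ' : @measurable_fun _ _ TG _ setT (EFin \o Z).
  by apply/measurable_EFinP/measurable_wrtP.
pose z : {nnsfun TG >-> R}^nat := nnsfun_approx (@measurableT _ TG) mZ'.
have zZ (w : TG) : EFin \o z^~ w @ \oo --> (Z w)%:E.
  apply: cvg_nnsfun_approx => // x _; rewrite lee_fin; exact: Z0.
have znd (w : TG) m n : (m <= n)%N -> z m w <= z n w.
  move=> mn; have := nd_nnsfun_approx (@measurableT _ TG) mZ' mn.
  by move=> /lefP; exact.
pose y n (w : Omega) : R := z n w.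
have mz n : measurable_fun setT (y n).
  apply: (@measurable_wrt_fun _ _ _ G) => //; apply/measurable_wrtP => //.
  exact: (measurable_funP (z n)).
have cvg (h : Omega -> R) : measurable_fun setT h -> (forall w, 0 <= h w) ->
    (\int[P]_w (y n w * h w)%:E)%E @[n --> \oo] --> (\int[P]_w (Z w * h w)%:E)%E.
  move=> mh h0.
  have -> : (\int[P]_w (Z w * h w)%:E =
      \int[P]_w limn (fun n => (y n w * h w)%:E))%E.
    apply: eq_integral => w _; apply/esym/cvg_lim => //.
    under eq_fun do rewrite EFinM.
    by rewrite EFinM; apply: cvgeZr => //; exact: zZ.
  apply: cvg_monotone_convergence => //.
  - by move=> n; apply/measurable_EFinP; exact: measurable_funM.
  - by move=> n w _; rewrite lee_fin mulr_ge0.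
  - by move=> w _ m n mn; rewrite lee_fin ler_wpM2r// znd.
apply: (lee_cvg_to (cvg f mf f0) (cvg g mg g0)); apply: nearW => n.
have E (h : Omega -> R) : measurable_fun setT h -> (forall w, 0 <= h w) ->
  (\int[P]_w (y n w * h w)%:E = \sum_(r \in range (y n))
    r%:E * \int[P]_(w in (y n @^-1` [set r])) (h w)%:E)%E.
  move=> mh h0.
  have mr (r : R) : measurable (y n @^-1` [set r]).
    by rewrite -(setTI (_ @^-1` _)); exact: mz.
  have yE w : y n w = \sum_(r \in range (y n)) r * \1_(y n @^-1` [set r]) w.
    exact: (fimfunE (z n) w).
  have y0 w : 0 <= y n w by exact: (@fun_ge0 _ _ (z n)).
  have fin : finite_set (range (y n)) by exact: (fimfunP (z n)).
  have ind0 r w : 0 <= r * (\1_(y n @^-1` [set r]) w * h w).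
    rewrite indicE; case: (boolP (w \in _)) => [|_]; last by rewrite mul0r mulr0.
    by rewrite inE/= => <-; rewrite mul1r mulr_ge0.
  transitivity (\int[P]_w \sum_(r \in range (y n))
      (r * (\1_(y n @^-1` [set r]) w * h w))%:E)%E.
    apply: eq_integral => w _; rewrite {1}yE.
    rewrite fsumEFin// mulr_fsuml;  congr (_%:E).
    by apply: eq_fsbigr => r _; rewrite mulrA.
  rewrite ge0_integral_fsum//; first last.
  - by move=> r w _; rewrite lee_fin.
  - move=> r; apply/measurable_EFinP; apply: measurable_funM => //.
    by apply: measurable_funM => //; exact: measurable_indic.
  apply: eq_fsbigr => r; rewrite inE => -[w _ <-].
  under eq_integral do rewrite EFinM.
  rewrite ge0_integralZl_EFin//; last first.
  - by apply/measurable_EFinP; apply: measurable_funM => //; exact: measurable_indic.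
  - by move=> x _; rewrite lee_fin mulr_ge0.
  by rewrite integral_indicM// setTI.
rewrite !E//; apply: lee_fsum; first exact: (fimfunP (z n)).
move=> r [w _ <-]; apply: lee_wpmul2l; first by rewrite lee_fin; exact: (@fun_ge0 _ _ (z n)).
apply: fg.
have := @measurable_funPTI _ _ _ _ (z n) [set y n w] (measurable_set1 _).
by rewrite {1}/measurable/= sigma_algebra_id.
Qed.

Lemma ge0_integralM_eq (f g Z : Omega -> R) :
  measurable_fun setT f -> measurable_fun setT g ->
  (forall w, 0 <= f w) -> (forall w, 0 <= g w) ->
  (forall A, G A -> (\int[P]_(w in A) (f w)%:E = \int[P]_(w in A) (g w)%:E)%E) ->
  measurable_wrt G Z -> (forall w, 0 <= Z w) ->
  (\int[P]_w (Z w * f w)%:E = \int[P]_w (Z w * g w)%:E)%E.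
Proof.
move=> mf mg f0 g0 fg mZ Z0; apply/eqP; rewrite eq_le.
by apply/andP; split; apply: ge0_le_integralM => // A GA; rewrite fg.
Qed.

Lemma integralM_ge0 (h Z : Omega -> R) : L1 h ->
  (forall A, G A -> (0 <= \int[P]_(w in A) (h w)%:E)%E) ->
  measurable_wrt G Z -> (forall w, 0 <= Z w) -> L1 (fun w => Z w * h w) ->
  (0 <= \int[P]_w (Z w * h w)%:E)%E.
Proof.
move=> Lh hG mZ Z0 LZh.
pose hp w := Num.max (h w) 0; pose hn w := Num.max (- h w) 0.
have hE w : h w = hp w - hn w.
  rewrite /hp /hn; case: (leP (h w) 0) => hw; case: (leP (- h w) 0) => hw'; lra.
have hp0 w : 0 <= hp w by rewrite /hp le_max lexx orbT.
have hn0 w : 0 <= hn w by rewrite /hn le_max lexx orbT.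
have mh := L1_measurable Lh.
have mhp : measurable_fun setT hp by exact: measurable_maxr.
have mhn : measurable_fun setT hn.
  by apply: measurable_maxr => //; exact: measurable_funN.
have hph w : hp w <= `|h w| by rewrite /hp ge_max ler_norm /=.
have hnh w : hn w <= `|h w| by rewrite /hn ge_max -normrN ler_norm /=.
have Lhp : L1 hp.
  by apply: (le_L1 mhp _ (L1_abs Lh)) => w; rewrite ger0_norm.
have Lhn : L1 hn.
  by apply: (le_L1 mhn _ (L1_abs Lh)) => w; rewrite ger0_norm.
have mZT := measurable_wrt_fun GM mZ.
have LZ (k : Omega -> R) : measurable_fun setT k -> (forall w, 0 <= k w <= `|h w|) ->
    L1 (fun w => Z w * k w).
  move=> mk kh; apply: (le_L1 _ _ (L1_abs LZh)); first exact: measurable_funM.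
  move=> w; have /andP[k0 kw] := kh w.
  by rewrite !normrM ler_wpM2l// (ger0_norm k0).
have LZp : L1 (fun w => Z w * hp w) by apply: LZ => // w; rewrite hp0 hph.
have LZn : L1 (fun w => Z w * hn w) by apply: LZ => // w; rewrite hn0 hnh.
have sub A (k1 k2 : Omega -> R) : measurable A -> L1 k1 -> L1 k2 ->
    (\int[P]_(w in A) (k1 w - k2 w)%:E =
     \int[P]_(w in A) (k1 w)%:E - \int[P]_(w in A) (k2 w)%:E)%E.
  move=> mA L1' L2; under eq_integral do rewrite EFinB.
  by apply: integralB_EFin => //; exact: L1_subset.
under eq_integral do rewrite hE mulrBr.
rewrite sub// sube_ge0; last first.
  by rewrite [X in _ || X]integrable_fin_num ?orbT.
apply: ge0_le_integralM => // A GA; have mA := GM GA.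
have := hG _ GA; under eq_integral do rewrite hE.
rewrite sub// sube_ge0//.
by rewrite [X in _ || X]integrable_fin_num ?orbT//; exact: L1_subset.
Qed.

End comparison.
End Condexp.

(** * Essential infima and suprema *)

Section Essinf.
Context {d : measure_display} {Omega : measurableType d} {R : realType}.
Variable P : probability Omega R.

Lemma einfs0_le (u : (\bar R)^nat) n : (einfs u 0%N <= u n)%E.
Proof. by apply: ereal_inf_lbound; exists n. Qed.

Lemma le_einfs0 (u : (\bar R)^nat) x : (forall n, x <= u n)%E -> (x <= einfs u 0%N)%E.
Proof. by move=> xu; apply: le_ereal_inf_tmp => _ [n _ <-]. Qed.

Lemma rat_between (x y : \bar R) : (x < y)%E ->
  exists q : rat, (x < (ratr q)%:E)%E /\ ((ratr q)%:E <= y)%E.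
Proof.
move: x y => [x| |] [y| |]//=.
- rewrite lte_fin => /rat_in_itvoo[q]; rewrite in_itv/= => /andP[xq qy].
  by exists q; rewrite lte_fin lee_fin ltW.
- have : x < x + 1 by rewrite ltrDl.
  move=> /rat_in_itvoo[q]; rewrite in_itv/= => /andP[xq qy] _.
  by exists q; rewrite lte_fin leey.
- have : y - 1 < y by rewrite ltrBlDr ltrDl.
  move=> /rat_in_itvoo[q]; rewrite in_itv/= => /andP[xq qy] _.
  by exists q; rewrite ltNyr lee_fin ltW.
- by move=> _; exists 0; rewrite ltNyr leey.
Qed.

(** The enumeration of a nonempty countable type, with i0 for the unused codes. *)
Definition unpickle_or {I : countType} (i0 : I) (n : nat) : I := odflt i0 (unpickle n).

Lemma unpickle_orK {I : countType} (i0 i : I) : unpickle_or i0 (pickle i) = i.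
Proof. by rewrite /unpickle_or pickleK. Qed.

(** A nonempty family of events has a countable subfamily whose union contains
    every member of the family up to a null set: take a countable
    subfamily whose union has the greatest probability. *)
Lemma ess_cover (S : set (set Omega)) :
  S !=set0 -> S `<=` measurable ->
  exists A : nat -> set Omega, (forall n, S (A n)) /\
    forall B, S B -> P (B `\` \bigcup_n A n) = 0%E.
Proof.
move=> [B0 SB0] SM.
pose V := [set P (\bigcup_n A n) | A in [set A : nat -> set Omega | forall n, S (A n)]].
pose al := ereal_sup V.
have mU (A : nat -> set Omega) : (forall n, S (A n)) -> measurable (\bigcup_n A n).
  by move=> SA; apply: bigcupT_measurable => n; exact/SM/SA.
have al1 : (al <= 1)%E.
  by apply: ge_ereal_sup => _ [A SA <-]; apply: probability_le1; exact: mU.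
have al0 : (0 <= al)%E.
  apply: (@le_trans _ _ (P (\bigcup_(n : nat) B0))); first exact: measure_ge0.
  by apply: ereal_sup_ubound; exists (fun=> B0).
have alf : al \is a fin_num.
  by rewrite ge0_fin_numE//; apply: le_lt_trans al1 _; rewrite ltry.
have ex (k : nat) : exists A : nat -> set Omega, (forall n, S (A n)) /\
    (al - (k.+1%:R^-1)%:E < P (\bigcup_n A n))%E.
  have /ub_ereal_sup_adherent-/(_ _ alf) [_ [A SA <-] h] : 0 < (k.+1%:R^-1 : R) by rewrite invr_gt0.
  by exists A.
have [A SA] := choice ex.
pose C n := let p := unpickle_or (0%N, 0%N) n in A p.1 p.2.
have SC n : S (C n) by have [h _] := SA (unpickle_or (0%N, 0%N) n).1; exact: h.
have PC : P (\bigcup_n C n) = al.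
  apply/eqP; rewrite eq_le; apply/andP; split.
    by apply: ereal_sup_ubound; exists C.
  apply/lee_subgt0Pr => e e0.
  pose k := Num.truncn e^-1.
  have [Sk hk] := SA k.
  apply: (@le_trans _ _ (P (\bigcup_n A k n))).
    apply: le_trans (ltW hk); rewrite leeB// lee_fin.
    by rewrite invf_ple ?posrE// ltW// truncnS_gt.
  apply: le_measure; rewrite ?inE; [exact: mU|exact: mU|].
  move=> w [n _ An]; exists (pickle (k, n)) => //=.
  by rewrite /C unpickle_orK.
(* adjoining B to the sequence C cannot increase the probability of the union *)
exists C; split => // B SB.
have mB := SM _ SB; have mC := mU _ SC.
have le1 : (P (\bigcup_n C n `|` (B `\` \bigcup_n C n)) <= al)%E.
  apply: ereal_sup_ubound; exists (fun n => if n is m.+1 then C m else B).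
    by case.
  congr (P _); apply/seteqP; split => w.
    move=> [[|n] _ /=]; last by move=> Cw; left; exists n.
    by move=> Bw; case: (pselect ((\bigcup_n C n) w)); [left|right].
  by move=> [[n _ Cn]|[Bw _]]; [exists n.+1|exists 0%N].
move: le1; rewrite measureU//; first last.
- by apply/seteqP; split => // w [? []].
- exact: measurableD.
move=> le1; have : (al + P (B `\` \bigcup_n C n) <= al + 0)%E by rewrite adde0 -{1}PC.
by rewrite leeD2lE// measure_le0 => /eqP.
Qed.

(** The essential infimum of a nonempty family of measurable functions is the
    pointwise infimum of a countable subfamily: for each rational q, countably many
    members suffice to cover the events [f < q] up to null sets. *)
Lemma essinf_seq (S : set (Omega -> \bar R)) :
  S !=set0 -> (forall f, S f -> measurable_fun setT f) ->
  exists f : nat -> Omega -> \bar R, (forall n, S (f n)) /\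
    is_essinf P S (fun w => einfs (fun n => f n w) 0%N).
Proof.
move=> [f0 Sf0] Sm.
pose L (f : Omega -> \bar R) (q : rat) := [set w | (f w < (ratr q)%:E)%E].
have mL f q : S f -> measurable (L f q).
  by move=> /Sm mf; rewrite -(setTI (L f q)); exact: emeasurable_fun_infty_o.
have ex q : exists f : nat -> Omega -> \bar R, (forall n, S (f n)) /\
    forall g, S g -> P (L g q `\` \bigcup_n L (f n) q) = 0%E.
  have [||A [SA hA]] := @ess_cover [set L f q | f in S].
  - by exists (L f0 q); exists f0.
  - by move=> _ [f Sf <-]; exact: mL.
  have /choice[f hf] n : exists f, S f /\ L f q = A n.
    by have [f Sf fA] := SA n; exists f.
  exists f; split => [n|g Sg]; first by case: (hf n).
  under eq_bigcupr do rewrite (hf _).2.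
  by apply: hA; exists g.
have [f hf] := choice ex.
pose h n := let p := unpickle_or (0 : rat, 0%N) n in f p.1 p.2.
have Sh n : S (h n) by have [+ _] := hf (unpickle_or (0 : rat, 0%N) n).1; exact.
exists h; split => //; split.
- by apply: measurable_fun_einfs => n; exact: Sm.
- move=> g Sg.
  have /ae_foralln ae : forall n : nat, {ae P, forall w,
      let q := unpickle_or (0 : rat) n in
      L g q w -> (\bigcup_n L (f q n) q) w}.
    move=> n; set q := unpickle_or _ n.
    exists (L g q `\` \bigcup_n L (f q n) q); split.
    - apply: measurableD; first exact: mL.
      by apply: bigcupT_measurable => m; apply: mL; case: (hf q).
    - by have [_] := hf q; apply.
    - by move=> w /= /not_implyP.
  apply: filterS ae => w hw; rewrite leNgt; apply/negP => /rat_between[q [gq qh]].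
  have := hw (pickle q); rewrite /= unpickle_orK => /(_ gq) [n _].
  rewrite /L /= => fq; move: qh; rewrite leNgt => /negP; apply.
  apply: le_lt_trans (einfs0_le _ (pickle (q, n))) _.
  by rewrite /h unpickle_orK.
- move=> Z mZ hZ; have /ae_foralln : forall n, {ae P, forall w, (Z w <= h n w)%E}.
    by move=> n; exact/hZ/Sh.
  by apply: filterS => w Zw; exact: le_einfs0.
Qed.

Lemma essinfP (S : set (Omega -> \bar R)) :
  S !=set0 -> (forall f, S f -> measurable_fun setT f) ->
  is_essinf P S (essinf P S).
Proof.
move=> S0 Sm; have [f [_ hf]] := essinf_seq S0 Sm.
apply: (@xgetPex _ (fun=> +oo%E) [set Y | is_essinf P S Y]).
by exists (fun w => einfs (fun n => f n w) 0%N).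
Qed.

Lemma is_essinf_unique (S : set (Omega -> \bar R)) Y Z :
  is_essinf P S Y -> is_essinf P S Z -> {ae P, forall w, Y w = Z w}.
Proof.
move=> [mY YS YZ] [mZ ZS ZY]; apply: filterS2 (YZ _ mZ ZS) (ZY _ mY YS) => w.
by move=> zy yz; apply/eqP; rewrite eq_le yz.
Qed.

Lemma esssupP (S : set (Omega -> \bar R)) :
  S !=set0 -> (forall f, S f -> measurable_fun setT f) ->
  is_esssup P S (esssup P S).
Proof.
move=> [f0 Sf0] Sm.
pose S' := [set (fun w => - f w)%E | f in S].
have [||f [_ [mf fS fZ]]] := @essinf_seq S'.
- by exists (fun w => - f0 w)%E; exists f0.
- by move=> _ [f /Sm mf <-]; exact: measurableT_comp.
apply: (@xgetPex _ (fun=> -oo%E) [set Y | is_esssup P S Y]).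
exists (fun w => - einfs (fun n => f n w) 0%N)%E; split.
- exact: measurableT_comp.
- move=> g Sg; have : S' (fun w => - g w)%E by exists g.
  by move=> /fS; apply: filterS => w; rewrite leeNr.
- move=> Z mZ hZ.
  have := fZ (fun w => - Z w)%E; have mZ' : measurable_fun setT (fun w => - Z w)%E.
    exact: measurableT_comp.
  move=> /(_ mZ') h; apply: filterS (h _) => [w|]; first by rewrite leeNl.
  move=> _ [g Sg <-]; apply: filterS (hZ _ Sg) => w.
  by rewrite leeN2.
Qed.

End Essinf.

(** * Stopping times and their sigma-algebras *)

Lemma natbar_le_trans u v s : natbar_le u v -> natbar_le v s -> natbar_le u s.
Proof. by move: u v s => [u|] [v|] [s|] //=; exact: leq_trans. Qed.

Lemma natbar_le_min (s T : natbar) t : natbar_le s T ->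
  natbar_le s (Some (natbar_min t T)) = natbar_le s (Some t).
Proof. by move: s T => [s|] [k|] //= sk; rewrite leq_min sk andbT. Qed.

Lemma natbar_min_idem (T : natbar) t : natbar_min (natbar_min t T) T = natbar_min t T.
Proof. by case: T => [k|] //=; rewrite -minnA minnn. Qed.

Lemma natbar_min_le (T : natbar) t : (natbar_min t T <= t)%N.
Proof. by case: T => [k|] //=; rewrite geq_minl. Qed.

(** x vanishes before s and is constant from T on; the shape of the paths of
    positions on [s, T]. *)
Definition stopped {R : realType} (T s : natbar) (x : nat -> R) : Prop :=
  forall t, x t = if natbar_le s (Some t) then x (natbar_min t T) else 0.

Section L0.
Context {d : measure_display} {Omega : measurableType d} {R : realType}.
Variable P : probability Omega R.

Lemma L0_ae (G : set (set Omega)) (f g : Omega -> R) :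
  {ae P, forall w, f w = g w} -> L0 P G f -> L0 P G g.
Proof.
move=> fg [h mh fh]; exists h => //.
by apply: filterS2 fg fh => w fg' fh' _; rewrite -fg' fh'.
Qed.

Lemma L0_wrt (G : set (set Omega)) (f : Omega -> R) : measurable_wrt G f -> L0 P G f.
Proof. by move=> mf; exists f => //; exact: aeW. Qed.

Lemma L0_ex (G : set (set Omega)) (f : Omega -> R) : L0 P G f ->
  exists2 g, measurable_wrt G g & {ae P, forall w, f w = g w}.
Proof. by move=> [g mg fg]; exists g => //; apply: filterS fg => w h; exact: h. Qed.

Lemma L0_sub (G H : set (set Omega)) (f : Omega -> R) : G `<=` H -> L0 P G f -> L0 P H f.
Proof. by move=> GH [g mg fg]; exists g => //; exact: sub_measurable_wrt mg. Qed.

Section sigma.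
Variable G : set (set Omega).
Hypothesis sG : sigma_algebra setT G.

Lemma L0_cst (c : R) : L0 P G (fun=> c).
Proof. by apply: L0_wrt; exact: measurable_wrt_cst. Qed.

Lemma L0D (f g : Omega -> R) : L0 P G f -> L0 P G g -> L0 P G (fun w => f w + g w).
Proof.
move=> /L0_ex[f' mf ff'] /L0_ex[g' mg gg'].
exists (fun w => f' w + g' w); first exact: measurable_wrtD.
by apply: filterS2 ff' gg' => w -> ->.
Qed.

Lemma L0M (f g : Omega -> R) : L0 P G f -> L0 P G g -> L0 P G (fun w => f w * g w).
Proof.
move=> /L0_ex[f' mf ff'] /L0_ex[g' mg gg'].
exists (fun w => f' w * g' w); first exact: measurable_wrtM.
by apply: filterS2 ff' gg' => w -> ->.
Qed.

Lemma L0_indic (A : set Omega) : G A -> L0 P G (\1_A : Omega -> R).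
Proof. by move=> GA; apply: L0_wrt; exact: measurable_wrt_indic. Qed.

Lemma L0_sum (I : Type) (s : seq I) (f : I -> Omega -> R) :
  (forall i, L0 P G (f i)) -> L0 P G (fun w => \sum_(i <- s) f i w).
Proof.
move=> Lf; elim: s => [|i s IH].
  by under eq_fun do rewrite big_nil; exact: L0_cst.
by under eq_fun do rewrite big_cons; exact: L0D.
Qed.

End sigma.
End L0.

Section Stopping.
Context {R : realType} {d : measure_display} {Omega : measurableType d}.
Variables (P : probability Omega R) (F : nat -> set (set Omega)).
Hypothesis hF : is_filtration P F.

Let sF t : sigma_algebra setT (F t) := filtration_sigma hF t.

Lemma F_measurable t A : F t A -> measurable A.
Proof. exact: (filtration_measurable hF). Qed.

Lemma F_mono s t A : (s <= t)%N -> F s A -> F t A.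
Proof. by move=> st; exact: (filtration_mono hF st). Qed.

Lemma F_set0 t : F t set0. Proof. by case: (sF t). Qed.

Lemma F_bigcup t (A : nat -> set Omega) :
  (forall n, F t (A n)) -> F t (\bigcup_n A n).
Proof. by case: (sF t) => _ _; exact. Qed.

Section one.
Variable tau : Omega -> natbar.
Hypothesis st : stopping_time F tau.

Lemma stopping_eq t : F t [set w | tau w = Some t].
Proof.
rewrite (_ : [set _ | _] = [set w | natbar_le (tau w) (Some t)] `\`
    (if t is s.+1 then [set w | natbar_le (tau w) (Some s)] else set0)).
  apply: (sigma_algebra_D (sF _)) => //.
  by case: t => [|t]; [exact: F_set0|apply: F_mono (st t)].
apply/seteqP; split => w /=.
  move=> E; rewrite E; split => //=; case: t E => [|t] E //=.
  by rewrite E /= ltnn.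
case: t => [|t] /=; case: (tau w) => [k|] [] //=.
  by rewrite leqn0 => /eqP ->.
by move=> kt /negP; rewrite -ltnNge => tk; congr Some; lia.
Qed.

(** The converse of [sigma_at_eq]. The measurability of A is not redundant, because
    A may meet [tau = oo]. *)
Lemma sigma_atP A : measurable A ->
  (forall t, F t (A `&` [set w | tau w = Some t])) -> sigma_at F tau A.
Proof.
move=> mA hA; split => // t.
rewrite (_ : _ `&` _ = \bigcup_n (if (n <= t)%N then A `&` [set w | tau w = Some n] else set0)).
  apply: F_bigcup => n; case: ifPn => nt; last exact: F_set0.
  exact: F_mono (hA n).
apply/seteqP; split => w /=.
  by case E : (tau w) => [k|] [Aw kt] //; exists k => //=; rewrite (kt : (k <= t)%N).
by move=> [n _]; case: ifPn => // nt [Aw /= ->].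
Qed.

(** Membership in sigma_at tau is tested on the events [tau = t]. *)
Lemma sigma_at_eq A t : sigma_at F tau A -> F t (A `&` [set w | tau w = Some t]).
Proof.
move=> [mA hA].
rewrite (_ : _ `&` _ = (A `&` [set w | natbar_le (tau w) (Some t)]) `&` [set w | tau w = Some t]).
  by apply: (sigma_algebra_I (sF _)) => //; exact: stopping_eq.
by apply/seteqP; split => w /=; [move=> [Aw ->]; split => //; split => //=|move=> [[]]].
Qed.

Lemma sigma_at_sub A t : F t A -> A `<=` [set w | tau w = Some t] -> sigma_at F tau A.
Proof.
move=> FA At; apply: sigma_atP; first exact: F_measurable FA.
move=> s; case: (eqVneq s t) => [->|st'].
  by apply: (sigma_algebra_I (sF _)) => //; exact: stopping_eq.
rewrite (_ : _ `&` _ = set0); first exact: F_set0.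
by apply/seteqP; split => // w [/At /= ->] [] /eqP; rewrite eq_sym (negbTE st').
Qed.

Lemma sigma_at_sigma : sigma_algebra setT (sigma_at F tau).
Proof.
split.
- by split => // t; rewrite set0I; exact: F_set0.
- move=> A [mA hA]; split; first exact: measurableD.
  move=> t; rewrite (_ : _ `&` _ = [set w | natbar_le (tau w) (Some t)] `\`
    (A `&` [set w | natbar_le (tau w) (Some t)])).
    by apply: (sigma_algebra_D (sF _)) => //; exact: st.
  apply/seteqP; split => w /=; first by move=> [[_ nA] tw]; split => // -[].
  by move=> [tw nA]; split => //; split => // Aw; exact: nA.
- move=> A hA; split; first by apply: bigcupT_measurable => n; case: (hA n).
  by move=> t; rewrite setI_bigcupl; apply: F_bigcup => n; case: (hA n).
Qed.

Lemma sigma_at_measurable : sigma_at F tau `<=` measurable.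
Proof. by move=> A []. Qed.

Lemma stopping_measurable t : measurable [set w | natbar_le (tau w) (Some t)].
Proof. exact: F_measurable (st t). Qed.

Lemma measurable_wrt_from (f : Omega -> R) t : measurable_wrt (sigma_at F tau) f ->
  measurable_wrt (F t) (fun w => if natbar_le (tau w) (Some t) then f w else 0).
Proof.
move=> mf B mB; have [_ /(_ t) h] := mf B mB.
rewrite (_ : _ @^-1` B = (f @^-1` B `&` [set w | natbar_le (tau w) (Some t)]) `|`
   ((fun=> 0 : R) @^-1` B `&` ~` [set w | natbar_le (tau w) (Some t)])).
  apply: (sigma_algebra_U (sF _)) => //; apply: sigma_algebra_I => //.
    exact: (measurable_wrt_cst (sF _)).
  by apply: (sigma_algebra_C (sF _)) => //; exact: st.
apply/seteqP; split => w /=.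
  by case: ifPn => h'; [left|right; split => //; exact/negP].
by case=> [[? ->]//|[? /negP/negbTE ->]].
Qed.

Lemma L0_from (f : Omega -> R) t : L0 P (sigma_at F tau) f ->
  L0 P (F t) (fun w => if natbar_le (tau w) (Some t) then f w else 0).
Proof.
move=> /L0_ex[g mg fg].
exists (fun w => if natbar_le (tau w) (Some t) then g w else 0).
  exact: measurable_wrt_from.
by apply: filterS fg => w ->.
Qed.

(** Gluing along the values of a stopping time. *)
Lemma measurable_wrt_pieces (v : nat -> Omega -> R) :
  (forall t, measurable_wrt (F t) (v t)) ->
  measurable_wrt (sigma_at F tau) (fun w => if tau w is Some t then v t w else 0).
Proof.
move=> mv B mB; set f := (f in f @^-1` B).
have E t : f @^-1` B `&` [set w | tau w = Some t] = v t @^-1` B `&` [set w | tau w = Some t].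
  by apply/seteqP; split => w /=; rewrite /f => -[+ tw]; rewrite tw.
have h t : F t (f @^-1` B `&` [set w | tau w = Some t]).
  by rewrite E; apply: (sigma_algebra_I (sF _)) => //; [exact: mv|exact: stopping_eq].
apply: sigma_atP => //.
rewrite (_ : f @^-1` B = (\bigcup_t (f @^-1` B `&` [set w | tau w = Some t])) `|`
   ((fun=> 0 : R) @^-1` B `&` ~` (\bigcup_t [set w | tau w = Some t]))).
  apply: measurableU; first by apply: bigcupT_measurable => t; exact: F_measurable (h t).
  apply: measurableI; first by rewrite -(setTI (_ @^-1` _)); exact: measurable_cst.
  apply: measurableC; apply: bigcupT_measurable => t; exact: F_measurable (stopping_eq t).
apply/seteqP; split => w /=.
  rewrite {1}/f; case E' : (tau w) => [t|] Bw.
    by left; exists t => //; split => //=; rewrite /f E'.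
  by right; split => // -[t _ /=]; rewrite E'.
case=> [[t _ []]//|[B0 nw]]; rewrite /f.
by case E' : (tau w) => [t|] //; case: nw; exists t.
Qed.

End one.

Lemma det_stopping t : stopping_time F (@det_time d Omega t).
Proof.
move=> s; rewrite /det_time /=; case: (t <= s)%N.
  by rewrite (_ : [set _ | _] = setT); [exact: sigma_algebra_T|apply/seteqP; split].
by rewrite (_ : [set _ | _] = set0); [exact: F_set0|apply/seteqP; split].
Qed.

Lemma sigma_at_det t A : F t A -> sigma_at F (@det_time d Omega t) A.
Proof. by move=> FA; apply: (sigma_at_sub (@det_stopping t) FA). Qed.

Lemma sigma_at_detE t : sigma_at F (@det_time d Omega t) = F t.
Proof.
apply/seteqP; split => [A hA|A]; last exact: sigma_at_det.
have := sigma_at_eq (@det_stopping t) t hA.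
by rewrite (_ : _ `&` _ = A)//; apply/seteqP; split => // w [].
Qed.

Lemma stopping_max theta t : stopping_time F theta ->
  stopping_time F (fun w => if theta w is Some k then Some (maxn k t) else None).
Proof.
move=> st s; case: (leqP t s) => ts.
  rewrite (_ : [set _ | _] = [set w | natbar_le (theta w) (Some s)]); first exact: st.
  by apply/seteqP; split => w /=; case: (theta w) => [k|] //=; rewrite geq_max ts andbT.
rewrite (_ : [set _ | _] = set0); first exact: F_set0.
apply/seteqP; split => w //=; case: (theta w) => [k|] //=.
by rewrite geq_max (leqNgt t) ts andbF.
Qed.

(** Where tau <= theta fails, an event of sigma_at tau need not belong to
    sigma_at theta. *)
Lemma sigma_at_le tau theta A : stopping_time F tau -> stopping_time F theta ->
  sigma_at F tau A ->
  sigma_at F theta (A `&` [set w | natbar_le (tau w) (theta w)]).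
Proof.
move=> stau sth hA.
have h t : F t ((A `&` [set w | natbar_le (tau w) (theta w)]) `&` [set w | theta w = Some t]).
  rewrite (_ : _ `&` _ = (A `&` [set w | natbar_le (tau w) (Some t)]) `&` [set w | theta w = Some t]).
    by apply: (sigma_algebra_I (sF _)) => //; [case: hA|exact: stopping_eq].
  by apply/seteqP; split => w /= [[Aw +] E]; rewrite E.
apply: sigma_atP => //; apply: measurableI; first by case: hA.
rewrite (_ : [set _ | _] = ~` (\bigcup_t ([set w | theta w = Some t] `\`
    [set w | natbar_le (tau w) (Some t)]))).
  apply: measurableC; apply: bigcupT_measurable => t; apply: measurableD.
    exact: F_measurable (stopping_eq sth t).
  exact: stopping_measurable.
apply/seteqP; split => w /=.
  by move=> tw [t _ [/= E]]; rewrite -E.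
case E : (theta w) => [t|]; last by case: (tau w).
by move=> nw; apply/negPn/negP => nt; apply: nw; exists t => //; split => //; exact/negP.
Qed.

End Stopping.

(** * Bounded positions *)

Lemma cvg_series_single (R : realType) (u : nat -> R) t :
  (forall s, s != t -> u s = 0) -> series u @ \oo --> u t.
Proof.
move=> u0; apply: cvg_near_cst.
exists t.+1 => // n /= tn; rewrite /series /= (bigD1_seq t) ?iota_uniq//=; last first.
  by rewrite mem_index_iota.
by rewrite big1 ?addr0// => s /u0.
Qed.

Lemma lim_series_single (R : realType) (u : nat -> R) t :
  (forall s, s != t -> u s = 0) -> limn (series u) = u t.
Proof. by move=> u0; apply: cvg_lim => //; exact: cvg_series_single. Qed.

Lemma indic_in (R : realType) (T : Type) (A : set T) w : A w -> (\1_A w : R) = 1.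
Proof. by move=> Aw; rewrite indicE mem_set. Qed.

Lemma indic_out (R : realType) (T : Type) (A : set T) w : ~ A w -> (\1_A w : R) = 0.
Proof. by move=> Aw; rewrite indicE memNset. Qed.

Section L0_if.
Context {d : measure_display} {Omega : measurableType d} {R : realType}.
Variable P : probability Omega R.

Lemma L0_if (G : set (set Omega)) (b : Omega -> bool) (f g : Omega -> R) :
  sigma_algebra setT G -> G [set w | b w] -> L0 P G f -> L0 P G g ->
  L0 P G (fun w => if b w then f w else g w).
Proof.
move=> sG Gb Lf Lg.
pose B := [set w | b w].
apply: (@L0_ae _ _ _ P _ (fun w => \1_B w * f w + \1_(~` B) w * g w)).
  apply: aeW => w; case: ifPn => bw.
    by rewrite indic_in// indic_out ?mul1r ?mul0r ?addr0//= /B /= => /(_ bw).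
  rewrite indic_out ?indic_in ?mul1r ?mul0r ?add0r//= /B /=; exact/negP.
apply: (L0D sG); apply: (L0M sG) => //; apply: (L0_indic _ sG) => //.
exact: sigma_algebra_C.
Qed.
End L0_if.

Section Ron.
Context {R : realType} {d : measure_display} {Omega : measurableType d}.
Variables (P : probability Omega R) (F : nat -> set (set Omega)) (T : natbar).
Hypothesis hF : is_filtration P F.

Let sF t : sigma_algebra setT (F t) := filtration_sigma hF t.

(** The space R^oo_(sigma,T), described by its paths: no underlying process on the
    whole time axis is mentioned, and the almost sure bound is nonnegative. *)
Definition Ron (sigma : Omega -> natbar) (X : nat -> Omega -> R) : Prop :=
  [/\ adapted P F X,
      exists2 m : R, 0 <= m & {ae P, forall w, forall t, `|X t w| <= m} &
      {ae P, forall w, stopped T (sigma w) (fun t => X t w)}].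

Lemma adapted_proj sigma X : stopping_time F sigma -> adapted P F X ->
  adapted P F (Defs.proj sigma (fun=> T) X).
Proof.
move=> st aX t; apply: (L0_if (sF t)); [exact: st| |exact: (L0_cst _ (sF t))].
apply: (@L0_sub _ _ _ _ (F (natbar_min t T))); last exact: aX.
by move=> A; apply: (F_mono hF); exact: natbar_min_le.
Qed.

Lemma RonP sigma X : stopping_time F sigma -> stopping_le P sigma (fun=> T) ->
  Rinfty_on P F sigma (fun=> T) X <-> Ron sigma X.
Proof.
move=> st sT; split=> [[Y [aY [m bY]] XY]|[aX [m m0 bX] sX]].
  split.
  - move=> t; apply: (@L0_ae _ _ _ _ _ (Defs.proj sigma (fun=> T) Y t)).
      by apply: filterS XY => w ->.
    exact: adapted_proj.
  - exists `|m| => //; apply: filterS2 XY bY => w XY bY t; rewrite XY /Defs.proj.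
    by case: ifP => _; [apply: le_trans (bY _) (ler_norm _)|rewrite normr0].
  - apply: filterS2 XY sT => w XY sT t; rewrite !XY /Defs.proj.
    by rewrite natbar_le_min// natbar_min_idem; case: ifP.
exists X; first by split => //; exists m.
apply: filterS sX => w sX t; rewrite /Defs.proj; exact: sX.
Qed.

Lemma Ron_zero sigma : Ron sigma (fun _ _ => 0).
Proof.
split.
- by move=> t; exact: L0_cst.
- by exists 0 => //; apply: aeW => w t; rewrite normr0.
- by apply: aeW => w t; case: ifP.
Qed.

Lemma RonD sigma X Y : Ron sigma X -> Ron sigma Y -> Ron sigma (fun t w => X t w + Y t w).
Proof.
move=> [aX [m m0 bX] sX] [aY [n n0 bY] sY]; split.
- by move=> t; apply: (L0D (sF t)); [exact: aX|exact: aY].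
- exists (m + n); first exact: addr_ge0.
  by apply: filterS2 bX bY => w bX bY t; rewrite (le_trans (ler_normD _ _))// lerD.
- apply: filterS2 sX sY => w sX sY t; rewrite sX sY.
  by case: ifP => // _; rewrite addr0.
Qed.

Lemma Ron_ae sigma X Y : {ae P, forall w, forall t, X t w = Y t w} -> Ron sigma X -> Ron sigma Y.
Proof.
move=> XY [aX [m m0 bX] sX]; split.
- by move=> t; apply: L0_ae (aX t); apply: filterS XY => w; apply.
- by exists m => //; apply: filterS2 XY bX => w XY bX t; rewrite -XY.
- by apply: filterS2 XY sX => w XY sX t; rewrite -!XY.
Qed.

(** On an event where sigma = t, a position on [sigma, T] is one on [t, T]. *)
Lemma Ron_indic sigma X A t : Ron sigma X -> F t A ->
  A `<=` [set w | sigma w = Some t] -> Ron (@det_time d Omega t) (fun s w => \1_A w * X s w).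
Proof.
move=> [aX [m m0 bX] sX] FA As.
split.
- move=> s; case: (leqP t s) => ts.
    apply: (L0M (sF s)); last exact: aX.
    by apply: (L0_indic _ (sF s)); exact: (F_mono hF ts).
  apply: L0_ae (L0_cst _ (sF s) 0).
  apply: filterS sX => w sX; case: (pselect (A w)) => Aw; last first.
    by rewrite indic_out ?mul0r.
  by rewrite sX (As _ Aw) /= leqNgt ts mulr0.
- exists m => //; apply: filterS bX => w bX s.
  case: (pselect (A w)) => Aw; first by rewrite indic_in// mul1r.
  by rewrite indic_out// mul0r normr0.
- apply: filterS sX => w sX s; rewrite /det_time.
  case: (pselect (A w)) => Aw; last by rewrite indic_out// !mul0r; case: ifP.
  by rewrite indic_in// !mul1r {1}sX (As _ Aw).
Qed.

Lemma Ron_local sigma X A : stopping_time F sigma -> sigma_at F sigma A -> Ron sigma X ->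
  Ron sigma (fun s w => \1_A w * X s w).
Proof.
move=> st hA [aX [m m0 bX] sX]; split.
- move=> t; pose B := A `&` [set w | natbar_le (sigma w) (Some t)].
  apply: (@L0_ae _ _ _ _ _ (fun w => \1_B w * X t w)).
    apply: filterS sX => w sX.
    case: (pselect (natbar_le (sigma w) (Some t))) => h.
      case: (pselect (A w)) => Aw; first by rewrite !indic_in.
      by rewrite !indic_out// => -[].
    by rewrite sX (negbTE (introN idP h)) !mulr0.
  apply: (L0M (sF t)); last exact: aX.
  by apply: (L0_indic _ (sF t)); case: hA.
- exists m => //; apply: filterS bX => w bX s.
  case: (pselect (A w)) => Aw; first by rewrite indic_in// mul1r.
  by rewrite indic_out// mul0r normr0.
- apply: filterS sX => w sX s.
  by rewrite {1}sX; case: ifP => // _; rewrite mulr0.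
Qed.

Lemma Ron_proj tau theta X : stopping_time F theta ->
  stopping_le P tau theta -> stopping_le P theta (fun=> T) ->
  Ron tau X -> Ron theta (Defs.proj theta (fun=> T) X).
Proof.
move=> st tt tT [aX [m m0 bX] sX]; apply/RonP => //; exists X; last exact: aeW.
by split => //; exists m.
Qed.

Lemma Ron_shift theta (xi : Omega -> R) : stopping_time F theta ->
  stopping_le P theta (fun=> T) -> Linf P (sigma_at F theta) xi ->
  Ron theta (fun t w => if natbar_le (theta w) (Some t) then xi w else 0).
Proof.
move=> st tT [Lxi [m bxi]]; split.
- by move=> t; exact: (L0_from hF).
- exists `|m| => //; apply: filterS bxi => w bxi t.
  by case: ifP => _; rewrite ?normr0// (le_trans bxi)// ler_norm.
- by apply: filterS tT => w tT t; rewrite natbar_le_min//; case: ifP.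
Qed.

Lemma Ron_trunc tau theta X : stopping_time F theta ->
  stopping_le P theta (fun=> T) -> Ron tau X ->
  Ron tau (fun t w => if natbar_le (theta w) (Some t) then 0 else X t w).
Proof.
move=> st tT [aX [m m0 bX] sX]; split.
- by move=> t; apply: (L0_if (sF t)) => //; exact: (L0_cst _ (sF t)).
- by exists m => //; apply: filterS bX => w bX t; case: ifP; rewrite ?normr0.
- apply: filterS2 sX tT => w sX tT t; rewrite natbar_le_min//.
  by case: (boolP (natbar_le (theta w) _)) => h; [case: ifP|rewrite sX].
Qed.

Lemma Ron_le tau theta X : stopping_le P tau theta -> stopping_le P theta (fun=> T) ->
  Ron theta X -> Ron tau X.
Proof.
move=> tt tT [aX [m m0 bX] sX]; split => //; first by exists m.
apply: filterS3 sX tt tT => w sX tt tT t.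
case: (boolP (natbar_le (theta w) (Some t))) => h.
  by rewrite {1}sX h (natbar_le_trans tt h).
by rewrite sX (negbTE h) sX natbar_le_min// (negbTE h); case: ifP.
Qed.

End Ron.

(** * The utility functional at a stopping time *)

Section Phi.
Context {R : realType} {d : measure_display} {Omega : measurableType d}.
Variables (P : probability Omega R) (F : nat -> set (set Omega)) (T : natbar).
Variable phi : nat -> (nat -> Omega -> R) -> Omega -> R.
Hypothesis hF : is_filtration P F.
Hypothesis hphi : concave_muf_process P F T phi.

Let sF t : sigma_algebra setT (F t) := filtration_sigma hF t.
Local Notation horizon := (fun=> T).
Local Notation det := (@det_time d Omega).
Local Notation Ron := (Ron P F T).
Local Notation phi_at := (phi_at T phi).
Implicit Types (sigma tau theta : Omega -> natbar) (X Y : nat -> Omega -> R).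

Lemma det_le t : natbar_le (Some t) T -> stopping_le P (det t) horizon.
Proof. by move=> tT; exact: aeW. Qed.

Lemma RonP_det t X : natbar_le (Some t) T ->
  Ron (det t) X -> Rinfty_on P F (det t) horizon X.
Proof. by move=> tT rX; apply/RonP => //; [exact: det_stopping hF _|exact: det_le]. Qed.

Lemma phi_mono t X Y : natbar_le (Some t) T -> Ron (det t) X -> Ron (det t) Y ->
  {ae P, forall w, forall s, X s w <= Y s w} -> {ae P, forall w, phi t X w <= phi t Y w}.
Proof.
by move=> tT /(RonP_det tT) rX /(RonP_det tT) rY; exact: (cmuf_mono (hphi tT)).
Qed.

Lemma phi_ext t X Y : natbar_le (Some t) T -> Ron (det t) X ->
  {ae P, forall w, forall s, X s w = Y s w} -> {ae P, forall w, phi t X w = phi t Y w}.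
Proof.
move=> tT rX XY; have rY := Ron_ae XY rX.
apply: filterS2 (phi_mono tT rX rY _) (phi_mono tT rY rX _).
- by move=> w h1 h2; apply/eqP; rewrite eq_le h1.
- by apply: filterS XY => w XY s; rewrite XY.
- by apply: filterS XY => w XY s; rewrite XY.
Qed.

Lemma phi_local t X A : natbar_le (Some t) T -> Ron (det t) X -> F t A ->
  {ae P, forall w, phi t (fun s w => \1_A w * X s w) w = \1_A w * phi t X w}.
Proof.
move=> tT /(RonP_det tT) rX /(sigma_at_det hF) hA.
by have := cmuf_local (hphi tT) rX hA; apply: filterS => w; apply.
Qed.

Lemma phi_zero t : natbar_le (Some t) T ->
  {ae P, forall w, phi t (fun _ _ => 0) w = 0}.
Proof.
move=> tT; have := phi_local tT (Ron_zero T hF (det t)) (F_set0 hF t).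
have -> : (fun (s : nat) (w : Omega) => \1_set0 w * (0 : R)) = (fun _ _ => 0).
  by apply/funext => s; apply/funext => w; rewrite mulr0.
by apply: filterS => w ->; rewrite indic_out ?mul0r.
Qed.

(* the summand of index t in phi_(sigma,T)(X) is phi t of this process *)
Let piece sigma (X : nat -> Omega -> R) t : nat -> Omega -> R :=
  fun s w => if sigma w == Some t then X s w else 0.

Let pieceE sigma X t : piece sigma X t = fun s w => \1_[set w | sigma w = Some t] w * X s w.
Proof.
apply/funext => s; apply/funext => w; rewrite /piece; case: eqP => h.
  by rewrite indic_in// mul1r.
by rewrite indic_out// mul0r.
Qed.

Section at_stopping.
Variable sigma : Omega -> natbar.
Hypotheses (st : stopping_time F sigma) (sT : stopping_le P sigma horizon).

Let piece_Ron X t : Ron sigma X -> Ron (det t) (piece sigma X t).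
Proof. by move=> rX; rewrite pieceE; apply: (Ron_indic hF rX); first exact: (stopping_eq hF st). Qed.

(** On an event of F t where sigma = t, only one term of the sum that defines
    phi_(sigma,T)(X) is nonzero, and by locality it may be computed from X on that
    event alone. All properties of phi_(sigma,T) follow from those of the phi_t in
    this way. *)
Lemma phi_at_piece X t A : Ron sigma X -> natbar_le (Some t) T -> F t A ->
  A `<=` [set w | sigma w = Some t] ->
  {ae P, forall w, A w -> phi_at sigma X w = phi t (fun s w => \1_A w * X s w) w}.
Proof.
move=> rX tT FA As.
have ae0 : {ae P, forall w, forall s, natbar_le (Some s) T -> sigma w <> Some s ->
    phi s (piece sigma X s) w = 0}.
  apply: ae_foralln => s; case: (boolP (natbar_le (Some s) T)) => sT'; last exact: aeW.
  have := phi_local sT' (piece_Ron s rX) (stopping_eq hF st s).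
  have -> : (fun u w => \1_[set w | sigma w = Some s] w * piece sigma X s u w) = piece sigma X s.
    apply/funext => u; apply/funext => w; rewrite /piece.
    case: eqP => h; first by rewrite indic_in// mul1r.
    by rewrite mulr0.
  by apply: filterS => w h _ ns; rewrite h indic_out ?mul0r.
have eA : (fun s w => \1_A w * X s w) = (fun s w => \1_A w * piece sigma X t s w).
  apply/funext => u; apply/funext => w; rewrite pieceE.
  case: (pselect (A w)) => h; last by rewrite !(indic_out R h) !mul0r.
  by rewrite (@indic_in _ _ [set w | sigma w = Some t])// ?mul1r//; exact: As.
rewrite eA; apply: filterS2 ae0 (phi_local tT (piece_Ron t rX) FA) => w h0 -> Aw.
rewrite indic_in// mul1r /phi_at (@lim_series_single _ _ t) ?tT// => s st'.
case: ifP => // sT'; apply: h0 => //; rewrite (As _ Aw) => -[E].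
by rewrite E eqxx in st'.
Qed.

(** A property may be proved separately on the events [sigma = t]. *)
Lemma ae_on_values (Q : Omega -> Prop) : {ae P, forall w, sigma w <> None} ->
  (forall t, natbar_le (Some t) T -> {ae P, forall w, sigma w = Some t -> Q w}) ->
  {ae P, forall w, Q w}.
Proof.
move=> fin hQ.
have : {ae P, forall w, forall t, natbar_le (Some t) T -> sigma w = Some t -> Q w}.
  apply: ae_foralln => t; case: (boolP (natbar_le (Some t) T)) => tT; last exact: aeW.
  by apply: filterS (hQ t tT) => w h _.
apply: filterS3 fin sT => w fin sT' h.
by case E : (sigma w) fin => [t|] // _; apply: (h t) => //; rewrite -E.
Qed.

Hypothesis fin : {ae P, forall w, sigma w <> None}.

Lemma phi_at_pieceT X t : Ron sigma X -> natbar_le (Some t) T ->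
  {ae P, forall w, sigma w = Some t ->
    phi_at sigma X w = phi t (fun s w => \1_[set w | sigma w = Some t] w * X s w) w}.
Proof. by move=> rX tT; apply: phi_at_piece => //; exact: (stopping_eq hF st). Qed.

Let piece_Ron' X t : Ron sigma X ->
  Ron (det t) (fun s w => \1_[set w | sigma w = Some t] w * X s w).
Proof. by move=> rX; rewrite -pieceE; exact: piece_Ron. Qed.

Lemma phi_at_mono X Y : Ron sigma X -> Ron sigma Y ->
  {ae P, forall w, forall s, X s w <= Y s w} ->
  {ae P, forall w, phi_at sigma X w <= phi_at sigma Y w}.
Proof.
move=> rX rY XY; apply: ae_on_values => // t tT.
have h := phi_mono tT (piece_Ron' t rX) (piece_Ron' t rY).
apply: filterS3 (h _) (phi_at_pieceT rX tT) (phi_at_pieceT rY tT).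
- by move=> w {}h hX hY sw; rewrite hX// hY.
- apply: filterS XY => w XY s; rewrite ler_wpM2l//.
Qed.

Lemma phi_at_ext X Y : Ron sigma X -> {ae P, forall w, forall s, X s w = Y s w} ->
  {ae P, forall w, phi_at sigma X w = phi_at sigma Y w}.
Proof.
move=> rX XY; have rY := Ron_ae XY rX.
apply: filterS2 (phi_at_mono rX rY _) (phi_at_mono rY rX _).
- by move=> w h1 h2; apply/eqP; rewrite eq_le h1.
- by apply: filterS XY => w XY s; rewrite XY.
- by apply: filterS XY => w XY s; rewrite XY.
Qed.

Lemma phi_at_zero : {ae P, forall w, phi_at sigma (fun _ _ => 0) w = 0}.
Proof.
apply: ae_on_values => // t tT.
apply: filterS2 (phi_zero tT) (phi_at_pieceT (Ron_zero T hF sigma) tT) => w h0 h sw.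
rewrite h// -[RHS]h0; congr (phi t _ w).
by apply/funext => s; apply/funext => w'; rewrite mulr0.
Qed.

Lemma Linf_indic t (m : Omega -> R) : Linf P (sigma_at F sigma) m ->
  Linf P (sigma_at F (det t)) (fun w => \1_[set w | sigma w = Some t] w * m w).
Proof.
move=> [Lm [c bm]]; split.
- rewrite (sigma_at_detE hF).
  apply: (@L0_ae _ _ _ _ _ (fun w => \1_[set w | sigma w = Some t] w *
      (if natbar_le (sigma w) (Some t) then m w else 0))).
    apply: aeW => w; case: (pselect (sigma w = Some t)) => h; last by rewrite !indic_out// !mul0r.
    by rewrite h /= leqnn.
  apply: (L0M (sF t)); first by apply: (L0_indic _ (sF t)); exact: (stopping_eq hF st).
  exact: (L0_from hF).
- exists c; apply: filterS bm => w bm.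
  case: (pselect (sigma w = Some t)) => h; first by rewrite indic_in// mul1r.
  by rewrite indic_out// mul0r normr0 (le_trans _ bm).
Qed.

Lemma phi_at_translation X m : Ron sigma X -> Linf P (sigma_at F sigma) m ->
  {ae P, forall w, phi_at sigma
    (fun t w => X t w + (if natbar_le (sigma w) (Some t) then m w else 0)) w
    = phi_at sigma X w + m w}.
Proof.
move=> rX hm; apply: ae_on_values => // t tT.
set Y := fun t w => _ + _.
have rY : Ron sigma Y by apply: (RonD hF) => //; exact: (Ron_shift hF).
have := cmuf_translation (hphi tT) (RonP_det tT (piece_Ron' t rX)) (Linf_indic t hm).
apply: filterS3 (phi_at_pieceT rX tT) (phi_at_pieceT rY tT) => w hX hY h sw.
rewrite hX// hY//; have {h} := h I; rewrite (@indic_in _ _ _ w)// mul1r => <-.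
congr (phi t _ w); apply/funext => s; apply/funext => w'; rewrite /Y /det_time.
case: (pselect (sigma w' = Some t)) => h; last by rewrite !indic_out// !mul0r; case: ifP; rewrite addr0.
by rewrite !indic_in// !mul1r h.
Qed.

Lemma phi_at_local X A : Ron sigma X -> sigma_at F sigma A ->
  {ae P, forall w, phi_at sigma (fun s w => \1_A w * X s w) w = \1_A w * phi_at sigma X w}.
Proof.
move=> rX hA; have rAX := Ron_local hF st hA rX.
apply: ae_on_values => // t tT.
have FA := sigma_at_eq hF st t hA.
apply: filterS3 (phi_local tT (piece_Ron' t rX) FA) (phi_at_pieceT rX tT) (phi_at_pieceT rAX tT).
move=> w h hX hAX sw; rewrite hX// hAX//.
have -> : \1_A w = \1_(A `&` [set w | sigma w = Some t]) w :> R.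
  case: (pselect (A w)) => Aw; first by rewrite !indic_in.
  by rewrite !indic_out// => -[].
rewrite -h; congr (phi t _ w); apply/funext => s; apply/funext => w'.
rewrite !mulrA; congr (_ * _).
case: (pselect (sigma w' = Some t)) => h'; last by rewrite (@indic_out _ _ [set w | sigma w = Some t])// mul0r mulr0.
rewrite (@indic_in _ _ [set w | sigma w = Some t])// mul1r mulr1.
case: (pselect (A w')) => Aw; first by rewrite !indic_in.
by rewrite !indic_out// => -[].
Qed.

Lemma phi_at_bounded X (m : R) : Ron sigma X -> {ae P, forall w, forall t, `|X t w| <= m} ->
  {ae P, forall w, `|phi_at sigma X w| <= m}.
Proof.
move=> rX bX.
have hc c : Linf P (sigma_at F sigma) (fun=> c).
  split; first exact: (L0_cst _ (sigma_at_sigma hF st)).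
  by exists `|c|; exact: aeW.
have cst_phi c : {ae P, forall w, phi_at sigma
      (fun t w => 0 + (if natbar_le (sigma w) (Some t) then c else 0)) w
    = phi_at sigma (fun _ _ => 0) w + c}.
  exact: phi_at_translation (Ron_zero T hF sigma) (hc c).
have rc c : Ron sigma (fun t w => 0 + (if natbar_le (sigma w) (Some t) then c else 0)).
  apply: (RonD hF); [exact: Ron_zero|exact: (Ron_shift hF)].
have [_ _ sX] := rX.
have up : {ae P, forall w, phi_at sigma X w <= m}.
  apply: filterS3 (phi_at_mono rX (rc m) _) (cst_phi m) phi_at_zero.
    by move=> w h1 h2 h3; rewrite h2 h3 add0r in h1.
  apply: filterS2 sX bX => w sX bX s; rewrite add0r; case: ifP => h.
    by rewrite (le_trans (ler_norm _)).
  by rewrite sX h.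
have dn : {ae P, forall w, - m <= phi_at sigma X w}.
  apply: filterS3 (phi_at_mono (rc (- m)) rX _) (cst_phi (- m)) phi_at_zero.
    by move=> w h1 h2 h3; rewrite h2 h3 add0r in h1.
  apply: filterS2 sX bX => w sX bX s; rewrite add0r; case: ifP => h.
    by have := bX s; rewrite ler_norml => /andP[].
  by rewrite sX h.
by apply: filterS2 up dn => w ? ?; rewrite ler_norml; apply/andP.
Qed.

(** phi_(sigma,T)(X) has a version that is bounded and measurable with respect to
    sigma_at sigma at every point. *)
Lemma phi_at_version X : Ron sigma X -> exists v : Omega -> R,
  [/\ measurable_wrt (sigma_at F sigma) v, exists m : R, forall w, `|v w| <= m &
      {ae P, forall w, phi_at sigma X w = v w}].
Proof.
move=> rX.
have ex t : exists v, measurable_wrt (F t) v /\ (natbar_le (Some t) T ->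
    {ae P, forall w, phi t (fun s w => \1_[set w | sigma w = Some t] w * X s w) w = v w}).
  case: (boolP (natbar_le (Some t) T)) => tT; last first.
    by exists (fun=> 0); split => //; exact: (measurable_wrt_cst (sF t)).
  have [Lv _] := cmuf_Linf (hphi tT) (RonP_det tT (piece_Ron' t rX)).
  by move: Lv; rewrite (sigma_at_detE hF) => /L0_ex[v mv hv]; exists v.
have [v hv] := choice ex.
pose u w := if sigma w is Some t then v t w else 0.
have mu : measurable_wrt (sigma_at F sigma) u.
  by apply: (measurable_wrt_pieces hF st) => t; case: (hv t).
have uE : {ae P, forall w, phi_at sigma X w = u w}.
  apply: ae_on_values => // t tT; have [_ /(_ tT) h] := hv t.
  by apply: filterS2 h (phi_at_pieceT rX tT) => w h h' sw; rewrite h'// h /u sw.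
have [_ [m m0 bX] _] := rX.
have sG := sigma_at_sigma hF st.
exists (fun w => Num.max (Num.min (u w) m) (- m)); split.
- apply: (measurable_wrt_max sG); last exact: (measurable_wrt_cst sG).
  by apply: (measurable_wrt_min sG) => //; exact: (measurable_wrt_cst sG).
- exists m => w; rewrite ler_norml le_max lexx orbT ge_max ge_min lexx orbT/=.
  by rewrite (le_trans _ m0)// oppr_le0.
- apply: filterS2 uE (phi_at_bounded rX bX) => w <-; rewrite ler_norml => /andP[h1 h2].
  by rewrite (min_idPl h2) (max_idPl h1).
Qed.

End at_stopping.
End Phi.

(** * Decomposition of acceptable positions *)

Section Decomposition.
Context {R : realType} {d : measure_display} {Omega : measurableType d}.
Variables (P : probability Omega R) (F : nat -> set (set Omega)) (T : natbar).
Variable phi : nat -> (nat -> Omega -> R) -> Omega -> R.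
Hypothesis hF : is_filtration P F.
Hypothesis hphi : concave_muf_process P F T phi.

Let sF t : sigma_algebra setT (F t) := filtration_sigma hF t.
Local Notation horizon := (fun=> T).
Local Notation det := (@det_time d Omega).
Local Notation Ron := (Ron P F T).
Local Notation phi_at := (phi_at T phi).
Local Notation acc := (acceptance P F T phi).
Local Notation projT theta := (Defs.proj theta (fun=> T)).
Implicit Types (sigma tau theta : Omega -> natbar) (X Y : nat -> Omega -> R).

Lemma accP sigma X : stopping_time F sigma -> stopping_le P sigma horizon ->
  acc sigma X <-> Ron sigma X /\ {ae P, forall w, 0 <= phi_at sigma X w}.
Proof.
move=> st sT; split => [[rX h]|[rX h]]; split => //.
  by apply/(RonP hF X st sT).
by apply/(RonP hF X st sT).
Qed.

Lemma acc0 sigma : stopping_time F sigma -> stopping_le P sigma horizon ->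
  {ae P, forall w, sigma w <> None} -> acc sigma (fun _ _ => 0).
Proof.
move=> st sT fin; apply/accP => //; split; first exact: Ron_zero.
by apply: filterS (phi_at_zero hF hphi st sT fin) => w ->.
Qed.

(** Acceptance sets are stable under pasting along events of sigma_at sigma. *)
Lemma acc_paste sigma X Y A : stopping_time F sigma -> stopping_le P sigma horizon ->
  {ae P, forall w, sigma w <> None} -> sigma_at F sigma A -> acc sigma X -> acc sigma Y ->
  acc sigma (fun s w => \1_A w * X s w + \1_(~` A) w * Y s w).
Proof.
move=> st sT fin hA /accP-/(_ st sT)[rX hX] /accP-/(_ st sT)[rY hY].
have hA' := sigma_algebra_C (sigma_at_sigma hF st) hA.
set Z := (fun s w => _ + _).
have rZ : Ron sigma Z by apply: (RonD hF); exact: (Ron_local hF).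
apply/accP => //; split => //.
have E1 := phi_at_local hF hphi st sT fin rZ hA.
have E2 := phi_at_local hF hphi st sT fin rZ hA'.
have E3 := phi_at_local hF hphi st sT fin rX hA.
have E4 := phi_at_local hF hphi st sT fin rY hA'.
have e3 : (fun s w => \1_A w * X s w) = (fun s w => \1_A w * Z s w).
  apply/funext => s; apply/funext => w; rewrite /Z.
  case: (pselect (A w)) => h; last by rewrite !(indic_out R h) !mul0r.
  by rewrite (indic_in R h) indic_out// !mul1r mul0r addr0.
have e4 : (fun s w => \1_(~` A) w * Y s w) = (fun s w => \1_(~` A) w * Z s w).
  apply/funext => s; apply/funext => w; rewrite /Z.
  case: (pselect (A w)) => h; first by rewrite !(@indic_out _ _ (~` A))// !mul0r.
  by rewrite (indic_out R h) indic_in// !mul1r mul0r add0r.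
rewrite e3 in E3; rewrite e4 in E4.
apply: filterS3 hX hY (filterI (filterI E1 E3) (filterI E2 E4)) => w hX hY [[e1 e3'] [e2 e4']].
case: (pselect (A w)) => h.
  by move: e3'; rewrite e1 (indic_in R h) !mul1r => ->.
by move: e4'; rewrite e2 indic_in// !mul1r => ->.
Qed.

Lemma acc_indic sigma X A t : stopping_time F sigma -> stopping_le P sigma horizon ->
  {ae P, forall w, sigma w <> None} -> natbar_le (Some t) T -> F t A ->
  A `<=` [set w | sigma w = Some t] -> acc sigma X ->
  acc (det t) (fun s w => \1_A w * X s w).
Proof.
move=> st sT fin tT FA As /accP-/(_ st sT)[rX hX].
have sd := det_stopping hF t; have dT := det_le P tT.
have rAX := Ron_indic hF rX FA As.
apply/accP => //; split => //.
have E1 := phi_at_piece hF hphi st rX tT FA As.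
have E2 := phi_at_piece hF hphi sd rAX tT (sigma_algebra_T (sF t)) (fun w _ => erefl).
have E3 := phi_local hF hphi tT rAX FA.
have e1 : (fun s w => \1_setT w * (\1_A w * X s w)) = (fun s w => \1_A w * X s w).
  by apply/funext => s; apply/funext => w; rewrite indic_in// mul1r.
have e2 : (fun s w => \1_A w * (\1_A w * X s w)) = (fun s w => \1_A w * X s w).
  apply/funext => s; apply/funext => w.
  case: (pselect (A w)) => h; first by rewrite !(indic_in R h) !mul1r.
  by rewrite !(indic_out R h) !mul0r.
rewrite e1 in E2; rewrite e2 in E3.
apply: filterS2 hX (filterI E1 (filterI E2 E3)) => w hX [h1 [h2 h3]].
rewrite h2//; case: (pselect (A w)) => h; first by rewrite -h1.
by rewrite h3 (indic_out R h) mul0r.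
Qed.

Hypothesis htc : time_consistent P F T phi.

Section two.
Variables tau theta : Omega -> natbar.
Hypotheses (stau : stopping_time F tau) (sth : stopping_time F theta).
Hypotheses (ftau : {ae P, forall w, tau w <> None}) (fth : {ae P, forall w, theta w <> None}).
Hypotheses (tth : stopping_le P tau theta) (thT : stopping_le P theta horizon).

Let tauT : stopping_le P tau horizon.
Proof. by apply: filterS2 tth thT => w; exact: natbar_le_trans. Qed.

(* Time consistency is assumed only between a constant t and later stopping
   times. On [tau = t] it is applied to t and the maximum of theta and t, which
   there coincides with theta; off that event the position vanishes. *)
Let phi_at_max X t : Ron tau X -> natbar_le (Some t) T ->
  let A := [set w | tau w = Some t] in
  let tht := fun w => if theta w is Some k then Some (maxn k t) else None in
  {ae P, forall w, phi_at tht (projT tht (fun s w => \1_A w * X s w)) w =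
    \1_A w * phi_at theta (projT theta X) w}.
Proof.
move=> rX tT A tht.
have FA : F t A := stopping_eq hF stau t.
have stt : stopping_time F tht := stopping_max hF t sth.
have ttT : stopping_le P tht horizon.
  by apply: filterS thT => w; rewrite /tht; case: (theta w) (T) tT => [k|] [n|] //=; lia.
have ftt : {ae P, forall w, tht w <> None}.
  by apply: filterS fth => w; rewrite /tht; case: (theta w).
have rU : Ron (det t) (fun s w => \1_A w * X s w) by exact: (Ron_indic hF rX FA).
have dtt : stopping_le P (det t) tht.
  by apply: aeW => w; rewrite /tht /det_time; case: (theta w) => [k|] //=; rewrite leq_max leqnn orbT.
have rV1 := Ron_proj hF stt dtt ttT rU.
have rV2 := Ron_proj hF sth tth thT rX.
apply: (ae_on_values ttT) => // s sT.
case: (ltnP s t) => st.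
  by apply: aeW => w; rewrite /tht; case: (theta w) => [k|] //= -[]; lia.
pose B1 := A `&` [set w | theta w = Some s].
pose B2 := ~` A `&` [set w | tht w = Some s].
have FA' : F s A := F_mono hF st FA.
have FB1 : F s B1 by apply: (sigma_algebra_I (sF s)) => //; exact: (stopping_eq hF sth).
have FB2 : F s B2.
  by apply: (sigma_algebra_I (sF s)); [exact: (sigma_algebra_C (sF s))|exact: (stopping_eq hF stt)].
have B1t : B1 `<=` [set w | tht w = Some s].
  by move=> w [_ /= E]; rewrite /tht E; congr Some; lia.
have E1 := phi_at_piece hF hphi stt rV1 sT FB1 B1t.
have E2 := phi_at_piece hF hphi sth rV2 sT FB1 (@subIsetr _ _ _).
have E3 := phi_at_piece hF hphi stt rV1 sT FB2 (@subIsetr _ _ _).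
have e1 : (fun u w => \1_B1 w * projT tht (fun s w => \1_A w * X s w) u w) =
          (fun u w => \1_B1 w * projT theta X u w).
  apply/funext => u; apply/funext => w.
  case: (pselect (B1 w)) => h; last by rewrite !(indic_out R h) !mul0r.
  rewrite !(indic_in R h) !mul1r /Defs.proj (B1t _ h); case: (h) => Aw /= ->.
  by rewrite (indic_in R Aw) mul1r.
have e3 : (fun u w => \1_B2 w * projT tht (fun s w => \1_A w * X s w) u w) = (fun _ _ => 0).
  apply/funext => u; apply/funext => w.
  case: (pselect (B2 w)) => h; last by rewrite !(indic_out R h) !mul0r.
  by case: h => nA _; rewrite /Defs.proj (indic_out R nA) mul0r; case: ifP; rewrite mulr0.
rewrite e1 in E1; rewrite e3 in E3.
apply: filterS3 (filterI E1 E2) (filterI E3 (phi_zero hF hphi sT)) tth => w [h1 h2] [h3 h0] tt sw.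
case: (pselect (A w)) => Aw.
  have Bw : B1 w.
    split => //=; move: sw tt; rewrite /tht (Aw : tau w = _); case: (theta w) => [k|] //= [<-] tk.
    by congr Some; lia.
  by rewrite h1// h2// (indic_in R Aw) mul1r.
by rewrite h3 ?h0 ?(indic_out R Aw) ?mul0r.
Qed.

(** Time consistency between two stopping times. *)
Lemma phi_at_time_consistent X : Ron tau X ->
  {ae P, forall w, phi_at tau X w =
    phi_at tau (fun s w => (if natbar_le (theta w) (Some s) then 0 else X s w) +
      (if natbar_le (theta w) (Some s) then phi_at theta (projT theta X) w else 0)) w}.
Proof.
move=> rX; set Z := (fun s w => _ + _).
have rV := Ron_proj hF sth tth thT rX.
have [v [mv [m vm] vE]] := phi_at_version hF hphi sth thT fth rV.
have Lphi : Linf P (sigma_at F theta) (phi_at theta (projT theta X)).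
  split; last by exists m; apply: filterS vE => w ->.
  by exists v => //; apply: filterS vE => w ->.
have rZ : Ron tau Z.
  apply: (RonD hF); first exact: (Ron_trunc hF).
  by apply: (Ron_le tth thT); exact: (Ron_shift hF).
apply: (ae_on_values tauT) => // t tT.
set A := [set w | tau w = Some t].
have FA : F t A := stopping_eq hF stau t.
pose tht w := if theta w is Some k then Some (maxn k t) else None.
have stt : stopping_time F tht := stopping_max hF t sth.
have ttT : stopping_le P tht horizon.
  by apply: filterS thT => w; rewrite /tht; case: (theta w) (T) tT => [k|] [n|] //=; lia.
have ftt : {ae P, forall w, tht w <> None}.
  by apply: filterS fth => w; rewrite /tht; case: (theta w).
have dtt : stopping_le P (det t) tht.
  by apply: aeW => w; rewrite /tht /det_time; case: (theta w) => [k|] //=; rewrite leq_max leqnn orbT.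
have rU : Ron (det t) (fun s w => \1_A w * X s w) by exact: (Ron_indic hF rX FA).
have rAZ : Ron (det t) (fun s w => \1_A w * Z s w) by exact: (Ron_indic hF rZ FA).
have H := htc tT (conj stt ftt) dtt ttT (RonP_det hF tT rU).
have K := phi_at_max rX tT; cbv zeta in K; rewrite -/A -/tht in K.
have [_ _ sX] := rX.
have H2 := phi_ext hF hphi tT rAZ.
have {}H2 := H2 _ (_ : {ae P, forall w, forall s, \1_A w * Z s w =
  (if natbar_le (Some t) (Some s) && ~~ natbar_le (tht w) (Some s)
       then \1_A w * X s w else 0)
      + (if natbar_le (tht w) (Some s)
         then phi_at tht (projT tht (fun s w => \1_A w * X s w)) w else 0)}).
apply: filterS3 (filterI (phi_at_pieceT hF hphi stau rX tT) (phi_at_pieceT hF hphi stau rZ tT)) H (H2 _).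
  move=> w [h1 h2] h3 h4 tw; rewrite h1// h2// h4 h3//.
apply: filterS3 K sX tth => w -> sX tt s.
case: (pselect (A w)) => Aw; last first.
  by rewrite (indic_out R Aw) !mul0r; case: ifP; case: ifP; rewrite addr0.
have -> : tht w = theta w.
  move: tt; rewrite /tht (Aw : tau w = _); case: (theta w) => [k|] //= tk.
  by congr Some; lia.
rewrite (indic_in R Aw) !mul1r /Z.
case: (boolP (natbar_le (theta w) (Some s))) => h; first by rewrite andbF.
rewrite andbT; case: ifP => // ts; congr (_ + _).
by rewrite sX (Aw : tau w = _) ts.
Qed.

(** Every acceptable position X is the sum of an acceptable position X1 that is
    constant from theta on and a position X2 that is acceptable from theta on. Here
    X1 replaces X from theta on by v = phi_theta(X), and X2 is the rest; X1 may be
    combined with any position Y that is acceptable from theta on, because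
    phi_theta (X1 + Y) = v + phi_theta(Y) >= v. *)
Lemma acc_decomposition X : acc tau X -> exists X1 X2 : nat -> Omega -> R,
  exists v : Omega -> R,
  [/\ [/\ acc tau X1, measurable_wrt (sigma_at F theta) v, exists m : R, forall w, `|v w| <= m &
       forall w s, natbar_le (theta w) (Some s) -> X1 s w = v w],
      acc theta X2, {ae P, forall w, forall s, X s w = X1 s w + X2 s w} &
      forall Y, acc theta Y -> acc tau (fun s w => X1 s w + Y s w)].
Proof.
move=> /accP-/(_ stau tauT)[rX hX].
have rV := Ron_proj hF sth tth thT rX.
have [v [mv [m vm] vE]] := phi_at_version hF hphi sth thT fth rV.
pose X1 s w := (if natbar_le (theta w) (Some s) then 0 else X s w) +
   (if natbar_le (theta w) (Some s) then v w else 0).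
pose X2 s w := projT theta X s w + (if natbar_le (theta w) (Some s) then - v w else 0).
have Lv : Linf P (sigma_at F theta) v.
  by split; [exact: L0_wrt|exists m; exact: aeW].
have LNv : Linf P (sigma_at F theta) (fun w => - v w).
  split; last by exists m; apply: aeW => w; rewrite normrN.
  apply: (@L0_ae _ _ _ _ _ (fun w => -1 * v w)); first by apply: aeW => w; rewrite mulN1r.
  have sG := sigma_at_sigma hF sth.
  by apply: (L0M sG); [exact: (L0_cst _ sG)|exact: L0_wrt].
have rX1 : Ron tau X1.
  apply: (RonD hF); first exact: (Ron_trunc hF).
  by apply: (Ron_le tth thT); exact: (Ron_shift hF).
have rX2 : Ron theta X2 by apply: (RonD hF) => //; exact: (Ron_shift hF).
have [_ _ sX] := rX.
have pX1 : {ae P, forall w, phi_at tau X w = phi_at tau X1 w}.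
  have e : {ae P, forall w, forall s, X1 s w =
      (if natbar_le (theta w) (Some s) then 0 else X s w) +
      (if natbar_le (theta w) (Some s) then phi_at theta (projT theta X) w else 0)}.
    by apply: filterS vE => w vE' s; rewrite vE'.
  apply: filterS2 (phi_at_time_consistent rX) (phi_at_ext hF hphi stau tauT ftau rX1 e).
  by move=> w -> ->.
have aX1 : acc tau X1.
  by apply/accP => //; split => //; apply: filterS2 hX pX1 => w + <-.
have X1v w s : natbar_le (theta w) (Some s) -> X1 s w = v w.
  by move=> h; rewrite /X1 h add0r.
exists X1, X2, v; split.
- by split => //; exists m.
- apply/accP => //; split => //.
  apply: filterS2 (phi_at_translation hF hphi sth thT fth rV LNv) vE => w -> ->.
  by rewrite subrr.
- apply: filterS3 sX tth thT => w sX tt tT s; rewrite /X1 /X2 /Defs.proj.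
  case: ifP => h; last by rewrite !addr0.
  by rewrite add0r addrC subrK {1}sX (natbar_le_trans tt h).
- move=> Y /accP-/(_ sth thT)[rY hY].
  have rXY : Ron tau (fun s w => X1 s w + Y s w).
    by apply: (RonD hF) => //; exact: (Ron_le tth thT).
  apply/accP => //; split => //.
  have [_ _ sY] := rY.
  have rXYp := Ron_proj hF sth tth thT rXY.
  have E : {ae P, forall w, phi_at theta (projT theta (fun s w => X1 s w + Y s w)) w =
      phi_at theta Y w + v w}.
    have e : {ae P, forall w, forall s, projT theta (fun s w => X1 s w + Y s w) s w =
        Y s w + (if natbar_le (theta w) (Some s) then v w else 0)}.
      apply: filterS2 sY thT => w sY' tT s; rewrite /Defs.proj.
      case: (boolP (natbar_le (theta w) (Some s))) => h; last by rewrite sY' (negbTE h) addr0.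
      by rewrite X1v ?natbar_le_min// addrC [in RHS]sY' h.
    apply: filterS2 (phi_at_ext hF hphi sth thT fth rXYp e) (phi_at_translation hF hphi sth thT fth rY Lv).
    by move=> w -> ->.
  have [v' [mv' [m' vm'] vE']] := phi_at_version hF hphi sth thT fth rXYp.
  pose Z s w := (if natbar_le (theta w) (Some s) then 0 else X1 s w + Y s w) +
     (if natbar_le (theta w) (Some s) then phi_at theta (projT theta (fun s w => X1 s w + Y s w)) w else 0).
  have rZ : Ron tau Z.
    apply: (RonD hF); first exact: (Ron_trunc hF).
    apply: (Ron_le tth thT); apply: (Ron_shift hF) => //; split.
      by exists v' => //; apply: filterS vE' => w ->.
    by exists m'; apply: filterS vE' => w ->.
  have mon : {ae P, forall w, phi_at tau X1 w <= phi_at tau Z w}.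
    apply: (phi_at_mono hF hphi stau tauT ftau rX1 rZ).
    apply: filterS3 E hY sY => w E hY sY s; rewrite /Z.
    case: (boolP (natbar_le (theta w) (Some s))) => h.
      by rewrite X1v// E add0r lerDr.
    by rewrite addr0 lerDl [leRHS]sY (negbTE h).
  have /accP-/(_ stau tauT)[_ hX1] := aX1.
  apply: filterS3 (phi_at_time_consistent rXY) mon hX1 => w -> h1 h2.
  exact: le_trans h2 h1.
Qed.

End two.
End Decomposition.

(** * Versions of the increments of a dual process *)

Lemma is_cvg_seriesMl (R : realType) (c : R) (u : nat -> R) :
  cvgn (series u) -> cvgn (series (fun t => c * u t)).
Proof.
move=> cu; rewrite (_ : series _ = fun n => c * series u n); first exact: is_cvgMr.
by apply/funext => n; rewrite /series/= mulr_sumr.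
Qed.

Lemma lim_seriesMl (R : realType) (c : R) (u : nat -> R) :
  cvgn (series u) -> limn (series (fun t => c * u t)) = c * limn (series u).
Proof.
move=> cu; rewrite (_ : series _ = fun n => c * series u n).
  by apply: cvg_lim => //; apply: cvgMr.
by apply/funext => n; rewrite /series/= mulr_sumr.
Qed.

Section Densities.
Context {R : realType} {d : measure_display} {Omega : measurableType d}.
Variable P : probability Omega R.
Implicit Types (X e : nat -> Omega -> R).

(** The integral of X against the measure on N with weights e. *)
Definition Sint X e (w : Omega) : R := limn (series (fun t => X t w * e t w)).

(** The total mass of the measure on N with weights e. *)
Definition mass e (w : Omega) : R := limn (series (fun t => e t w)).

(** Weights that are measurable, nonnegative and summable at every point, with an
    integrable total mass. *)
Definition dens e : Prop :=
  [/\ forall t, measurable_fun setT (e t), forall t w, 0 <= e t w,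
      forall w, cvgn (series (fun t => e t w)) & L1 P (mass e)].

(** Uniformly bounded processes with measurable components, at every point and
    without reference to the filtration. *)
Definition bounded_process X : Prop :=
  (forall t, measurable_fun setT (X t)) /\ exists m : R, forall t w, `|X t w| <= m.

Lemma bounded_processD X Y : bounded_process X -> bounded_process Y ->
  bounded_process (fun t w => X t w + Y t w).
Proof.
move=> [mX [m bX]] [mY [n bY]]; split; first by move=> t; exact: measurable_funD.
by exists (m + n) => t w; rewrite (le_trans (ler_normD _ _))// lerD.
Qed.

Lemma bounded_processM X Y : bounded_process X -> bounded_process Y ->
  bounded_process (fun t w => X t w * Y t w).
Proof.
move=> [mX [m bX]] [mY [n bY]]; split; first by move=> t; exact: measurable_funM.
by exists (m * n) => t w; rewrite normrM ler_pM.
Qed.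

Lemma bounded_process_fun (f : Omega -> R) (m : R) : measurable_fun setT f ->
  (forall w, `|f w| <= m) -> bounded_process (fun _ w => f w).
Proof. by move=> mf bf; split => //; exists m => _. Qed.

Lemma bounded_process_cst (c : R) : bounded_process (fun _ _ => c).
Proof. by apply: (@bounded_process_fun _ `|c|); [exact: measurable_cst|]. Qed.

Lemma bounded_process_indic (A : set Omega) : measurable A ->
  bounded_process (fun _ w => \1_A w).
Proof.
move=> mA; split; first by move=> _; exact: measurable_indic.
by exists 1 => _ w; rewrite indicE; case: (_ \in _); rewrite ?normr0 ?normr1.
Qed.

Lemma bounded_process_if (b : nat -> Omega -> bool) X :
  (forall t, measurable [set w | b t w]) ->
  bounded_process X -> bounded_process (fun t w => if b t w then X t w else 0).
Proof.
move=> mb [mX [m bX]]; split.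
  move=> t; rewrite (_ : (fun w => _) = (fun w => \1_[set w | b t w] w * X t w)).
    by apply: measurable_funM => //; exact: measurable_indic.
  apply/funext => w; case: (boolP (b t w)) => h; first by rewrite indic_in// mul1r.
  by rewrite indic_out ?mul0r//=; exact/negP.
exists m => t w; case: ifP => // _; rewrite normr0.
exact: le_trans (bX t w).
Qed.

Section one.
Variable e : nat -> Omega -> R.
Hypothesis he : dens e.

Let e0 t w : 0 <= e t w. Proof. by case: he. Qed.
Let ecv w : cvgn (series (fun t => e t w)). Proof. by case: he. Qed.

Lemma mass_ge0 w : 0 <= mass e w.
Proof.
apply: limr_ge; first exact: ecv.
by apply: nearW => n; rewrite /series/=; apply: sumr_ge0.
Qed.

Lemma Sint_cvg X w (m : R) : (forall t, `|X t w| <= m) ->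
  cvgn (series (fun t => X t w * e t w)).
Proof.
move=> bX; apply: normed_cvg.
apply: (@series_le_cvg _ _ (fun t => m * e t w)) => //.
- by move=> t /=.
- by move=> t; rewrite mulr_ge0// (le_trans _ (bX t)).
- by move=> t /=; rewrite normrM (ger0_norm (e0 _ _)) ler_wpM2r.
- by apply: is_cvg_seriesMl; exact: ecv.
Qed.

Lemma Sint_bound X w (m : R) : (forall t, `|X t w| <= m) -> `|Sint X e w| <= m * mass e w.
Proof.
move=> bX; have c1 := Sint_cvg bX.
have cM (c : R) : cvgn (series (fun t => c * e t w)).
  by apply: is_cvg_seriesMl; exact: ecv.
have tM (c : R) : c * mass e w = limn (series (fun t => c * e t w)).
  by rewrite lim_seriesMl//; exact: ecv.
rewrite ler_norml; apply/andP; split.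
  rewrite -mulNr tM; apply: lim_series_le => // n; rewrite ler_wpM2r//.
  by have := bX n; rewrite ler_norml => /andP[].
rewrite tM; apply: lim_series_le => // n; rewrite ler_wpM2r//.
by rewrite (le_trans (ler_norm _)).
Qed.

Lemma Sint_L1 X : bounded_process X -> L1 P (Sint X e).
Proof.
move=> [mX [m bX]].
apply: (@le_L1 _ _ _ _ _ (fun w => m * mass e w)).
- apply: (@measurable_fun_cvg _ _ _ _ (fun n w => series (fun t => X t w * e t w) n)).
    move=> n; apply: measurable_sum => t; apply: measurable_funM => //.
    by case: he.
  by move=> w _; exact: (Sint_cvg (bX ^~ w)).
- by move=> w; exact: Sint_bound (bX ^~ w).
- by apply: L1Z; case: he.
Qed.

Lemma SintD X Y w : bounded_process X -> bounded_process Y ->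
  Sint (fun t w => X t w + Y t w) e w = Sint X e w + Sint Y e w.
Proof.
move=> [_ [m bX]] [_ [n bY]].
have := lim_seriesD (Sint_cvg (bX ^~ w)) (Sint_cvg (bY ^~ w)).
rewrite /Sint => <-; congr (limn (series _)); apply/funext => t.
by rewrite mulrDl.
Qed.

Lemma Sint_cst (c : Omega -> R) w : Sint (fun _ w => c w) e w = c w * mass e w.
Proof. by rewrite /Sint lim_seriesMl//; exact: ecv. Qed.

Lemma le_Sint X Y w : bounded_process X -> bounded_process Y ->
  (forall t, X t w <= Y t w) -> Sint X e w <= Sint Y e w.
Proof.
move=> [_ [m bX]] [_ [n bY]] XY; apply: lim_series_le.
- exact: Sint_cvg (bX ^~ w).
- exact: Sint_cvg (bY ^~ w).
- by move=> t; rewrite ler_wpM2r.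
Qed.

End one.

Lemma SintZ (c : Omega -> R) X e w (m : R) : dens e -> (forall t, `|X t w| <= m) ->
  Sint (fun t w => c w * X t w) e w = c w * Sint X e w.
Proof.
move=> he bX; rewrite /Sint -lim_seriesMl; last by apply: (Sint_cvg he); exact: bX.
by congr (limn (series _)); apply/funext => t; rewrite -mulrA.
Qed.

Lemma eq_Sint X Y e f w : (forall t, X t w * e t w = Y t w * f t w) ->
  Sint X e w = Sint Y f w.
Proof. by move=> h; congr (limn (series _)); apply/funext. Qed.

Lemma Sint_one e w : Sint (fun _ _ => 1) e w = mass e w.
Proof. by congr (limn (series _)); apply/funext => t; rewrite mul1r. Qed.

(** A comparison of integrals in which the dominating function g need not be
    measurable. *)
Lemma ae_le_integral_nonneg (f g : Omega -> \bar R) :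
  measurable_fun setT f -> (forall w, 0 <= f w)%E -> (forall w, 0 <= g w)%E ->
  {ae P, forall w, (f w <= g w)%E} -> (\int[P]_w f w <= \int[P]_w g w)%E.
Proof.
move=> mf f0 g0 [N [mN PN0 hN]].
pose h w := if w \in N then 0%E else f w.
have hf : h = f \_ (~` N).
  by apply/funext => w; rewrite /h patchE in_setC; case: (w \in N).
have mh : measurable_fun setT h.
  by rewrite hf; apply/(measurable_restrictT _ (measurableC mN)); exact: measurable_funTS.
have h0 w : (0 <= h w)%E by rewrite /h; case: ifP.
have -> : (\int[P]_w f w = \int[P]_w h w)%E.
  apply: ae_eq_integral => //; exists N; split => // w /= nh.
  apply: contrapT => nN; apply: nh => _; rewrite /h memNset//.
have hg w : (h w <= g w)%E.
  rewrite /h; case: (boolP (w \in N)) => // /negP nN.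
  by apply: contrapT => ngw; apply: nN; rewrite inE; exact: hN.
rewrite !ge0_integralTE//; apply: ereal_sup_le.
by move=> _ [k kh <-]; exists k => // w; exact: le_trans (kh w) (hg w).
Qed.

End Densities.

Section Pairing.
Context {R : realType} {d : measure_display} {Omega : measurableType d}.
Variables (P : probability Omega R) (F : nat -> set (set Omega)) (T : natbar).
Hypothesis hF : is_filtration P F.

Local Notation horizon := (fun=> T).
Local Notation Ron := (Ron P F T).
Implicit Types (sigma tau theta : Omega -> natbar) (X Y a b e : nat -> Omega -> R).

Lemma Ron_version sigma X : Ron sigma X ->
  exists2 X', bounded_process X' & {ae P, forall w, forall t, X t w = X' t w}.
Proof.
move=> [aX [m m0 bX] _].
have ex t : exists g, measurable_fun setT g /\ {ae P, forall w, X t w = g w}.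
  have [g mg Xg] := L0_ex (aX t); exists g; split => //.
  by apply: measurable_wrt_fun mg; exact: (filtration_measurable hF).
have [g hg] := choice ex.
exists (fun t w => Num.max (Num.min (g t w) m) (- m)).
  split; first by move=> t; apply: measurable_maxr => //; apply: measurable_minr => //; case: (hg t).
  exists m => t w; rewrite ler_norml le_max lexx orbT ge_max ge_min lexx orbT/=.
  by rewrite (le_trans _ m0)// oppr_le0.
have : {ae P, forall w, forall t, X t w = g t w}.
  by apply: ae_foralln => t; case: (hg t).
apply: filterS2 bX => w bX Xg t; rewrite -Xg.
by have := bX t; rewrite ler_norml => /andP[h1 h2]; rewrite (min_idPl h2) (max_idPl h1).
Qed.

(** If e and X' are versions of the increments of a and of X, the pairing is the
    conditional expectation of the sum of the X' t * e t. *)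
Lemma pairing_ce sigma h X a X' e : stopping_time F sigma -> dens P e ->
  bounded_process X' ->
  {ae P, forall w, forall t, (if natbar_le (sigma w) (Some t) && natbar_le (Some t) (h w)
      then X t w * incr a t w else 0) = X' t w * e t w} ->
  ce P (sigma_at F sigma) (Sint X' e) (pairing P F sigma h X a).
Proof.
move=> st he bX E; apply: condexp_ce.
- exact: (sigma_at_sigma hF).
- exact: sigma_at_measurable.
- exact: Sint_L1.
apply: filterS E => w E _; congr (limn (series _)); exact/funext.
Qed.

Lemma measurable_if_set (b : Omega -> bool) (f : Omega -> R) :
  measurable [set w | b w] -> measurable_fun setT f ->
  measurable_fun setT (fun w => if b w then f w else 0).
Proof.
move=> mb mf; rewrite (_ : (fun w => _) = (fun w => \1_[set w | b w] w * f w)).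
  by apply: measurable_funM => //; exact: measurable_indic.
apply/funext => w; case: (boolP (b w)) => h; first by rewrite indic_in// mul1r.
by rewrite indic_out ?mul0r//=; exact/negP.
Qed.

Lemma series_incr (A : nat -> Omega -> R) w n : series (fun t => incr A t w) n = Defs.prev A n w.
Proof.
elim: n => [|n IH]; first by rewrite /series/= big_geq.
by rewrite seriesSr IH /incr /= addrC subrK.
Qed.

Lemma measurable_incr (A : nat -> Omega -> R) t : (forall t, measurable_fun setT (A t)) ->
  measurable_fun setT (incr A t).
Proof.
move=> mA; apply: measurable_funB => //.
by case: t => [|t]; [exact: (@measurable_cst _ _ _ _ _ (0 : R))|exact: mA].
Qed.

(** The weights e are versions of the increments of a, and are carried by
    [sigma, T]. *)
Definition has_dens sigma a e : Prop :=
  [/\ dens P e, {ae P, forall w, forall t, incr a t w = e t w},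
      {ae P, forall w, forall t, ~~ natbar_le (Some t) T -> e t w = 0} &
      {ae P, forall w, forall t, ~~ natbar_le (sigma w) (Some t) -> e t w = 0}].

(** Elements of (A^1_(sigma,T))_+ have such weights. *)
Lemma A1_has_dens sigma a : stopping_time F sigma -> stopping_le P sigma horizon ->
  A1_plus_on P F sigma horizon a -> exists e, has_dens sigma a e.
Proof.
move=> st sT [b [[adb nb] ib] ab].
have ex t : exists g, measurable_fun setT g /\ {ae P, forall w, b t w = g w}.
  have [g mg Xg] := L0_ex (adb t); exists g; split => //.
  by apply: measurable_wrt_fun mg; exact: (filtration_measurable hF).
have [g hg] := choice ex.
have bg : {ae P, forall w, forall t, b t w = g t w} by apply: ae_foralln => t; case: (hg t).
have mg t : measurable_fun setT (g t) by case: (hg t).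
pose be t w := Num.max (incr g t w) 0.
have be0 t w : 0 <= be t w by rewrite /be le_max lexx orbT.
have mbe t : measurable_fun setT (be t) by apply: measurable_maxr => //; exact: measurable_incr.
have bbe : {ae P, forall w, forall t, incr b t w = be t w}.
  apply: filterS2 bg ib => w bg' ib' t.
  have E : incr b t w = incr g t w.
    by rewrite /incr bg'; case: t => [|t] //=; rewrite bg'.
  by rewrite /be -E; apply/esym/max_idPl; rewrite E -E.
(* N is the total mass; it is finite almost surely, and the weights are set to
   0 where it is not *)
pose N w : \bar R := (\sum_(0 <= t <oo) (be t w)%:E)%E.
have N0 w : (0 <= N w)%E by apply: nneseries_ge0 => t _ _; rewrite lee_fin.
have mN : measurable_fun setT N.
  by apply: ge0_emeasurable_sum => [t w _ _|t _]; [rewrite lee_fin|exact/measurable_EFinP].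
have iN : (\int[P]_w N w < +oo)%E.
  apply: le_lt_trans nb; apply: ae_le_integral_nonneg => //.
    by move=> w; apply: nneseries_ge0.
  apply: filterS bbe => w h; rewrite /N.
  rewrite (@eq_eseriesr _ _ (fun t => `|incr b t w|%:E))// => t _.
  by rewrite h ger0_norm.
have LN : P.-integrable setT N.
  apply/integrableP; split => //.
  by under eq_integral do rewrite gee0_abs//.
have Nfin : {ae P, forall w, N w \is a fin_num}.
  by apply: filterS (integrable_ae measurableT LN) => w; exact.
pose G n w := \sum_(0 <= s < n) be s w.
have mG n : measurable_fun setT (G n) by apply: measurable_sum.
have GS n w : G n.+1 w = G n w + be n w by rewrite /G big_nat_recr.
have Gnd m n w : (m <= n)%N -> G m w <= G n w.
  by move=> mn; rewrite /G; apply: (nondecreasing_series (P := xpredT) (m := 0%N)).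
have G0 n w : 0 <= G n w by rewrite /G sumr_ge0.
have GN n w : N w \is a fin_num -> G n w <= fine (N w).
  move=> fN; rewrite -lee_fin fineK// /G -sumEFin.
  by apply: nneseries_lim_ge => t _ _; rewrite lee_fin.
(* the projection of the partial sums G on [sigma, T], a version of a *)
pose A t w := if natbar_le (sigma w) (Some t) then G (natbar_min t T).+1 w else 0.
have mA t : measurable_fun setT (A t).
  by apply: measurable_if_set => //; exact: (stopping_measurable hF st).
have AN t w : N w \is a fin_num -> 0 <= A t w <= fine (N w).
  move=> fN; rewrite /A; case: ifP => _; first by rewrite G0 GN.
  by rewrite lexx fine_ge0.
have AS t w : A t w <= A t.+1 w.
  rewrite /A; case: (boolP (natbar_le (sigma w) (Some t))) => h.
    rewrite (natbar_le_trans h)//=; apply: Gnd; case: (T) => [k|] //=; lia.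
  by case: ifP.
have iA0 t w : 0 <= incr A t w.
  rewrite /incr; case: t => [|t] /=; last by rewrite subr_ge0.
  by rewrite subr0 /A; case: ifP.
pose e t w := if N w \is a fin_num then incr A t w else 0.
have e0 t w : 0 <= e t w by rewrite /e; case: ifP.
have mfin : measurable [set w | N w \is a fin_num].
  by have := emeasurable_fin_num measurableT mN; rewrite setTI.
have me t : measurable_fun setT (e t) by apply: measurable_if_set => //; exact: measurable_incr.
have eE w : N w \is a fin_num -> series (fun t => e t w) = fun n => Defs.prev A n w.
  by move=> fN; apply/funext => n; rewrite -series_incr /e fN.
have e_out w : N w \isn't a fin_num -> series (fun t => e t w) = fun=> 0.
  move=> /negbTE nN; apply/funext => n; rewrite /series/= big1// => t _.
  by rewrite /e nN.
have bnd w n : series (fun t => e t w) n <= fine (N w).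
  case: (boolP (N w \is a fin_num)) => fN; last by rewrite e_out// fine_ge0.
  rewrite eE//; case: n => [|n] /=; first exact: fine_ge0.
  by have /andP[] := AN n w fN.
have ecvg w : cvgn (series (fun t => e t w)).
  apply: nondecreasing_is_cvgn; first by apply: nondecreasing_series.
  by exists (fine (N w)) => _ [n _ <-].
exists e; split.
- split => //.
  apply: (le_integrable measurableT _ _ LN).
    apply/measurable_EFinP.
    apply: (@measurable_fun_cvg _ _ _ _ (fun n w => series (fun t => e t w) n)).
      by move=> n; apply: measurable_sum.
    by move=> w _; exact: ecvg.
  move=> w _ /=; rewrite ger0_norm; last first.
    apply: limr_ge; first exact: ecvg.
    by apply: nearW => n; rewrite /series/=; apply: sumr_ge0.
  rewrite gee0_abs//; case: (boolP (N w \is a fin_num)) => fN.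
    rewrite -(fineK fN) lee_fin; apply: limr_le; first exact: ecvg.
    by apply: nearW => n; exact: bnd.
  suff -> : mass e w = 0 by [].
  by apply: cvg_lim => //; rewrite (e_out _ fN); exact: cvg_cst.
- apply: filterS3 Nfin ab (filterI bbe sT) => w fN ab' [bb sT'] t.
  have bG s : b s w = G s.+1 w.
    elim: s => [|s IH]; first by rewrite GS /G big_geq// add0r -bb /incr subr0.
    by rewrite GS -IH -bb /incr /= addrC subrK.
  have aA s : a s w = A s w by rewrite ab' /Defs.proj /A -bG.
  by rewrite /e fN /incr aA; case: t => [|t] //=; rewrite aA.
- apply: filterS2 Nfin sT => w fN sT' [|t] tT; first by case: (T) tT.
  rewrite /e fN /incr /= /A.
  have h1 : natbar_le (sigma w) (Some t.+1).
    by move: sT' tT; case: (sigma w) (T) => [k|] [n|] //=; lia.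
  have h2 : natbar_le (sigma w) (Some t).
    by move: sT' tT; case: (sigma w) (T) => [k|] [n|] //=; lia.
  rewrite h1 h2 (_ : natbar_min t.+1 T = natbar_min t T) ?subrr//.
  by move: tT; case: (T) => [n|] //=; lia.
- apply: aeW => w t h; rewrite /e; case: ifP => // _.
  rewrite /incr /A (negbTE h); case: t h => [|t] h /=; first by rewrite subr0.
  rewrite ifF ?subr0//; apply/negbTE; apply: contra h => h; apply: (natbar_le_trans h) => /=; exact: leqnSn.
Qed.

End Pairing.

(** * Pairing with a concatenation *)

Section Concat.
Context {R : realType} {d : measure_display} {Omega : measurableType d}.
Variables (P : probability Omega R) (F : nat -> set (set Omega)) (T : natbar).
Hypothesis hF : is_filtration P F.

Local Notation horizon := (fun=> T).
Local Notation Ron := (Ron P F T).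
Local Notation has_dens := (has_dens P T).
Local Notation pairing := (pairing P F).
Implicit Types (sigma tau theta : Omega -> natbar) (X Y a b e : nat -> Omega -> R).

(** For elements of D_(sigma,T) the total mass has conditional expectation 1. *)
Lemma D_has_dens sigma a : stopping_time F sigma -> stopping_le P sigma horizon ->
  D_on P F sigma horizon a -> exists2 e, has_dens sigma a e &
  forall A, sigma_at F sigma A -> (\int[P]_(w in A) (mass e w)%:E = P A)%E.
Proof.
move=> st sT [a1 pa1]; have [e he] := A1_has_dens hF st sT a1; exists e => // A hA.
have [de ie eT es] := he.
have mA := sigma_at_measurable hA.
have bX := @bounded_process_cst R d Omega 1.
have [_ L1p pE] : ce P (sigma_at F sigma) (Sint (fun _ _ => 1) e)
    (pairing sigma horizon one_process a).
  apply: (pairing_ce hF) => //.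
  apply: filterS3 ie eT es => w ie' eT' es' t; rewrite /one_process mul1r ie'.
  case: (boolP (natbar_le (sigma w) (Some t))) => h1; rewrite ?andTb ?andFb; last by rewrite es'// mulr0.
  rewrite mul1r; case: ifP => // /negbT h2; by rewrite eT'.
under eq_integral do rewrite -Sint_one.
rewrite -pE//.
have -> : (\int[P]_(w in A) (pairing sigma horizon one_process a w)%:E = \int[P]_(w in A) 1%:E)%E.
  apply: eq_integral_L1 => //; first exact: L1_cst.
  by apply: filterS pa1 => w; apply.
by rewrite integral_cst// mul1e.
Qed.

(** The pairing at theta only involves times from theta on, so a may as well start
    at another time sigma. *)
Lemma pairing_Ron sigma theta X X' a e : stopping_time F theta -> has_dens sigma a e ->
  Ron theta X -> bounded_process X' -> {ae P, forall w, forall t, X t w = X' t w} ->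
  ce P (sigma_at F theta) (Sint X' e) (pairing theta horizon X a).
Proof.
move=> st [de ie eT es] [_ _ sX] bX XX; apply: (pairing_ce hF) => //.
apply: filterS3 (filterI ie eT) XX sX => w [ie' eT'] XX' sX' t; rewrite -XX' ie'.
case: (boolP (natbar_le (theta w) (Some t))) => h1; rewrite ?andTb ?andFb; last first.
  by rewrite sX' (negbTE h1) mul0r.
by case: (boolP (natbar_le (Some t) T)) => h2 //; rewrite eT'// mulr0.
Qed.

Section two.
Variables tau theta : Omega -> natbar.
Hypotheses (stau : stopping_time F tau) (sth : stopping_time F theta).
Hypotheses (fth : {ae P, forall w, theta w <> None}).
Hypotheses (tth : stopping_le P tau theta) (thT : stopping_le P theta horizon).
Variables a e : nat -> Omega -> R.
Hypothesis he : has_dens tau a e.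

Let de : dens P e. Proof. by case: he. Qed.
Let Le : L1 P (mass e). Proof. by case: de. Qed.
Let sGtau := sigma_at_sigma hF stau.
Let sGth := sigma_at_sigma hF sth.
Let Gmtau := @sigma_at_measurable d Omega F tau.
Let Gmth := @sigma_at_measurable d Omega F theta.

Let mle t : measurable [set w | natbar_le (theta w) (Some t)].
Proof. exact: (stopping_measurable hF sth). Qed.

(** Since tau <= theta holds only almost surely, an event of sigma_at tau has to
    be cut down by a null set before it lies in sigma_at theta. *)
Lemma integral_sigma_at_le A f : sigma_at F tau A -> L1 P f ->
  (\int[P]_(w in A) (f w)%:E =
   \int[P]_(w in A `&` [set w | natbar_le (tau w) (theta w)]) (f w)%:E)%E.
Proof.
move=> hA Lf; have hA' := sigma_at_le hF stau sth hA.
apply: integral_eq_mod_null => //; [by case: hA|by case: hA'|].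
by apply: filterS tth => w tw; split => [Aw|[]].
Qed.

Lemma pairing_tower X X' Q : Ron theta X -> bounded_process X' ->
  {ae P, forall w, forall t, X t w = X' t w} ->
  ce P (sigma_at F tau) (pairing theta horizon X a) Q ->
  ce P (sigma_at F tau) (Sint X' e) Q.
Proof.
move=> rX bX XX [mQ LQ QE]; have [mp Lp pE] := pairing_Ron sth he rX bX XX.
split => // A hA; rewrite QE// integral_sigma_at_le// pE; last exact: (sigma_at_le hF stau sth hA).
by rewrite -integral_sigma_at_le//; exact: Sint_L1.
Qed.

(** The pairing of a position that is split at theta: the tail X2 contributes
    through its value at theta, by the tower property. *)
Lemma pairing_split X X1 X2 Q : Ron tau X -> Ron tau X1 -> Ron theta X2 ->
  {ae P, forall w, forall s, X s w = X1 s w + X2 s w} ->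
  ce P (sigma_at F tau) (pairing theta horizon X2 a) Q ->
  {ae P, forall w, pairing tau horizon X a w = pairing tau horizon X1 a w + Q w}.
Proof.
move=> rX rX1 rX2 XX hQ.
have [X1' bX1 XX1] := Ron_version hF rX1; have [X2' bX2 XX2] := Ron_version hF rX2.
have bX := bounded_processD bX1 bX2.
have E : {ae P, forall w, forall t, X t w = X1' t w + X2' t w}.
  by apply: filterS3 XX XX1 XX2 => w h h1 h2 t; rewrite h h1 h2.
have c := pairing_Ron stau he rX bX E.
have c1 := pairing_Ron stau he rX1 bX1 XX1.
have c2 := pairing_tower rX2 bX2 XX2 hQ.
have L1' := Sint_L1 de bX1; have L2' := Sint_L1 de bX2.
apply: (ce_unique sGtau Gmtau c (ceD sGtau Gmtau L1' L2' c1 c2)) => A hA.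
by apply: eq_integral => w _; rewrite (SintD de).
Qed.

(* the indicator of [theta, oo): its sum against e is the mass of a from theta on *)
Let one_th (t : nat) (w : Omega) : R := if natbar_le (theta w) (Some t) then 1 else 0.

Let b1 : bounded_process one_th.
Proof.
by apply: bounded_process_if => //; exact: bounded_process_cst.
Qed.

Let pa := pairing theta (fun=> None) one_process a.

Let pa_ce : ce P (sigma_at F theta) (Sint one_th e) pa.
Proof.
apply: (pairing_ce hF) => //.
have [_ ie _ _] := he.
apply: filterS ie => w ie' t; rewrite andbT /one_th /one_process ie' mul1r.
by case: ifP; rewrite ?mul1r ?mul0r.
Qed.

Let E_ge0 w : 0 <= Sint one_th e w.
Proof.
rewrite -[leLHS](mul0r (mass e w)) -(Sint_cst de (fun=> 0)).
apply: (le_Sint de) => //; first exact: bounded_process_cst.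
by move=> t; rewrite /one_th; case: ifP.
Qed.

(** The mass of a that is expected at theta to come from theta on, in a version that
    is nonnegative everywhere. *)
Definition tail_mass (w : Omega) : R := Num.max (pa w) 0.
Let M := tail_mass.

Let M0 w : 0 <= M w. Proof. by rewrite /M /tail_mass le_max lexx orbT. Qed.

Let paM : {ae P, forall w, pa w = M w}.
Proof.
have c0 : ce P (sigma_at F theta) (fun=> 0) (fun=> 0).
  by split => //; [exact: (measurable_wrt_cst sGth)|exact: L1_cst].
have := ce_le sGth Gmth c0 pa_ce; have h A (_ : sigma_at F theta A) :
    (\int[P]_(w in A) 0%:E <= \int[P]_(w in A) (Sint one_th e w)%:E)%E.
  rewrite integral0; apply: integral_ge0 => w _; rewrite lee_fin; exact: E_ge0.
move=> /(_ h); apply: filterS => w h'; rewrite /M /tail_mass.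
by apply/esym/max_idPl.
Qed.

Let M_ce : ce P (sigma_at F theta) (Sint one_th e) M.
Proof.
have [mp Lp pE] := pa_ce; split.
- by apply: (measurable_wrt_max sGth) => //; exact: (measurable_wrt_cst sGth).
- exact: L1_max.
- move=> A hA; rewrite -pE//; apply: eq_integral_L1 => //; [exact: Gmth|exact: L1_max|].
  by apply: filterS paM.
Qed.

Section concat_b.
Variables b f : nat -> Omega -> R.
Hypothesis hf : has_dens theta b f.
Hypothesis mf : forall A, sigma_at F theta A -> (\int[P]_(w in A) (mass f w)%:E = P A)%E.

Let df : dens P f. Proof. by case: hf. Qed.

Let Lmf : L1 P (mass f). Proof. by case: df. Qed.
Let mmf : measurable_fun setT (mass f). Proof. exact: L1_measurable Lmf. Qed.

Let mMT : measurable_fun setT M.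
Proof. by apply: (measurable_wrt_fun Gmth); case: M_ce. Qed.

(* Up to conditioning on sigma_at theta, the mass of a from theta on equals the
   mass M * mass f that the concatenation puts there. *)
Let tail_mass_tower (Z : Omega -> R) : measurable_wrt (sigma_at F theta) Z -> (forall w, 0 <= Z w) ->
  (\int[P]_w (Z w * M w * mass f w)%:E = \int[P]_w (Z w * Sint one_th e w)%:E)%E.
Proof.
move=> mZ Z0; have [mM LM ME] := M_ce.
rewrite (@ge0_integralM_eq _ _ _ P _ sGth Gmth (mass f) (fun=> 1)) //; first last.
- by move=> w; rewrite mulr_ge0.
- exact: (measurable_wrtM sGth).
- move=> A hA; rewrite mf// integral_cst ?mul1e//; exact: Gmth.
- by move=> w; exact: (mass_ge0 df).
under eq_integral do rewrite mulr1.
apply: (@ge0_integralM_eq _ _ _ P _ sGth Gmth) => //.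
exact: L1_measurable (Sint_L1 de b1).
Qed.

Let LMf : L1 P (fun w => M w * mass f w).
Proof.
apply/integrableP; split; first by apply/measurable_EFinP; exact: measurable_funM.
have := tail_mass_tower (measurable_wrt_cst sGth 1) (fun _ => ler01).
under eq_integral do rewrite mul1r.
under [in RHS]eq_integral do rewrite mul1r.
under [X in _ -> (X < _)%E]eq_integral.
  move=> w _ /=; rewrite ger0_norm; last by rewrite mulr_ge0// (mass_ge0 df).
  over.
by move=> ->; apply: integrable_lty => //; exact: Sint_L1.
Qed.

(** The weights of the concatenation of a and b at theta: those of a before theta,
    and M times those of b from theta on. They are versions of its increments
    because b has conditional mass 1, so that no division remains. *)
Definition concat_dens (t : nat) (w : Omega) : R :=
  (if natbar_le (theta w) (Some t) then 0 else e t w) + M w * f t w.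
Let c := concat_dens.

(* X restricted to the times before theta *)
Let before X t w := if natbar_le (theta w) (Some t) then 0 else X t w : R.

Let b_before X : bounded_process X -> bounded_process (before X).
Proof.
move=> bX; have [_ [m bm]] := bX.
rewrite (_ : before X = fun t w => if ~~ natbar_le (theta w) (Some t) then X t w else 0).
  apply: bounded_process_if => // t.
  rewrite (_ : [set _ | _] = ~` [set w | natbar_le (theta w) (Some t)]); first exact: measurableC.
  by apply/seteqP; split => w /=; [move/negP|move=> h; exact/negP].
by apply/funext => t; apply/funext => w; rewrite /before; case: ifP.
Qed.

Let Sint_concat X w : bounded_process X ->
  cvgn (series (fun t => X t w * c t w)) /\
  Sint X c w = Sint (before X) e w + M w * Sint X f w.
Proof.
move=> bX; have [_ [m bm]] := bX; have [_ [n bn]] := b_before bX.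
have c1 := Sint_cvg de (bn ^~ w).
have c2 : cvgn (series (fun t => M w * (X t w * f t w))).
  by apply: is_cvg_seriesMl; exact: (Sint_cvg df (bm ^~ w)).
have E : (fun t => X t w * c t w) = (fun t => before X t w * e t w) + (fun t => M w * (X t w * f t w)).
  apply/funext => t; rewrite /c /concat_dens /before -[RHS]/(_ + _).
  by case: ifP => _; ring.
split; first by rewrite E; exact: is_cvg_seriesD.
rewrite /Sint E lim_seriesD// lim_seriesMl//; exact: (Sint_cvg df (bm ^~ w)).
Qed.

Let mass_concat w : mass c w = Sint (before (fun _ _ => 1)) e w + M w * mass f w.
Proof.
rewrite -Sint_one (Sint_concat w _).2 ?Sint_one//.
exact: bounded_process_cst.
Qed.

Let b_cst1 : bounded_process (fun _ (_ : Omega) => 1 : R).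
Proof. exact: bounded_process_cst. Qed.

Let dc : dens P c.
Proof.
split.
- move=> t; apply: measurable_funD; last by apply: measurable_funM => //; case: df.
  have [+ _] := b_before (b_cst1) => /(_ t) m1.
  rewrite (_ : (fun w => _) = (fun w => before (fun _ _ => 1) t w * e t w)).
    by apply: measurable_funM => //; case: de.
  by apply/funext => w; rewrite /before; case: ifP => _; rewrite ?mul0r ?mul1r.
- move=> t w; rewrite addr_ge0//; last by rewrite mulr_ge0//; case: df.
  by case: ifP => // _; case: de.
- move=> w; have [+ _] := Sint_concat w b_cst1.
  by under eq_fun do rewrite mul1r.
- rewrite (_ : mass c = fun w => Sint (before (fun _ _ => 1)) e w + M w * mass f w); last first.
    by apply/funext => w; rewrite mass_concat.
  by apply: L1D => //; apply: Sint_L1 => //; exact: b_before.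
Qed.

Let concat_incr : {ae P, forall w, forall t, incr (concat P F theta setT a b) t w = c t w}.
Proof.
have pb1 : {ae P, forall w, pairing theta (fun=> None) one_process b w = 1}.
  have [_ ie _ es] := hf.
  have h : ce P (sigma_at F theta) (Sint (fun _ _ => 1) f) (pairing theta (fun=> None) one_process b).
    apply: (pairing_ce hF) => //.
    apply: filterS2 ie es => w ie' es' t; rewrite andbT /one_process ie' mul1r.
    by case: ifP => // h; rewrite es' ?h// mulr0.
  have c1 : ce P (sigma_at F theta) (fun=> 1) (fun=> 1).
    by split => //; [exact: (measurable_wrt_cst sGth)|exact: L1_cst].
  apply: (ce_unique sGth Gmth h c1) => A hA.
  under eq_integral do rewrite Sint_one.
  by rewrite mf// integral_cst ?mul1e//; exact: Gmth.
have [_ ia _ _] := he; have [_ ib _ fs] := hf.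
apply: filterS3 (filterI pb1 paM) (filterI ia ib) (filterI fs fth) => w [pb1' paM'] [ia' ib'] [fs' fth'] t.
rewrite /c /concat_dens -ia' -ib'.
have cE s : concat P F theta setT a b s w = if natbar_le (theta w) (Some s)
    then (if theta w is Some k then Defs.prev a k w + M w * (b s w - Defs.prev b k w) else 0)
    else a s w.
  rewrite /concat; case: (theta w) fth' => [k|] // _.
  rewrite -/pa pb1' paM' divr1 /=; case: ifP => [/asboolP[-> _]|]//.
  by move/asboolPn => h; rewrite ifF//; apply/negbTE/negP => ks; apply: h; split.
rewrite {1}/incr cE.
case E : (theta w) fth' => [k|] // _; case: t => [|t] /=.
  case: (leqP k 0) => k0.
    have -> : k = 0%N by lia.
    by rewrite /incr /= !subr0 !add0r.
  have := fs' 0%N; rewrite E /= -ltnNge -ib' => /(_ k0) ->.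
  by rewrite mulr0 addr0 /incr.
rewrite cE E /=; case: (leqP k t) => kt.
  rewrite (leqW kt) add0r /incr /=; ring.
case: (leqP k t.+1) => kt'.
  have -> : k = t.+1 by lia.
  by rewrite /incr /=; ring.
have := fs' t.+1; rewrite E /= -ltnNge -ib' => /(_ kt') ->.
by rewrite mulr0 addr0 /incr.
Qed.

Let pairing_concat X X' : Ron tau X -> bounded_process X' ->
  {ae P, forall w, forall t, X t w = X' t w} ->
  ce P (sigma_at F tau) (Sint X' c) (pairing tau horizon X (concat P F theta setT a b)).
Proof.
move=> [_ _ sX] bX XX; apply: (pairing_ce hF) => //.
have [_ _ eT _] := he; have [_ _ fT _] := hf.
apply: filterS3 (filterI concat_incr XX) (filterI eT fT) sX => w [ci XX'] [eT' fT'] sX' t.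
rewrite -XX' ci; case: (boolP (natbar_le (tau w) (Some t))) => h1; rewrite ?andTb ?andFb; last first.
  by rewrite sX' (negbTE h1) mul0r.
case: (boolP (natbar_le (Some t) T)) => h2 //.
by rewrite /c /concat_dens eT'// fT'// mulr0 addr0; case: ifP; rewrite mulr0.
Qed.

(** On a position that is constant from theta on, the concatenation is worth as much
    as a: both put the same conditional mass from theta on. *)
Lemma pairing_concat_frozen X v (m : R) : Ron tau X ->
  measurable_wrt (sigma_at F theta) v -> (forall w, `|v w| <= m) ->
  (forall w s, natbar_le (theta w) (Some s) -> X s w = v w) ->
  {ae P, forall w, pairing tau horizon X (concat P F theta setT a b) w =
                   pairing tau horizon X a w}.
Proof.
move=> rX mv vm Xv; have [X' bX XX] := Ron_version hF rX.
apply: (ce_unique sGtau Gmtau (pairing_concat rX bX XX) (pairing_Ron stau he rX bX XX)) => A hA.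
have mA := Gmtau hA.
have mvT := measurable_wrt_fun Gmth mv.
have Lb : L1 P (Sint (before X') e) by apply: Sint_L1 => //; exact: b_before.
have LvM : L1 P (fun w => v w * (M w * mass f w)) by exact: L1M_bounded vm _.
have LE : L1 P (Sint one_th e) by exact: Sint_L1.
have LvE : L1 P (fun w => v w * Sint one_th e w) by exact: L1M_bounded vm _.
have [_ _ _ fs] := hf; have [_ [m' bm']] := bX.
transitivity (\int[P]_(w in A) (Sint (before X') e w + v w * (M w * mass f w))%:E)%E.
  apply: eq_integral_L1 => //; [exact: Sint_L1|exact: L1D|].
  apply: filterS2 XX fs => w XX' fs'.
  rewrite (Sint_concat w bX).2; congr (_ + _).
  rewrite mulrCA -(Sint_cst df v); congr (_ * _); apply: eq_Sint => t.
  case: (boolP (natbar_le (theta w) (Some t))) => h; first by rewrite -XX' Xv.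
  by rewrite fs'// !mulr0.
transitivity (\int[P]_(w in A) (Sint (before X') e w + v w * Sint one_th e w)%:E)%E; last first.
  apply/esym; apply: eq_integral_L1 => //; [exact: Sint_L1|exact: L1D|].
  apply: filterS XX => w XX'.
  have [_ [m1 bm1]] := b1.
  rewrite -(SintZ v de (bm1 ^~ w)) -(SintD de) => //.
  - apply: eq_Sint => t; congr (_ * _); rewrite /before /one_th.
    case: ifP => h; last by rewrite mulr0 addr0.
    by rewrite mulr1 add0r -XX' Xv.
  - exact: b_before.
  - apply: bounded_processM => //; exact: (bounded_process_fun mvT vm).
rewrite !integralD_L1//; congr (_ + _)%E.
have hA0 := sigma_at_le hF stau sth hA.
have toA0 g := @integral_sigma_at_le A g hA.
set A0 := (A `&` _) in hA0 toA0; have mA0 := Gmth hA0.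
rewrite !toA0//.
(* v is shifted by its bound m, so as to have nonnegative factors *)
have m0 : 0 <= m by rewrite (le_trans _ (vm point)).
have key (Z : Omega -> R) : measurable_wrt (sigma_at F theta) Z -> (forall w, 0 <= Z w) ->
    (\int[P]_(w in A0) (Z w * (M w * mass f w))%:E = \int[P]_(w in A0) (Z w * Sint one_th e w)%:E)%E.
  move=> mZ Z0.
  have := tail_mass_tower (measurable_wrtM sGth (measurable_wrt_indic sGth hA0) mZ).
  have i0 w : 0 <= \1_A0 w * Z w by rewrite mulr_ge0.
  move=> /(_ i0).
  under eq_integral do rewrite -!mulrA.
  under [in RHS]eq_integral do rewrite -!mulrA.
  by rewrite !integral_indicM// !setTI.
have k1 := key (fun w => v w + m).
have k2 := key (fun=> m).
have e1 : (\int[P]_(w in A0) ((v w + m) * (M w * mass f w))%:E =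
  \int[P]_(w in A0) ((v w + m) * Sint one_th e w)%:E)%E.
  apply: k1; first by apply: (measurable_wrtD sGth) => //; exact: (measurable_wrt_cst sGth).
  by move=> w; have := vm w; rewrite ler_norml => /andP[+ _]; rewrite -subr_ge0 opprK.
have e2 : (\int[P]_(w in A0) (m * (M w * mass f w))%:E =
  \int[P]_(w in A0) (m * Sint one_th e w)%:E)%E.
  by apply: k2 => //; exact: (measurable_wrt_cst sGth).
move: e1.
under eq_integral do rewrite mulrDl.
under [in RHS]eq_integral do rewrite mulrDl.
have Lm1 : L1 P (fun w => m * (M w * mass f w)) by exact: L1Z.
have Lm2 : L1 P (fun w => m * Sint one_th e w) by exact: L1Z.
rewrite !integralD_L1// e2.
set y := (\int[P]_(w in A0) (m * _)%:E)%E => E.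
have fy : y \is a fin_num by exact: integral_fin.
by have := congr1 (fun x => (x - y)%E) E; rewrite !addeK.
Qed.

(** If the tail X2 is worth at least - eps under b, it lowers the value under the
    concatenation by at most eps: the tail is weighted by M, whose conditional
    expectation is at most 1. *)
Lemma pairing_concat_lower X X1 X2 v (m eps : R) : 0 <= eps ->
  (forall A, sigma_at F tau A -> (\int[P]_(w in A) (mass e w)%:E = P A)%E) ->
  Ron tau X -> Ron tau X1 -> Ron theta X2 ->
  measurable_wrt (sigma_at F theta) v -> (forall w, `|v w| <= m) ->
  (forall w s, natbar_le (theta w) (Some s) -> X1 s w = v w) ->
  {ae P, forall w, forall s, X s w = X1 s w + X2 s w} ->
  {ae P, forall w, - eps <= pairing theta horizon X2 b w} ->
  {ae P, forall w, pairing tau horizon X1 a w - eps <=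
    pairing tau horizon X (concat P F theta setT a b) w}.
Proof.
move=> eps0 me rX rX1 rX2 mv vm X1v XX hb.
have [X1' bX1 XX1] := Ron_version hF rX1; have [X2' bX2 XX2] := Ron_version hF rX2.
have bX := bounded_processD bX1 bX2.
have E : {ae P, forall w, forall t, X t w = X1' t w + X2' t w}.
  by apply: filterS3 XX XX1 XX2 => w h h1 h2 t; rewrite h h1 h2.
have cX := pairing_concat rX bX E.
have cX1 := pairing_concat rX1 bX1 XX1.
have L1c := Sint_L1 dc bX1; have L2c := Sint_L1 dc bX2.
have ceps : ce P (sigma_at F tau) (fun=> - eps) (fun=> - eps).
  by split => //; [exact: (measurable_wrt_cst sGtau)|exact: L1_cst].
have cX1e := ceD sGtau Gmtau L1c (L1_cst P (- eps)) cX1 ceps.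
have fr := pairing_concat_frozen rX1 mv vm X1v.
suff : {ae P, forall w, pairing tau horizon X1 (concat P F theta setT a b) w - eps <=
    pairing tau horizon X (concat P F theta setT a b) w}.
  by apply: filterS2 fr => w <-.
apply: (ce_le sGtau Gmtau cX1e cX) => A hA.
have mA := Gmtau hA.
under [leRHS]eq_integral do rewrite (SintD dc)//.
have Leps := L1_cst P (- eps).
rewrite !integralD_L1// leeD2lE ?integral_fin//.
have hA0 := sigma_at_le hF stau sth hA.
have toA0 g := @integral_sigma_at_le A g hA.
set A0 := (A `&` _) in hA0 toA0; have mA0 := Gmth hA0.
have [_ _ _ fs] := hf; have [_ [m' bm']] := bX2; have [_ _ sX2] := rX2.
have L2f := Sint_L1 df bX2.
have LMX : L1 P (fun w => M w * Sint X2' f w).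
  apply: (@le_L1 _ _ _ _ _ (fun w => m' * (M w * mass f w))); last exact: L1Z.
    by apply: measurable_funM => //; exact: L1_measurable L2f.
  move=> w; rewrite normrM (ger0_norm (M0 w)) mulrCA ler_wpM2l//.
  by apply: (Sint_bound df) => t; exact: bm'.
have -> : (\int[P]_(w in A) (Sint X2' c w)%:E = \int[P]_(w in A) (M w * Sint X2' f w)%:E)%E.
  apply: eq_integral_L1 => //.
  apply: filterS2 sX2 XX2 => w sX2' XX2'; rewrite (Sint_concat w bX2).2.
  rewrite (_ : Sint (before X2') e w = 0) ?add0r//.
  rewrite -[RHS](mul0r (mass e w)) -(Sint_cst de (fun=> 0)); apply: eq_Sint => t.
  rewrite /before; case: ifP => // h.
  by rewrite -XX2' sX2' h.
have [mM LM ME] := M_ce.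
have pos : (0 <= \int[P]_w (\1_A0 w * M w * (Sint X2' f w + eps))%:E)%E.
  apply: (integralM_ge0 sGth Gmth).
  - by apply: L1D => //; exact: L1_cst.
  - move=> D hD; have mD := Gmth hD.
    rewrite integralD_L1//; last exact: L1_cst.
    have [_ Lp pE] := pairing_Ron sth hf rX2 bX2 XX2.
    rewrite -pE// -integralD_L1//; last exact: L1_cst.
    rewrite -(integral0 P D); apply: le_integral_L1 => //; first exact: L1_cst.
      by apply: L1D => //; exact: L1_cst.
    by apply: filterS hb => w; rewrite -subr_ge0 opprK.
  - by apply: (measurable_wrtM sGth) => //; exact: (measurable_wrt_indic sGth).
  - by move=> w; rewrite mulr_ge0.
  - have := L1_indic mA0 (L1D LMX (L1Z eps LM)).
    by apply: eq_integrable => // w _ /=; congr EFin; ring.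
move: pos; under eq_integral do rewrite -mulrA.
rewrite integral_indicM// setTI.
under eq_integral do rewrite mulrDr.
have LMe : L1 P (fun w => M w * eps).
  by have := L1Z eps LM; apply: eq_integrable => // w _ /=; rewrite mulrC.
rewrite integralD_L1// -(toA0 _ LMX) => pos.
have bM : (\int[P]_(w in A0) (M w * eps)%:E <= P A * eps%:E)%E.
  rewrite (_ : \int[P]_(w in A0) (M w * eps)%:E = (\int[P]_(w in A0) (M w)%:E) * eps%:E)%E; last first.
    under eq_integral do rewrite EFinM.
    by rewrite integralZr//; exact: L1_subset.
  apply: lee_wpmul2r; first by rewrite lee_fin.
  rewrite ME// -(toA0 _ (Sint_L1 de b1)) -me//.
  apply: le_integral_L1 => //; [exact: Sint_L1|].
  apply: aeW => w; rewrite -Sint_one; apply: (le_Sint de) => //.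
  by move=> t; rewrite /one_th; case: ifP.
rewrite integral_cst// EFinN mulNe muleC.
have := le_trans pos (leeD2l _ bM).
rewrite -leeBlDr ?sub0e// fin_numM//; exact: fin_num_measure.
Qed.

End concat_b.
End two.
End Concat.

(** * The penalty function *)

Section PhiSharp.
Context {R : realType} {d : measure_display} {Omega : measurableType d}.
Variables (P : probability Omega R) (F : nat -> set (set Omega)) (T : natbar).
Variable phi : nat -> (nat -> Omega -> R) -> Omega -> R.
Hypothesis hF : is_filtration P F.
Hypothesis hphi : concave_muf_process P F T phi.

Let sF t : sigma_algebra setT (F t) := filtration_sigma hF t.
Local Notation horizon := (fun=> T).
Local Notation det := (@det_time d Omega).
Local Notation Ron := (Ron P F T).
Local Notation acc := (acceptance P F T phi).
Local Notation has_dens := (has_dens P T).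
Local Notation pairing := (pairing P F).
Local Notation phi_sharp := (phi_sharp P F T phi).
Local Notation D_on sigma := (D_on P F sigma horizon).
Implicit Types (sigma tau theta : Omega -> natbar) (X Y a b e : nat -> Omega -> R).

Lemma condexp_measurable_wrt (G : set (set Omega)) f : sigma_algebra setT G ->
  measurable_wrt G (condexp P G f).
Proof.
move=> sG; rewrite /condexp; case: xgetP => [Y -> [mY _ _]//|_].
exact: measurable_wrt_cst.
Qed.

Lemma pairing_wrt sigma h X a : stopping_time F sigma ->
  measurable_wrt (sigma_at F sigma) (pairing sigma h X a).
Proof. by move=> st; apply: condexp_measurable_wrt; exact: (sigma_at_sigma hF). Qed.

Lemma pairing_measurable sigma h X a : stopping_time F sigma ->
  measurable_fun setT (fun w => (pairing sigma h X a w)%:E).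
Proof.
move=> st; apply/measurable_EFinP.
by apply: measurable_wrt_fun (pairing_wrt h X a st); exact: sigma_at_measurable.
Qed.

Section sharp.
Variable sigma : Omega -> natbar.
Hypotheses (st : stopping_time F sigma) (sT : stopping_le P sigma horizon).
Hypothesis fin : {ae P, forall w, sigma w <> None}.

Lemma phi_sharpP a : is_essinf P
  [set (fun w => (pairing sigma horizon X a w)%:E) | X in acc sigma] (phi_sharp sigma a).
Proof.
apply: essinfP.
  by exists (fun w => (pairing sigma horizon (fun _ _ => 0) a w)%:E); exists (fun _ _ => 0) => //; exact: acc0.
by move=> _ [X _ <-]; exact: pairing_measurable.
Qed.

Lemma phi_sharp_le a X : acc sigma X ->
  {ae P, forall w, (phi_sharp sigma a w <= (pairing sigma horizon X a w)%:E)%E}.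
Proof. by move=> hX; have [_ h _] := phi_sharpP a; apply: h; exists X. Qed.

(** The penalty is the pointwise infimum of countably many values. *)
Lemma phi_sharp_seq a : exists Y : nat -> nat -> Omega -> R,
  (forall n, acc sigma (Y n)) /\
  {ae P, forall w, phi_sharp sigma a w = einfs (fun n => (pairing sigma horizon (Y n) a w)%:E) 0%N}.
Proof.
have [||f [Sf hf]] := @essinf_seq _ _ _ P
    [set (fun w => (pairing sigma horizon X a w)%:E) | X in acc sigma].
- by exists (fun w => (pairing sigma horizon (fun _ _ => 0) a w)%:E); exists (fun _ _ => 0) => //; exact: acc0.
- by move=> _ [X _ <-]; exact: pairing_measurable.
have ex n : exists Y, acc sigma Y /\ (fun w => (pairing sigma horizon Y a w)%:E) = f n.
  by have [Y aY Yf] := Sf n; exists Y.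
have [Y hY] := choice ex.
exists Y; split; first by move=> n; case: (hY n).
apply: filterS (is_essinf_unique (phi_sharpP a) hf) => w ->.
congr (einfs _ _); apply/funext => n; by have [_ <-] := hY n.
Qed.

Lemma pairing_zero rho a e : has_dens rho a e ->
  {ae P, forall w, pairing sigma horizon (fun _ _ => 0) a w = 0}.
Proof.
move=> he; have sG := sigma_at_sigma hF st.
have c := pairing_Ron hF st he (Ron_zero T hF sigma) (@bounded_process_cst R d Omega 0) (aeW P (fun _ _ => erefl)).
have c0 : ce P (sigma_at F sigma) (fun=> 0) (fun=> 0).
  by split => //; [exact: (measurable_wrt_cst sG)|exact: L1_cst].
apply: (ce_unique sG (@sigma_at_measurable _ _ F sigma) c c0) => A hA.
have [de _ _ _] := he.
by apply: eq_integral => w _; rewrite (Sint_cst de (fun=> 0)) mul0r.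
Qed.

End sharp.

Hypothesis hrep : dual_representation P F T phi.

(** The probability space is not a null set. *)
Lemma ae_false : ~ {ae P, forall w : Omega, False}.
Proof.
move=> [N [mN PN0 hN]]; have : P setT = 0%E.
  by apply/eqP; rewrite -measure_le0 -PN0; apply: le_measure; rewrite ?inE// => w _; exact: hN.
by rewrite probability_setT => /eqP; rewrite onee_eq0.
Qed.

(** The dual representation at the position 0 provides countably many dual processes
    whose penalties are at least - eps on events that cover Omega up to a null set. *)
Lemma near_optimal_densities t (eps : R) : natbar_le (Some t) T -> 0 < eps ->
  exists (b : nat -> nat -> Omega -> R) (B : nat -> set Omega),
  (forall n, [/\ D_on (det t) (b n), F t (B n) &
     forall Y, acc (det t) Y -> {ae P, forall w, B n w -> - eps <= pairing (det t) horizon Y (b n) w}]) /\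
  {ae P, forall w, exists n, B n w}.
Proof.
move=> tT eps0.
have st := det_stopping hF t; have sT := det_le P tT.
have fin : {ae P, forall w, det t w <> None} by exact: aeW.
have h0 := hrep tT (RonP_det hF tT (Ron_zero T hF (det t))).
set S := (X in essinf P X) in h0.
have Sm f : S f -> measurable_fun setT f.
  move=> [a aD <-]; apply: emeasurable_funB; first exact: pairing_measurable.
  by have [] := phi_sharpP st sT fin a.
(* an empty family would have the essential infimum +oo instead of phi_t(0) = 0 *)
have S0 : S !=set0.
  apply: contrapT => nS; apply: ae_false.
  have Se : S = set0.
    by apply/seteqP; split => // f Sf; apply: nS; exists f.
  have : is_essinf P S (essinf P S).
    apply: (@xgetPex _ (fun=> +oo%E) [set Y | is_essinf P S Y]).
    exists (fun=> +oo%E); split => //; first by move=> f; rewrite Se.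
    by move=> Z _ _; apply: aeW => w; rewrite leey.
  move=> [_ _ hZ].
  have := hZ (fun=> +oo%E) (measurable_cst _) => /(_ _)[].
    by move=> f; rewrite Se.
  move=> N [mN PN hN].
  have : {ae P, forall w, (+oo <= essinf P S w)%E} by exists N.
  by apply: filterS2 h0 => w h0' /=; rewrite -h0'.
have [f [Sf hf]] := essinf_seq P S0 Sm.
have E0 : {ae P, forall w, einfs (fun n => f n w) 0%N = 0%E}.
  apply: filterS3 (is_essinf_unique (essinfP P S0 Sm) hf) h0 (phi_zero hF hphi tT) => w <- + E.
  by move=> <- //; rewrite E.
have exb n : exists b, D_on (det t) b /\
    (fun w => (pairing (det t) horizon (fun _ _ => 0%R) b w)%:E - phi_sharp (det t) b w)%E = f n.
  by have [a aD af] := Sf n; exists a.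
have [b hb] := choice exb.
have exY n := phi_sharp_seq st sT fin (b n).
have [Y hY] := choice exY.
pose B n := \bigcap_k [set w | - eps <= pairing (det t) horizon (Y n k) (b n) w].
exists b, B; split.
  move=> n; have [bD _] := hb n; have [aY eY] := hY n; split => //.
  - rewrite -(setCK (B n)) setC_bigcap; apply: (sigma_algebra_C (sF t)).
    apply: (F_bigcup hF) => k; apply: (sigma_algebra_C (sF t)).
    rewrite -(sigma_at_detE hF t).
    apply: (measurable_wrt_ler (sigma_at_sigma hF st)); last exact: pairing_wrt.
    exact: (measurable_wrt_cst (sigma_at_sigma hF st)).
  - move=> X aX; apply: filterS2 eY (phi_sharp_le st sT fin (b n) aX) => w eY' h Bw.
    rewrite -lee_fin; apply: le_trans h; rewrite eY'; apply: le_einfs0 => k.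
    by rewrite lee_fin; exact: Bw.
have z n : {ae P, forall w, pairing (det t) horizon (fun _ _ => 0%R) (b n) w = 0}.
  have [bD _] := hb n; have [e he _] := D_has_dens hF st sT bD.
  exact: (pairing_zero st he).
have eYall : {ae P, forall w, forall n, phi_sharp (det t) (b n) w =
   einfs (fun k => (pairing (det t) horizon (Y n k) (b n) w)%:E) 0%N}.
  by apply: ae_foralln => n; case: (hY n).
apply: filterS3 E0 (ae_foralln z) eYall => w E0' z' eY'.
apply: contrapT => /forallNP nB.
suff : (eps%:E <= 0)%E by rewrite lee_fin leNgt eps0.
rewrite -E0'; apply: le_einfs0 => n; have [_ <-] := hb n.
rewrite z' sub0e eY' leeNr -EFinN.
have /existsNP[k hk] : ~ forall k, - eps <= pairing (det t) horizon (Y n k) (b n) w.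
  by move=> h; apply: (nB n) => k _; exact: h.
apply: le_trans (einfs0_le _ k) _; rewrite lee_fin ltW// ltNge; exact/negP.
Qed.

End PhiSharp.

(** * Pasting of dual processes *)

Section DisjointSum.
Context {R : realType} {d : measure_display} {Omega : measurableType d}.
Variables (A : nat -> set Omega) (tA : trivIset setT A).

(** The function equal to u k on A k, and to 0 outside of the A k. *)
Definition paste (u : nat -> Omega -> R) (w : Omega) : R :=
  limn (series (fun k => \1_(A k) w * u k w)).

Lemma paste_cvg u w : series (fun k => \1_(A k) w * u k w) @ \oo --> paste u w.
Proof.
have [[k Ak]|nA] := pselect (exists k, A k w).
  have h s : s != k -> \1_(A s) w * u s w = 0.
    move=> sk; rewrite indic_out ?mul0r// => As.
    by move: sk; rewrite (tA I I (ex_intro _ w (conj As Ak))) eqxx.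
  have := cvg_series_single h; rewrite /paste => c.
  by rewrite (cvg_lim _ c).
have h s : s != 0%N -> \1_(A s) w * u s w = 0.
  by move=> _; rewrite indic_out ?mul0r// => As; apply: nA; exists s.
have := cvg_series_single h; rewrite /paste => c.
by rewrite (cvg_lim _ c).
Qed.

Lemma paste_in u k w : A k w -> paste u w = u k w.
Proof.
move=> Ak; rewrite /paste (@lim_series_single _ _ k) ?(indic_in R Ak) ?mul1r// => s sk.
rewrite indic_out ?mul0r// => As.
by move: sk; rewrite (tA I I (ex_intro _ w (conj As Ak))) eqxx.
Qed.

Lemma paste_out u w : (forall k, ~ A k w) -> paste u w = 0.
Proof.
move=> nA; rewrite /paste (@lim_series_single _ _ 0%N); first by rewrite (indic_out R (nA _)) mul0r.
by move=> s _; rewrite (indic_out R (nA _)) mul0r.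
Qed.

Lemma paste_measurable u : (forall k, measurable (A k)) ->
  (forall k, measurable_fun setT (u k)) -> measurable_fun setT (paste u).
Proof.
move=> mA mu; apply: (@measurable_fun_cvg _ _ _ _ (fun n w => series (fun k => \1_(A k) w * u k w) n)).
  move=> n; apply: measurable_sum => k; apply: measurable_funM => //.
by move=> w _; exact: paste_cvg.
Qed.

Lemma paste_wrt (G : set (set Omega)) u : sigma_algebra setT G ->
  (forall k, measurable_wrt G (fun w => \1_(A k) w * u k w)) -> measurable_wrt G (paste u).
Proof.
move=> sG mu; apply/(measurable_wrtP _ sG).
apply: (@measurable_fun_cvg _ (g_sigma_algebraType G) R setT (fun n w => series (fun k => \1_(A k) w * u k w) n)).
  by move=> n; apply: measurable_sum => k; apply/(measurable_wrtP _ sG).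
by move=> w _; exact: paste_cvg.
Qed.
End DisjointSum.

Section Pasting.
Context {R : realType} {d : measure_display} {Omega : measurableType d}.
Variables (P : probability Omega R) (F : nat -> set (set Omega)) (T : natbar).
Variable phi : nat -> (nat -> Omega -> R) -> Omega -> R.
Hypothesis hF : is_filtration P F.
Hypothesis hphi : concave_muf_process P F T phi.

Let sF t : sigma_algebra setT (F t) := filtration_sigma hF t.
Local Notation horizon := (fun=> T).
Local Notation det := (@det_time d Omega).
Local Notation Ron := (Ron P F T).
Local Notation acc := (acceptance P F T phi).
Local Notation has_dens := (has_dens P T).
Local Notation pairing := (pairing P F).
Local Notation D_on sigma := (D_on P F sigma horizon).
Implicit Types (sigma tau theta : Omega -> natbar) (X Y a b e : nat -> Omega -> R).

Lemma L0_incr X t : adapted P F X -> L0 P (F t) (incr X t).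
Proof.
move=> aX; apply: (@L0_ae _ _ _ _ _ (fun w => X t w + -1 * Defs.prev X t w)).
  by apply: aeW => w; rewrite mulN1r.
apply: (L0D (sF t)) => //; apply: (L0M (sF t)); first exact: (L0_cst _ (sF t)).
case: t => [|t]; first exact: (L0_cst _ (sF _)).
by apply: L0_sub (aX t) => A; exact: (F_mono hF (leqnSn t)).
Qed.

Variable theta : Omega -> natbar.
Hypotheses (sth : stopping_time F theta) (thT : stopping_le P theta horizon).
Hypothesis fth : {ae P, forall w, theta w <> None}.

Section paste.
Variables (A : nat -> set Omega) (t : nat -> nat) (b : nat -> nat -> Omega -> R) (eps : R).
Hypothesis tA : trivIset setT A.
Hypothesis cA : {ae P, forall w, exists k, A k w}.
Hypothesis tT : forall k, natbar_le (Some (t k)) T.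
Hypothesis FA : forall k, F (t k) (A k).
Hypothesis At : forall k, A k `<=` [set w | theta w = Some (t k)].
Hypothesis Db : forall k, D_on (det (t k)) (b k).
Hypothesis lb : forall k Y, acc (det (t k)) Y ->
  {ae P, forall w, A k w -> - eps <= pairing (det (t k)) horizon Y (b k) w}.

Let st k := det_stopping hF (t k).
Let sT k := det_le P (tT k).
Let mA k : measurable (A k). Proof. exact: (F_measurable hF (@FA k)). Qed.
Let sGth := sigma_at_sigma hF sth.
Let Gmth := @sigma_at_measurable d Omega F theta.

Let FDA k D : sigma_at F theta D -> F (t k) (D `&` A k).
Proof.
move=> hD; have := sigma_at_eq hF sth (t k) hD => h.
rewrite (_ : D `&` A k = (D `&` [set w | theta w = Some (t k)]) `&` A k).
  exact: (sigma_algebra_I (sF _)).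
by apply/seteqP; split => w /= [Dw Aw]; split => //; [split => //; exact: At|case: Dw].
Qed.

(** Dual processes b k that start at t k, given on disjoint events A k of F (t k)
    contained in [theta = t k] and covering Omega, are pasted to a dual process that
    starts at theta. A common lower bound - eps for the values of acceptable
    positions is preserved. *)
Lemma paste_densities : exists2 b', D_on theta b' &
  forall Y, acc theta Y -> {ae P, forall w, - eps <= pairing theta horizon Y b' w}.
Proof.
have exf k : exists e, has_dens (det (t k)) (b k) e /\
    forall A, F (t k) A -> (\int[P]_(w in A) (mass e w)%:E = P A)%E.
  have [e he hm] := D_has_dens hF (st k) (sT k) (Db k).
  by exists e; split => // B FB; apply: hm; exact: (sigma_at_det hF FB).
have [f hf] := choice exf.
have df k : dens P (f k) by case: (hf k) => -[].
pose g s := paste A (fun k => f k s).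
have gin k s w : A k w -> g s w = f k s w by move=> Ak; exact: (paste_in tA).
have gout s w : (forall k, ~ A k w) -> g s w = 0 by move=> h; rewrite /g paste_out.
have mg s : measurable_fun setT (g s).
  by apply: (paste_measurable tA) => // k; case: (df k).
have g0 s w : 0 <= g s w.
  have [[k Ak]|nA] := pselect (exists k, A k w).
    by rewrite (gin k)//; case: (df k).
  by rewrite gout// => k Ak; apply: nA; exists k.
have gcvg w : cvgn (series (fun s => g s w)).
  have [[k Ak]|nA] := pselect (exists k, A k w).
    rewrite (_ : (fun s => _) = (fun s => f k s w)); first by case: (df k).
    by apply/funext => s; rewrite (gin k).
  rewrite (_ : (fun s => _) = (fun _ => 0)).
    by apply/cvg_ex; exists 0; rewrite /series; under eq_fun do rewrite big1//; exact: cvg_cst.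
  by apply/funext => s; rewrite gout// => k Ak; apply: nA; exists k.
have Sin k X w : A k w -> Sint X g w = Sint X (f k) w.
  by move=> Ak; apply: eq_Sint => s; rewrite (gin k).
have massin k w : A k w -> mass g w = mass (f k) w.
  by move=> Ak; rewrite -!Sint_one; exact: Sin.
have mmass : measurable_fun setT (mass g).
  apply: (@measurable_fun_cvg _ _ _ _ (fun n w => series (fun s => g s w) n)).
    by move=> n; apply: measurable_sum.
  by move=> w _; exact: gcvg.
have mass0 w : 0 <= mass g w.
  by apply: limr_ge; [exact: gcvg|apply: nearW => n; rewrite /series/=; exact: sumr_ge0].
have tDA D : trivIset setT (fun k => D `&` A k).
  move=> i j _ _ [w [[_ h1] [_ h2]]]; exact: (tA I I (ex_intro _ w (conj h1 h2))).
have mDA D : sigma_at F theta D -> forall k, measurable (D `&` A k).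
  by move=> hD k; apply: (F_measurable hF (FDA k hD)).
have massU D : sigma_at F theta D ->
    (\int[P]_(w in \bigcup_k (D `&` A k)) (mass g w)%:E = P (\bigcup_k (D `&` A k)))%E.
  move=> hD; rewrite ge0_integral_bigcup//; first last.
  - by move=> w _; rewrite lee_fin.
  - by apply/measurable_EFinP; exact: measurable_funTS.
  - exact: mDA.
  rewrite measure_bigcup//; last by move=> k _; exact: mDA.
  rewrite [RHS](@eq_eseriesl _ _ xpredT); last by move=> k; rewrite in_setT.
  apply: eq_eseriesr => k _; have [_ h] := hf k; apply: (etrans _ (h _ (FDA k hD))).
  apply: eq_integral => w; rewrite inE => -[_ Ak]; by rewrite (massin k).
have Lmass : L1 P (mass g).
  apply/integrableP; split; first exact/measurable_EFinP.
  under eq_integral do rewrite /= ger0_norm//.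
  have -> : (\int[P]_w (mass g w)%:E = \int[P]_(w in \bigcup_k (setT `&` A k)) (mass g w)%:E)%E.
    rewrite [RHS]integral_mkcond; apply: eq_integral => w _; rewrite patchE.
    case: ifPn => // nU; congr EFin.
    rewrite /mass (_ : (fun s => _) = (fun _ => 0)).
      by apply: cvg_lim => //; rewrite /series; under eq_fun do rewrite big1//; exact: cvg_cst.
    apply/funext => s; apply: gout => k Ak; move/negP: nU; apply; rewrite inE.
    by exists k.
  rewrite massU; last exact: (sigma_algebra_T sGth).
  apply: le_lt_trans (probability_le1 _ _) (ltry _).
  by apply: bigcupT_measurable => k; apply: mDA; exact: (sigma_algebra_T sGth).
have dg : dens P g by split.
pose b' s w := \sum_(0 <= u < s.+1) g u w.
have b'incr s w : incr b' s w = g s w.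
  rewrite /incr /b'; case: s => [|s] /=; first by rewrite big_nat1 subr0.
  by rewrite big_nat_recr//= addrAC subrr add0r.
have g_before : {ae P, forall w, forall s, ~~ natbar_le (theta w) (Some s) -> g s w = 0}.
  have h : {ae P, forall w, forall k s, ~~ natbar_le (Some (t k)) (Some s) -> f k s w = 0}.
    by apply: ae_foralln => k; have [[_ _ _]] := hf k.
  apply: filterS2 h cA => w h [k Ak] s; rewrite (At Ak) => ts.
  by rewrite (gin k)// h.
have g_after : {ae P, forall w, forall s, ~~ natbar_le (Some s) T -> g s w = 0}.
  have h : {ae P, forall w, forall k s, ~~ natbar_le (Some s) T -> f k s w = 0}.
    by apply: ae_foralln => k; have [[_ _ +]] := hf k.
  by apply: filterS2 h cA => w h [k Ak] s ts; rewrite (gin k)// h.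
(* if t k <= s, then A k belongs to F s; otherwise f k s = 0 almost surely *)
have Lg s : L0 P (F s) (g s).
  have Lf k : L0 P (F s) (f k s).
    have [[_ ie _ _] _] := hf k; have [[c [[ac _] _] bc] _] := Db k.
    apply: (@L0_ae _ _ _ _ _ (incr (Defs.proj (det (t k)) horizon c) s)); last first.
      by apply: L0_incr; exact: (adapted_proj T hF).
    apply: filterS2 ie bc => w <- bc'; rewrite /incr bc'; congr (_ - _).
    by case: (s) => [|u] //=.
  have exv k : exists v, measurable_wrt (F s) v /\ {ae P, forall w, f k s w = v w}.
    by have [v mv fv] := L0_ex (Lf k); exists v.
  have [v hv] := choice exv.
  pose u k w := if (t k <= s)%N then v k w else 0.
  apply: (@L0_ae _ _ _ _ _ (paste A u)); last first.
    apply: L0_wrt; apply: (paste_wrt tA (sF s)) => k.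
    rewrite /u; case: (leqP (t k) s) => ts.
      apply: (measurable_wrtM (sF s)); last by case: (hv k).
      by apply: (measurable_wrt_indic (sF s)); exact: (F_mono hF ts).
    by under eq_fun do rewrite mulr0; exact: (measurable_wrt_cst (sF s)).
  have h : {ae P, forall w, forall k, f k s w = u k w}.
    apply: ae_foralln => k; have [[_ _ _ fs] _] := hf k; have [_ fv] := hv k.
    apply: filterS2 fs fv => w fs' fv'; rewrite /u.
    case: (leqP (t k) s) => ts; first exact: fv'.
    by apply: fs'; rewrite /det_time /= -ltnNge.
  by apply: filterS h => w h; rewrite /g /paste; congr (limn (series _)); apply/funext => k; rewrite h.
have hg : has_dens theta b' g.
  by split => //; apply: aeW => w s.
have A1b : A1_plus P F b'.
  split; last by apply: aeW => w s; rewrite b'incr.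
  split.
    move=> s; rewrite /b'; under eq_fun do rewrite big_mkord.
    apply: (L0_sum (sF s)) => u; apply: L0_sub (Lg u) => B.
    by apply: (F_mono hF); have := ltn_ord u.
  rewrite /A1_norm.
  under eq_integral => w _.
    rewrite (_ : (\sum_(0 <= s <oo) `|incr b' s w|%:E)%E = (mass g w)%:E).
      over.
    rewrite (@eq_eseriesr _ _ (fun s => (g s w)%:E)); last first.
      by move=> s _; rewrite b'incr ger0_norm.
    apply: cvg_lim => //; under eq_fun do rewrite sumEFin.
    by apply: cvg_EFin; [exact: nearW|exact: gcvg].
  by apply: integrable_lty.
have b'proj : proc_eq P b' (Defs.proj theta horizon b').
  apply: filterS3 g_before g_after thT => w gb ga tT' s; rewrite /Defs.proj.
  case: ifP => [h|/negbT h]; last first.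
    rewrite /b' big_nat big1// => u /andP[_ us]; apply: gb.
    by apply: contra h => h; apply: (natbar_le_trans h) => /=; lia.
  case: (boolP (natbar_le (Some s) T)) => sT'.
    by rewrite (_ : natbar_min s T = s)//; move: sT'; case: (T) => [k|] //=; lia.
  have [k Tk ks] : exists2 k, T = Some k & (k < s)%N.
    by move: sT'; case: (T) => [k|] //=; rewrite -ltnNge => ks; exists k.
  rewrite Tk /= (minn_idPr (ltnW ks)) /b' (@big_cat_nat _ _ _ k.+1)//=; last by lia.
  rewrite [X in _ + X]big_nat [X in _ + X]big1 ?addr0// => u /andP[ku _].
  by apply: ga; rewrite Tk /= -ltnNge.
have pmass D : sigma_at F theta D -> (\int[P]_(w in D) (mass g w)%:E = P D)%E.
  move=> hD; have mD := Gmth hD.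
  have mU : measurable (\bigcup_k (D `&` A k)) by apply: bigcupT_measurable; exact: mDA.
  have DU : {ae P, forall w, D w <-> (\bigcup_k (D `&` A k)) w}.
    apply: filterS cA => w [k Ak]; split; first by move=> Dw; exists k.
    by move=> [j _ []].
  rewrite (integral_eq_mod_null mD mU Lmass DU) massU//.
  have := integral_eq_mod_null mD mU (L1_cst P 1) DU.
  by rewrite !integral_cst// !mul1e => ->.
have b1 := @bounded_process_cst R d Omega 1.
exists b'.
  split; first by exists b'.
  have c : ce P (sigma_at F theta) (Sint (fun _ _ => 1) g) (pairing theta horizon one_process b').
    apply: (pairing_ce hF) => //.
    apply: filterS2 g_before g_after => w gb ga s; rewrite /one_process mul1r b'incr mul1r.
    case: (boolP (natbar_le (theta w) (Some s))) => h1; last by rewrite andFb gb.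
    by rewrite andTb; case: ifP => // /negbT h2; rewrite ga.
  have c1 : ce P (sigma_at F theta) (fun=> 1) (fun=> 1).
    by split => //; [exact: (measurable_wrt_cst sGth)|exact: L1_cst].
  have h : {ae P, forall w, pairing theta horizon one_process b' w = 1}.
    apply: (ce_unique sGth Gmth c c1) => D hD.
    under eq_integral do rewrite Sint_one.
    by rewrite pmass// integral_cst ?mul1e//; exact: Gmth.
  by apply: filterS h => w h _.
move=> Y aY; have [rY _] := (accP phi hF Y sth thT).1 aY.
have [Y' bY YY] := Ron_version hF rY.
have cY := pairing_Ron hF sth hg rY bY YY.
have ceps : ce P (sigma_at F theta) (fun=> - eps) (fun=> - eps).
  by split => //; [exact: (measurable_wrt_cst sGth)|exact: L1_cst].
have LY := Sint_L1 dg bY.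
pose h w := Sint Y' g w + eps.
have Lh : L1 P h by apply: L1D => //; exact: L1_cst.
apply: (ce_le sGth Gmth ceps cY) => D hD.
have mD := Gmth hD.
have mU : measurable (\bigcup_k (D `&` A k)) by apply: bigcupT_measurable; exact: mDA.
have DU : {ae P, forall w, D w <-> (\bigcup_k (D `&` A k)) w}.
  apply: filterS cA => w [k Ak]; split; first by move=> Dw; exists k.
  by move=> [j _ []].
have -> : (\int[P]_(w in D) (Sint Y' g w)%:E =
    \int[P]_(w in D) (h w)%:E + \int[P]_(w in D) (- eps)%:E)%E.
  rewrite -integralD_L1//; last exact: L1_cst.
  by apply: eq_integral => w _; rewrite /h addrK.
rewrite -[leLHS]add0e; apply: leeD => //.
rewrite (integral_eq_mod_null mD mU Lh DU) integral_bigcup//; first last.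
- by apply: L1_subset.
- exact: mDA.
apply: nneseries_ge0 => k _ _.
have aAY := acc_indic hF hphi sth thT fth (tT k) (@FA k) (@At k) aY.
have [rAY _] := (accP phi hF _ (@st k) (@sT k)).1 aAY.
have bAY := bounded_processM (@bounded_process_indic R _ _ _ (mA k)) bY.
have AYY : {ae P, forall w, forall s, \1_(A k) w * Y s w = \1_(A k) w * Y' s w}.
  by apply: filterS YY => w YY' s; rewrite YY'.
have [hk _] := hf k.
have [_ Lp pE] := pairing_Ron hF (@st k) hk rAY bAY AYY.
have mDk := mDA D hD k.
have FDk := sigma_at_det hF (FDA k hD).
have -> : (\int[P]_(w in D `&` A k) (h w)%:E = \int[P]_(w in D `&` A k)
    (pairing (det (t k)) horizon (fun s w => \1_(A k) w * Y s w) (b k) w + eps)%:E)%E.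
  rewrite integralD_L1//; last exact: L1_cst.
  rewrite pE// -integralD_L1//; last 2 first.
  - exact: Sint_L1.
  - exact: L1_cst.
  apply: eq_integral => w; rewrite inE => -[_ Ak]; rewrite /h (Sin k)//.
  by congr (EFin (_ + _)); apply: eq_Sint => s; rewrite (indic_in R Ak) mul1r.
have Lpe := L1D Lp (L1_cst P eps).
apply: integral_ge0_ae => //.
apply: filterS (lb aAY) => w hw [_ Ak].
by have := hw Ak; rewrite -subr_ge0 opprK.
Qed.
End paste.
End Pasting.

Section NearOptimal.
Context {R : realType} {d : measure_display} {Omega : measurableType d}.
Variables (P : probability Omega R) (F : nat -> set (set Omega)) (T : natbar).
Variable phi : nat -> (nat -> Omega -> R) -> Omega -> R.
Hypothesis hF : is_filtration P F.
Hypothesis hphi : concave_muf_process P F T phi.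
Hypothesis hrep : dual_representation P F T phi.

Let sF t : sigma_algebra setT (F t) := filtration_sigma hF t.
Local Notation horizon := (fun=> T).
Local Notation det := (@det_time d Omega).
Local Notation acc := (acceptance P F T phi).
Local Notation pairing := (pairing P F).
Local Notation D_on sigma := (D_on P F sigma horizon).

(** Some element of D_(theta,T) values every acceptable position at no less than
    - eps, that is, has a penalty of at least - eps. *)
Lemma near_optimal_density theta (eps : R) :
  stopping_time F theta -> stopping_le P theta horizon ->
  {ae P, forall w, theta w <> None} -> 0 < eps ->
  exists2 b, D_on theta b &
    forall Y, acc theta Y -> {ae P, forall w, - eps <= pairing theta horizon Y b w}.
Proof.
move=> sth thT fth eps0.
have ex t : exists bB : (nat -> nat -> Omega -> R) * (nat -> set Omega),
    natbar_le (Some t) T ->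
    (forall n, [/\ D_on (det t) (bB.1 n), F t (bB.2 n) &
     forall Y, acc (det t) Y -> {ae P, forall w, bB.2 n w -> - eps <= pairing (det t) horizon Y (bB.1 n) w}]) /\
    {ae P, forall w, exists n, bB.2 n w}.
  case: (boolP (natbar_le (Some t) T)) => tT; last first.
    by exists (fun _ _ _ => 0, fun=> set0).
  have [b [B h]] := near_optimal_densities hF hphi hrep tT eps0.
  by exists (b, B).
have [bB hb] := choice ex.
have T0 : natbar_le (Some 0%N) T by case: (T).
(* the events of index t are made disjoint; the pairs (t, n) are enumerated, and
   codes of no pair receive the empty event *)
pose C t n := (bB t).2 n `\` \bigcup_m (if (m < n)%N then (bB t).2 m else set0).
pose q (k : nat) : nat * nat := if @pickle_inv (nat * nat)%type k is Some p then
  if natbar_le (Some p.1) T then p else (0%N, 0%N) else (0%N, 0%N).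
pose A (k : nat) : set Omega := if @pickle_inv (nat * nat)%type k is Some p then
  if natbar_le (Some p.1) T then [set w | theta w = Some p.1] `&` C p.1 p.2 else set0 else set0.
have AE k w : A k w -> [/\ @pickle_inv (nat * nat)%type k = Some (q k),
    natbar_le (Some (q k).1) T, theta w = Some (q k).1 & C (q k).1 (q k).2 w].
  rewrite /A /q; case: (pickle_inv _) => // p; case: ifP => // pT [/= h1 h2].
  by split.
have qT k : natbar_le (Some (q k).1) T.
  by rewrite /q; case: (pickle_inv _) => // p; case: ifP.
have FC t n : natbar_le (Some t) T -> F t (C t n).
  move=> tT; have [h _] := hb t tT; apply: (sigma_algebra_D (sF t)); first by case: (h n).
  apply: (F_bigcup hF) => m; case: ifP => _; last exact: (F_set0 hF).
  by case: (h m).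
have Cdisj t n n' w : C t n w -> C t n' w -> (n < n')%N -> False.
  by move=> [Bn _] [_ h] nn; apply: h; exists n => //; rewrite nn.
apply: (@paste_densities _ _ _ P F T phi hF hphi theta sth thT fth A (fun k => (q k).1)
   (fun k => (bB (q k).1).1 (q k).2) eps).
- move=> k k' _ _ [w [/AE[e1 _ e2 e3] /AE[e1' _ e2' e3']]].
  have tt : (q k).1 = (q k').1 by have := e2; rewrite e2' => -[].
  have nn : (q k).2 = (q k').2.
    rewrite tt in e3; case: (ltngtP (q k).2 (q k').2) => // h.
      by case: (Cdisj _ _ _ _ e3 e3' h).
    by case: (Cdisj _ _ _ _ e3' e3 h).
  have qq : q k = q k' by rewrite (surjective_pairing (q k)) tt nn -surjective_pairing.
  have := @pickle_invK (nat * nat)%type k; rewrite e1 /= => <-.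
  by have := @pickle_invK (nat * nat)%type k'; rewrite e1' /= qq.
- have h : {ae P, forall w, forall t, natbar_le (Some t) T -> exists n, (bB t).2 n w}.
    apply: ae_foralln => t; case: (boolP (natbar_le (Some t) T)) => tT; last exact: aeW.
    by have [_ h] := hb t tT; apply: filterS h.
  apply: filterS3 h fth thT => w h; case E : (theta w) => [t|] // _ tT.
  have [n0 hn0] := h t tT.
  have ex0 : exists n, `[< (bB t).2 n w >] by exists n0; exact/asboolP.
  pose n := ex_minn ex0.
  exists (pickle (t, n)); rewrite /A pickleK_inv (tT : natbar_le (Some (t, n).1) T); split => //.
  rewrite /n; case: ex_minnP => m /asboolP hm mmin; split => //.
  move=> [j _]; case: ifP => // jm hj.
  have hj' : `[< (bB t).2 j w >] by exact/asboolP.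
  by have := mmin j hj'; rewrite leqNgt jm.
- exact: qT.
- move=> k; rewrite /A; have := qT k; rewrite /q.
  case: (pickle_inv _) => [p|_]; last exact: (F_set0 hF).
  case: ifP => [pT _|_ _]; last exact: (F_set0 hF).
  by apply: (sigma_algebra_I (sF _)); [exact: (stopping_eq hF sth)|exact: FC].
- by move=> k w /AE[].
- by move=> k; have [h _] := hb _ (qT k); case: (h (q k).2).
- move=> k Y aY; have [h _] := hb _ (qT k); have [_ _ /(_ Y aY)] := h (q k).2.
  by apply: filterS => w hw /AE[_ _ _ [Bw _]]; exact: hw.
Qed.

End NearOptimal.

(** * Conditional expectations of penalties *)

Section CondexpLimits.
Context {R : realType} {d : measure_display} {Omega : measurableType d}.
Variables (P : probability Omega R) (F : nat -> set (set Omega)) (T : natbar).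
Variable phi : nat -> (nat -> Omega -> R) -> Omega -> R.
Hypothesis hF : is_filtration P F.
Hypothesis hphi : concave_muf_process P F T phi.

Local Notation horizon := (fun=> T).
Local Notation Ron := (Ron P F T).
Local Notation acc := (acceptance P F T phi).
Local Notation has_dens := (has_dens P T).
Local Notation pairing := (pairing P F).
Local Notation phi_sharp := (phi_sharp P F T phi).
Local Notation D_on sigma := (D_on P F sigma horizon).
Implicit Types (sigma tau theta : Omega -> natbar) (X Y a b e : nat -> Omega -> R).

(** An approximate form of dominated convergence, over one event. *)
Lemma dominated_integral (u : nat -> Omega -> R) (v g : Omega -> R) A (eps : R) :
  measurable A -> (forall n, L1 P (u n)) -> L1 P v -> L1 P g ->
  {ae P, forall w, u ^~ w @ \oo --> v w} ->
  {ae P, forall w, forall n, `|u n w| <= g w} -> 0 < eps ->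
  exists n, (\int[P]_(w in A) (u n w)%:E <= \int[P]_(w in A) (v w)%:E + eps%:E)%E.
Proof.
move=> mA Lu Lv Lg uv ug eps0.
have mR (h : Omega -> R) : L1 P h -> measurable_fun A (fun w => (h w)%:E).
  by move=> Lh; apply/measurable_EFinP; apply: measurable_funTS; exact: L1_measurable Lh.
have [_ _ c] : [/\ P.-integrable A (fun w => (v w)%:E),
   [sequence \int[P]_(w in A) `|(u n w)%:E - (v w)%:E|]_n @ \oo --> 0 &
   [sequence \int[P]_(w in A) (u n w)%:E]_n @ \oo --> (\int[P]_(w in A) (v w)%:E)]%E.
  apply: (@dominated_convergence _ _ _ P A mA (fun n w => (u n w)%:E) (fun w => (v w)%:E) (fun w => (g w)%:E)).
  - by move=> n; exact: mR.
  - exact: mR.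
  - by apply: filterS uv => w h _; apply: cvg_EFin => //; exact: nearW.
  - exact: L1_subset.
  - by apply: filterS ug => w h n _; rewrite lee_fin.
have fv := integral_fin mA Lv.
apply: contrapT => /forallNP h.
have : (\int[P]_(w in A) (v w)%:E + eps%:E <= \int[P]_(w in A) (v w)%:E)%E.
  have E := cvg_lim (@ereal_hausdorff R) c.
  rewrite -[leRHS]E; apply: lime_ge; first exact: cvgP c.
  by apply: nearW => n; rewrite ltW// ltNge; apply/negP; exact: h.
by rewrite -[leRHS]adde0 leeD2lE// lee_fin leNgt eps0.
Qed.

Lemma L1_condexp sigma f : stopping_time F sigma -> L1 P f ->
  ce P (sigma_at F sigma) f (condexp P (sigma_at F sigma) f).
Proof.
move=> st Lf; apply: condexp_ce => //; [exact: (sigma_at_sigma hF)|exact: sigma_at_measurable|].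
exact: aeW.
Qed.

Lemma pairing_paste sigma theta a e Y Z A : stopping_time F theta -> has_dens sigma a e ->
  Ron theta Y -> Ron theta Z -> sigma_at F theta A ->
  {ae P, forall w, pairing theta horizon (fun s w => \1_A w * Y s w + \1_(~` A) w * Z s w) a w =
    \1_A w * pairing theta horizon Y a w + \1_(~` A) w * pairing theta horizon Z a w}.
Proof.
move=> st he rY rZ hA; have sG := sigma_at_sigma hF st.
have Gm := @sigma_at_measurable _ _ F theta.
have hA' := sigma_algebra_C sG hA.
have [Y' bY YY] := Ron_version hF rY; have [Z' bZ ZZ] := Ron_version hF rZ.
have cY := pairing_Ron hF st he rY bY YY; have cZ := pairing_Ron hF st he rZ bZ ZZ.
have [de _ _ _] := he.
have bA B (hB : sigma_at F theta B) := @bounded_process_indic R _ _ _ (Gm _ hB).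
have bAY := bounded_processM (bA _ hA) bY; have bAZ := bounded_processM (bA _ hA') bZ.
have rW := RonD hF (Ron_local hF st hA rY) (Ron_local hF st hA' rZ).
have c := pairing_Ron hF st he rW (bounded_processD bAY bAZ) _.
have {}c := c (ltac:(by apply: filterS2 YY ZZ => w h1 h2 t; rewrite h1 h2)).
have LY := Sint_L1 de bY; have LZ := Sint_L1 de bZ.
have := ce_unique sG Gm c (ceD sG Gm (L1_indic (Gm _ hA) LY) (L1_indic (Gm _ hA') LZ)
  (ce_indic sG Gm hA cY) (ce_indic sG Gm hA' cZ)).
apply=> D hD; apply: eq_integral => w _; congr EFin.
have [_ [m bm]] := bY; have [_ [n bn]] := bZ.
by rewrite (SintD de)// (SintZ (\1_A) de (bm ^~ w)) (SintZ (\1_(~` A)) de (bn ^~ w)).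
Qed.

Section approximation.
Variable theta : Omega -> natbar.
Hypotheses (sth : stopping_time F theta) (fth : {ae P, forall w, theta w <> None}).
Hypothesis thT : stopping_le P theta horizon.
Variable a : nat -> Omega -> R.

(** Acceptable positions Y j whose values are bounded above by that of an acceptable
    position Z and become smaller than any x above the penalty. The Y j are obtained
    by pasting, with the smallest of the first j values of a minimizing sequence. *)
Lemma phi_sharp_approx sigma e : has_dens sigma a e ->
  exists (Z : nat -> Omega -> R) (Y : nat -> nat -> Omega -> R),
  [/\ acc theta Z, forall j, acc theta (Y j),
      {ae P, forall w, forall j, pairing theta horizon (Y j) a w <= pairing theta horizon Z a w} &
      {ae P, forall w, forall x, (phi_sharp theta a w < x)%E ->
        exists j0, forall j, (j0 <= j)%N -> ((pairing theta horizon (Y j) a w)%:E < x)%E}].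
Proof.
move=> he; have [Y0 [aY0 hY0]] := phi_sharp_seq hF hphi sth thT fth a.
have ex j : exists Y, acc theta Y /\ {ae P, forall w, forall i, (i <= j)%N ->
    pairing theta horizon Y a w <= pairing theta horizon (Y0 i) a w}.
  elim: j => [|j [Y [aY hY]]].
    by exists (Y0 0%N); split => //; apply: aeW => w i; rewrite leqn0 => /eqP ->.
  pose A := [set w | pairing theta horizon Y a w <= pairing theta horizon (Y0 j.+1) a w].
  have hA : sigma_at F theta A.
    by apply: (measurable_wrt_ler (sigma_at_sigma hF sth)); exact: (pairing_wrt hF).
  exists (fun s w => \1_A w * Y s w + \1_(~` A) w * Y0 j.+1 s w); split.
    exact: (acc_paste hF hphi sth thT fth hA aY (aY0 j.+1)).
  have [rY _] := (accP phi hF _ sth thT).1 aY.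
  have [rY0 _] := (accP phi hF _ sth thT).1 (aY0 j.+1).
  apply: filterS2 hY (pairing_paste sth he rY rY0 hA) => w hY' -> i ij.
  have [Aw|nA] := pselect (A w).
    rewrite (indic_in R Aw) indic_out// mul1r mul0r addr0.
    move: ij; rewrite leq_eqVlt => /orP[/eqP ->|ij]; first exact: Aw.
    exact: hY'.
  rewrite (indic_out R nA) indic_in// mul1r mul0r add0r.
  move: ij; rewrite leq_eqVlt => /orP[/eqP -> //|ij].
  apply: le_trans (hY' i ij); apply/ltW; rewrite ltNge; exact/negP.
have [Y hY] := choice ex.
have h : {ae P, forall w, forall j i, (i <= j)%N ->
  pairing theta horizon (Y j) a w <= pairing theta horizon (Y0 i) a w}.
  by apply: ae_foralln => j; case: (hY j).
exists (Y0 0%N), Y; split => //; first by move=> j; case: (hY j).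
  by apply: filterS h => w h j; exact: h.
apply: filterS2 hY0 h => w -> h' x hx.
have [i hi] : exists i, ((pairing theta horizon (Y0 i) a w)%:E < x)%E.
  apply: contrapT => /forallNP nx; move: hx; rewrite ltNge => /negP; apply.
  by apply: le_einfs0 => n; rewrite leNgt; apply/negP.
by exists i => j ij; apply: le_lt_trans hi; rewrite lee_fin h'.
Qed.

End approximation.

Section npos.
Variable tau : Omega -> natbar.
Hypothesis stau : stopping_time F tau.
Let sG := sigma_at_sigma hF stau.
Let Gm := @sigma_at_measurable d Omega F tau.
Local Notation cexp := (condexp P (sigma_at F tau)).
Local Notation ceG := (ce P (sigma_at F tau)).

(** A common lower bound of conditional expectations passes to a dominated limit. *)
Lemma le_condexp_lim (Z : Omega -> \bar R) (u U : nat -> Omega -> R) (v V g : Omega -> R) :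
  (forall n, L1 P (u n)) -> (forall n, ceG (u n) (U n)) -> L1 P v -> ceG v V -> L1 P g ->
  {ae P, forall w, u ^~ w @ \oo --> v w} ->
  {ae P, forall w, forall n, `|u n w| <= g w} ->
  (forall n, {ae P, forall w, (Z w <= (U n w)%:E)%E}) ->
  {ae P, forall w, (Z w <= (V w)%:E)%E}.
Proof.
move=> Lu cU Lv [mV LV VE] Lg uv ug ZU.
apply: (ae_le_of_integrals sG Gm (Yn := U)) => //.
  by move=> n; case: (cU n).
move=> A eps hA eps0; rewrite VE//.
have [n h] := dominated_integral (Gm hA) Lu Lv Lg uv ug eps0.
by exists n; have [_ _ ->] := cU n.
Qed.

Variable f : Omega -> \bar R.
Hypotheses (mf : measurable_fun setT f) (f0 : {ae P, forall w, (f w <= 0)%E}).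

(* fn n is the truncation in the definition of condexp_npos; gn n is a version
   that is bounded everywhere, including where f > 0 *)
Let fn (n : nat) (w : Omega) : R := fine (Order.max (f w) (- n%:R)%:E).
Let gn (n : nat) (w : Omega) : R := Num.max (Num.min (fn n w) 0) (- n%:R).

Let fnE n w : (f w <= 0)%E -> (fn n w)%:E = Order.max (f w) (- n%:R)%:E.
Proof.
move=> f0'; rewrite /fn fineK// fin_numE; apply/andP; split.
  by rewrite gt_eqF// lt_max (ltNyr (- n%:R)) orbT.
by rewrite lt_eqF// gt_max (le_lt_trans f0' (ltry 0)) ltry.
Qed.

Let fgn n w : (f w <= 0)%E -> gn n w = fn n w.
Proof.
move=> f0'; rewrite /gn (min_idPl _) ?(max_idPl _)// -lee_fin fnE//.
  by rewrite le_max lexx orbT.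
by rewrite ge_max f0' lee_fin oppr_le0 ler0n.
Qed.

Let gnE n w : (f w <= 0)%E -> (gn n w)%:E = Order.max (f w) (- n%:R)%:E.
Proof. by move=> f0'; rewrite fgn// fnE. Qed.

Let Lgn n : L1 P (gn n).
Proof.
apply: (@le_L1 _ _ _ _ _ (fun=> n%:R)); last exact: L1_cst.
  apply: measurable_maxr => //; apply: measurable_minr => //.
  apply: measurableT_comp => //; exact: measurable_maxe.
move=> w; rewrite /gn ler_norml le_max lexx orbT /= ge_max.
by rewrite ge_min !ler0n !orbT/= (le_trans _ (ler0n _ n))// oppr_le0 ler0n.
Qed.

Let cn n := cexp (fn n).

Let cnP n : ceG (gn n) (cn n).
Proof.
apply: condexp_ce => //; apply: filterS f0 => w f0' _.
by rewrite fgn.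
Qed.

(** The truncations decrease, so the limit is an infimum. *)
Lemma condexp_nposE : {ae P, forall w,
  condexp_npos P (sigma_at F tau) f w = einfs (fun n => (cn n w)%:E) 0%N}.
Proof.
have mon : {ae P, forall w, forall n, cn n.+1 w <= cn n w}.
  apply: ae_foralln => n; apply: (ce_le sG Gm (cnP n.+1) (cnP n)) => A hA.
  apply: le_integral_L1 => //; first exact: Gm.
  apply: filterS f0 => w f0'; rewrite -lee_fin !gnE//.
  by rewrite ge_max !le_max lexx /= lee_fin lerN2 ler_nat leqnSn orbT.
apply: filterS mon => w mon; rewrite /condexp_npos.
apply: cvg_lim => //.
have -> : einfs (fun n => (cn n w)%:E) 0%N = ereal_inf (range (fun n => (cn n w)%:E)).
  rewrite /einfs /=; congr ereal_inf; apply/seteqP; split => x [n _ <-]; by exists n.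
apply: ereal_nonincreasing_cvgn; apply/nonincreasing_seqP => n. by rewrite lee_fin; exact: mon.
Qed.

Lemma condexp_npos_measurable : measurable_fun setT (fun w => einfs (fun n => (cn n w)%:E) 0%N).
Proof.
apply: measurable_fun_einfs => n; apply/measurable_EFinP.
by apply: (measurable_wrt_fun Gm); case: (cnP n).
Qed.

(** E[f | F_tau] is a lower bound of E[p | F_tau] for integrable p above f. *)
Lemma condexp_npos_le p Q : L1 P p -> {ae P, forall w, (f w <= (p w)%:E)%E} -> ceG p Q ->
  {ae P, forall w, (condexp_npos P (sigma_at F tau) f w <= (Q w)%:E)%E}.
Proof.
move=> Lp fp cQ.
pose u n w := Num.max (p w) (- n%:R).
have Lu n : L1 P (u n) by exact: L1_max.
have cU n := L1_condexp stau (Lu n).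
apply: (le_condexp_lim Lu cU Lp cQ (L1_abs Lp)).
- apply: aeW => w; apply: cvg_near_cst; exists (Num.truncn `|p w|).+1 => // n /= hn.
  apply/max_idPl; rewrite lerNl (le_trans (ler_norm _))// normrN.
  by rewrite (le_trans (ltW (truncnS_gt _)))// ler_nat.
- apply: aeW => w n; rewrite /u; case: (leP (p w) (- n%:R)) => h //.
  have n0 : 0 <= n%:R :> R by [].
  by rewrite normrN ger0_norm// -normrN (le_trans _ (ler_norm _))// lerNr.
- move=> n; have h := ce_le sG Gm (cnP n) (cU n).
  have {}h : {ae P, forall w, cn n w <= cexp (u n) w}.
    apply: h => A hA; apply: le_integral_L1 => //; first exact: Gm.
    apply: filterS2 f0 fp => w f0' fp'; rewrite -lee_fin gnE// /u ge_max.
    rewrite lee_fin le_max lexx orbT andbT (le_trans fp')// lee_fin le_max lexx//.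
  apply: filterS2 condexp_nposE h => w -> h.
  by apply: le_trans (einfs0_le _ n) _; rewrite lee_fin.
Qed.

(** E[f | F_tau] is above any lower bound Z of conditional expectations E[p j | F_tau],
    where the p j >= f have an integrable common bound and tend to f from above. *)
Lemma le_condexp_npos (Z : Omega -> \bar R) (p Q : nat -> Omega -> R) (g : Omega -> R) :
  (forall j, L1 P (p j)) -> L1 P g -> (forall j, ceG (p j) (Q j)) ->
  (forall j, {ae P, forall w, (f w <= (p j w)%:E)%E}) ->
  {ae P, forall w, forall j, p j w <= g w} ->
  {ae P, forall w, forall x, (f w < x)%E -> exists j0, forall j, (j0 <= j)%N -> ((p j w)%:E < x)%E} ->
  (forall j, {ae P, forall w, (Z w <= (Q j w)%:E)%E}) ->
  {ae P, forall w, (Z w <= condexp_npos P (sigma_at F tau) f w)%E}.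
Proof.
move=> Lp Lg cQ fp pg fx ZQ.
suff h n : {ae P, forall w, (Z w <= (cn n w)%:E)%E}.
  by apply: filterS2 condexp_nposE (ae_foralln h) => w ->; exact: le_einfs0.
pose u j w := Num.max (p j w) (- n%:R).
have Lu j : L1 P (u j) by exact: L1_max.
have cU j := L1_condexp stau (Lu j).
apply: (le_condexp_lim Lu cU (Lgn n) (cnP n) (L1D (L1_abs Lg) (L1_cst P n%:R))).
- apply: filterS3 f0 (ae_foralln fp) fx => w f0' fp' fx'.
  apply/cvgrPdist_le => eps eps0.
  have gE := gnE n f0'.
  have [|j0 hj0] := fx' (gn n w + eps)%:E.
    rewrite EFinD gE; apply: le_lt_trans (_ : (Order.max (f w) (- n%:R)%:E < _)%E).
      by rewrite le_max lexx.
    by rewrite -gE -EFinD lte_fin ltrDl.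
  exists j0 => // j /= /hj0; rewrite lte_fin => hj.
  have h1 : gn n w <= u j w.
    by rewrite -lee_fin gE /u ge_max lee_fin le_max lexx orbT andbT (le_trans (fp' j))// lee_fin le_max lexx.
  have h2 : - n%:R <= gn n w by rewrite -lee_fin gE le_max lexx orbT.
  rewrite distrC ger0_norm ?subr_ge0// lerBlDl /u ge_max (ltW hj) /=.
  by rewrite (le_trans h2)// lerDl ltW.
- apply: filterS pg => w pg' j; rewrite ler_norml /u le_max ge_max.
  have := pg' j; have := ler_norm (g w); have := normr_ge0 (g w); have : 0 <= n%:R :> R by [].
  by move=> ? ? ? ?; apply/andP; split; [apply/orP; right|apply/andP; split]; lra.
- move=> j; have {}h := ce_le sG Gm (cQ j) (cU j).
  have {}h : {ae P, forall w, Q j w <= cexp (u j) w}.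
    apply: h => A hA; apply: le_integral_L1 => //; first exact: Gm.
    by apply: aeW => w; rewrite le_max lexx.
  by apply: filterS2 (ZQ j) h => w h1 h2; apply: le_trans h1 _; rewrite lee_fin.
Qed.

End npos.
End CondexpLimits.

(** * The decomposition of the penalty *)

Section PenaltyDecomposition.
Context {R : realType} {d : measure_display} {Omega : measurableType d}.
Variables (P : probability Omega R) (F : nat -> set (set Omega)) (T : natbar).
Variable phi : nat -> (nat -> Omega -> R) -> Omega -> R.
Hypothesis hF : is_filtration P F.
Hypothesis hphi : concave_muf_process P F T phi.

Local Notation horizon := (fun=> T).
Local Notation Ron := (Ron P F T).
Local Notation acc := (acceptance P F T phi).
Local Notation has_dens := (has_dens P T).
Local Notation pairing := (pairing P F).
Local Notation phi_sharp := (phi_sharp P F T phi).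
Local Notation D_on sigma := (D_on P F sigma horizon).
Hypothesis htc : time_consistent P F T phi.
Hypothesis hrep : dual_representation P F T phi.
Variables tau theta : Omega -> natbar.
Hypotheses (stau : stopping_time F tau) (sth : stopping_time F theta).
Hypotheses (ftau : {ae P, forall w, tau w <> None}) (fth : {ae P, forall w, theta w <> None}).
Hypotheses (tth : stopping_le P tau theta) (thT : stopping_le P theta horizon).
Variable a : nat -> Omega -> R.
Hypothesis ha : D_on tau a.

Let tauT : stopping_le P tau horizon.
Proof. by apply: filterS2 tth thT => w; exact: natbar_le_trans. Qed.

Let f := phi_sharp theta a.
Let C := condexp_npos P (sigma_at F tau) f.
Let L := phi_sharp tau a.
Let cc b := concat P F theta setT a b.
Let Sset := [set phi_sharp tau (cc b) | b in D_on theta].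
Let S := esssup P Sset.
Local Notation cexp := (condexp P (sigma_at F tau)).

Let mL : measurable_fun setT L.
Proof. by have [] := phi_sharpP hF hphi stau tauT ftau a. Qed.

Let mf : measurable_fun setT f.
Proof. by have [] := phi_sharpP hF hphi sth thT fth a. Qed.

Let ex_e : exists2 e, has_dens tau a e &
  forall A, sigma_at F tau A -> (\int[P]_(w in A) (mass e w)%:E = P A)%E.
Proof. exact: (D_has_dens hF stau tauT ha). Qed.

Let f0 : {ae P, forall w, (f w <= 0)%E}.
Proof.
have [e he _] := ex_e.
by apply: filterS2 (phi_sharp_le hF hphi sth thT fth a (acc0 hF hphi sth thT fth))
  (pairing_zero hF sth he) => w + E; rewrite E.
Qed.

Let Lpair sigma X : stopping_time F sigma -> Ron sigma X -> L1 P (pairing sigma horizon X a).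
Proof.
move=> st rX; have [e he _] := ex_e; have [X' bX XX] := Ron_version hF rX.
by have [] := pairing_Ron hF st he rX bX XX.
Qed.

Let SP : is_esssup P Sset S.
Proof.
apply: esssupP.
  have [b bD _] := near_optimal_density hF hphi hrep sth thT fth ltr01.
  by exists (phi_sharp tau (cc b)); exists b.
by move=> _ [b _ <-]; have [] := phi_sharpP hF hphi stau tauT ftau (cc b).
Qed.

Let accR sigma X : stopping_time F sigma -> stopping_le P sigma horizon -> acc sigma X -> Ron sigma X.
Proof. by move=> st sT /(accP phi hF _ st sT)[]. Qed.

Let mC0 : measurable_fun setT (fun w => einfs (fun n => (cexp (fun w => fine (Order.max (f w) (- n%:R)%:E)) w)%:E) 0%N).
Proof. exact: condexp_npos_measurable. Qed.

Lemma phi_sharp_ge : {ae P, forall w, (S w + C w <= L w)%E}.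
Proof.
have [e he me] := ex_e.
have [_ _ maxL] := phi_sharpP hF hphi stau tauT ftau a.
have CE := condexp_nposE hF stau mf f0.
have mC := mC0; set C' := (fun w => einfs _ _) in mC; have [mS _ minS] := SP.
have mSC : measurable_fun setT (fun w => S w + C' w)%E by exact: emeasurable_funD.
have := maxL _ mSC; move=> h.
suff /h : forall g, [set (fun w => (pairing tau horizon X a w)%:E) | X in acc tau] g ->
    {ae P, forall w, (S w + C' w <= g w)%E}.
  by apply: filterS2 CE => w; rewrite /C => ->.
move=> _ [X aX <-].
have [X1 [X2 [v [[aX1 mv [m vm] X1v] aX2 XX _]]]] :=
  acc_decomposition hF hphi htc stau sth ftau fth tth thT aX.
have rX := accR stau tauT aX; have rX1 := accR stau tauT aX1; have rX2 := accR sth thT aX2.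
have S1 : {ae P, forall w, (S w <= (pairing tau horizon X1 a w)%:E)%E}.
  apply: minS; first exact: pairing_measurable.
  move=> _ [b bD <-]; have [g hg mg] := D_has_dens hF sth thT bD.
  have h1 := phi_sharp_le hF hphi stau tauT ftau (cc b) aX1.
  have h2 := pairing_concat_frozen hF stau sth fth tth he hg mg rX1 mv vm X1v.
  apply: filterS2 h1 h2 => w + E.
  by rewrite E.
have L2 := Lpair sth rX2; have cQ := L1_condexp hF stau L2.
have C2 := condexp_npos_le hF stau mf f0 L2 (phi_sharp_le hF hphi sth thT fth a aX2) cQ.
apply: filterS3 (filterI S1 C2) CE
  (pairing_split hF stau sth tth he rX rX1 rX2 XX cQ) => w [s1 c2] ce -> .
by rewrite EFinD; apply: leeD => //; move: c2; rewrite ce.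
Qed.

(** If all the sums X1 + Y are acceptable, the penalty of a exceeds the value of X1
    by at most E[phi_sharp theta a | F_tau]: let Y run through positions whose values
    at theta tend to the essential infimum. *)
Lemma phi_sharp_head X1 : (forall Y, acc theta Y -> acc tau (fun s w => X1 s w + Y s w)) ->
  Ron tau X1 ->
  {ae P, forall w, (L w - (pairing tau horizon X1 a w)%:E <= C w)%E}.
Proof.
move=> hX1 rX1; have [e he me] := ex_e.
have [Z [Y [aZ aY YZ Yf]]] := phi_sharp_approx hF hphi sth fth thT he.
have rY j := accR sth thT (aY j).
apply: (le_condexp_npos hF stau mf f0 (p := fun j => pairing theta horizon (Y j) a)
  (Q := fun j => cexp (pairing theta horizon (Y j) a)) _ (Lpair sth (accR sth thT aZ))) => //.
- by move=> j; exact: Lpair.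
- by move=> j; apply: (L1_condexp hF stau); exact: Lpair.
- by move=> j; exact: (phi_sharp_le hF hphi sth thT fth a (aY j)).
- move=> j; have aXY := hX1 _ (aY j).
  have cQ := L1_condexp hF stau (Lpair sth (rY j)).
  apply: filterS2 (phi_sharp_le hF hphi stau tauT ftau a aXY)
   (pairing_split hF stau sth tth he (accR stau tauT aXY) rX1 (rY j)
     (aeW P (fun _ _ => erefl)) cQ) => w + E.
  by rewrite E EFinD addeC leeBlDr.
Qed.

Lemma phi_sharp_le_sum : {ae P, forall w, (L w <= S w + C w)%E}.
Proof.
have [e he me] := ex_e.
have CE := condexp_nposE hF stau mf f0.
have mC := mC0; set C' := (fun w => einfs _ _) in mC; have [mS Sle _] := SP.
(* X1 has a finite value, so C' may be moved to the left even if it is -oo *)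
have Zd X1 : (forall Y, acc theta Y -> acc tau (fun s w => X1 s w + Y s w)) -> Ron tau X1 ->
    {ae P, forall w, (L w - C' w <= (pairing tau horizon X1 a w)%:E)%E}.
  move=> h rX1; apply: filterS2 (phi_sharp_head h rX1) CE => w hd ce; move: hd; rewrite /C ce -/(C' w).
  case: (L w) (C' w) => [l| |] [c| |] //=; rewrite ?leNye//.
  by rewrite !lee_fin lerBlDr lerBlDl.
have ZS k : {ae P, forall w, (L w - C' w - (k.+1%:R^-1)%:E <= S w)%E}.
  have eps0 : 0 < k.+1%:R^-1 :> R by rewrite invr_gt0.
  set eps : R := k.+1%:R^-1 in eps0 *.
  have [b bD hb] := near_optimal_density hF hphi hrep sth thT fth eps0.
  have [g hg mg] := D_has_dens hF sth thT bD.
  have [_ _ maxb] := phi_sharpP hF hphi stau tauT ftau (cc b).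
  have := Sle (phi_sharp tau (cc b)); have Sb : Sset (phi_sharp tau (cc b)) by exists b.
  move=> /(_ Sb); apply: filterS2; last first.
    apply: (maxb (fun w => L w - C' w - eps%:E)%E).
      by apply: emeasurable_funB => //; exact: emeasurable_funB.
    move=> _ [X aX <-].
    have [X1 [X2 [v [[aX1 mv [m vm] X1v] aX2 XX hX1]]]] :=
      acc_decomposition hF hphi htc stau sth ftau fth tth thT aX.
    have rX := accR stau tauT aX; have rX1 := accR stau tauT aX1; have rX2 := accR sth thT aX2.
    apply: filterS2 (Zd _ hX1 rX1)
      (pairing_concat_lower hF stau sth fth tth he hg mg (ltW eps0) me rX rX1 rX2 mv vm X1v XX (hb _ aX2)) => w h1 h2.
    have h3 := leeB h1 (lexx eps%:E).
    apply: le_trans h3 _.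
    by rewrite -EFinB lee_fin.
  by move=> w h1 h2; exact: le_trans h1 h2.
(* some frozen part, needed to see that L = -oo where C = -oo *)
have [X1 [hX1 rX1]] : exists X1, (forall Y, acc theta Y -> acc tau (fun s w => X1 s w + Y s w)) /\ Ron tau X1.
  have [X1 [X2 [v [[aX1 _ _ _] _ _ h]]]] :=
    acc_decomposition hF hphi htc stau sth ftau fth tth thT (acc0 hF hphi stau tauT ftau).
  by exists X1; split => //; exact: accR.
have C0 : {ae P, forall w, (C w < +oo)%E}.
  have [X2 aX2] : exists X2, acc theta X2 by exists (fun _ _ => 0); exact: (acc0 hF hphi).
  have L2 := Lpair sth (accR sth thT aX2); have cQ := L1_condexp hF stau L2.
  have C2 := condexp_npos_le hF stau mf f0 L2 (phi_sharp_le hF hphi sth thT fth a aX2) cQ.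
  by apply: filterS C2 => w h; apply: le_lt_trans h (ltry _).
apply: filterS3 (filterI C0 CE) (phi_sharp_head hX1 rX1) (ae_foralln ZS) => w [c0 ce] hd hs.
have {}hs : (L w - C w <= S w)%E.
  rewrite /C ce -/(C' w); apply/lee_addgt0Pr => eps eps0.
  have h := hs (Num.truncn eps^-1); rewrite leeBlDr// in h.
  apply: le_trans h _; rewrite leeD2l// lee_fin invf_ple ?posrE//.
  by rewrite ltW// truncnS_gt.
move: c0 hd hs; case: (C w) => [c| |] // _ hd hs.
  by rewrite -leeBlDr.
move: hd; case: (L w) => [l| |] //= _; by rewrite leNye.
Qed.

End PenaltyDecomposition.

Theorem theorem4p19 (R : realType) (d : measure_display)
    (Omega : measurableType d) (P : probability Omega R)
    (F : nat -> set (set Omega)) (T : natbar)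
    (phi : nat -> (nat -> Omega -> R) -> Omega -> R)
    (hF : is_filtration P F)
    (hphi : concave_muf_process P F T phi)
    (htc : time_consistent P F T phi)
    (hrep : dual_representation P F T phi)
    (tau theta : Omega -> natbar)
    (htau : finite_stopping_time P F tau)
    (htheta : finite_stopping_time P F theta)
    (htau_theta : stopping_le P tau theta)
    (htheta_T : stopping_le P theta (fun=> T))
    (a : nat -> Omega -> R)
    (ha : D_on P F tau (fun=> T) a) :
  phi_sharp P F T phi tau a =
  (fun w =>
    esssup P [set phi_sharp P F T phi tau (concat P F theta setT a b)
             | b in D_on P F theta (fun=> T)] w
    + condexp_npos P (sigma_at F tau) (phi_sharp P F T phi theta a) w)%E
  %[ae P].
Proof.
case: htau htheta => stau ftau [sth fth].
apply: filterS2 (phi_sharp_ge hF hphi htc hrep stau sth ftau fth htau_theta htheta_T ha)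
  (phi_sharp_le_sum hF hphi htc hrep stau sth ftau fth htau_theta htheta_T ha) => w h1 h2 _.
by apply/eqP; rewrite eq_le h2.
Qed.
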